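(* Let $k$ be a field. For the cover ideal $J(G)\subseteq k[V(G)]$ of a finite simple graph $G$, the following conditions are equivalent: (i) $J(G)$ is not Golod; (ii) $J(G)$ is a complete intersection of two monomials of degree at least two; (iii) $G=K_{m,n}$ is a complete bipartite graph with $\min\{m,n\}\ge 2$.
   Context: $k[V(G)]$ is the standard graded polynomial ring over $k$ whose variables are the vertices of $G$. A vertex cover of $G$ is a subset $V\subseteq V(G)$ such that every edge of $G$ has at least one endpoint in $V$. The cover ideal $J(G)$ is the monomial ideal generated by the monomials $\prod_{x\in A}x$, where $A$ ranges over the minimal (with respect to inclusion) vertex covers of $G$; one has $J(G)=\bigcap_{\{x,y\}\in E(G)}(x,y)$. A graph $G$ is complete bipartite, denoted $K_{m,n}$, if $V(G)=A\sqcup B$ with $|A|=m$, $|B|=n$, where $A$ and $B$ are independent sets (no two vertices of the set are joined by an edge) and $E(G)=\{\{x,y\}: x\in A,\ y\in B\}$. Golod: let $R$ be a standard graded $k$-algebra with homogeneous maximal ideal $\mathfrak m$, let $\operatorname{edim}(R)=\dim_k(\mathfrak m/\mathfrak m^2)$, and let $K^R$ be the Koszul complex on a minimal generating set of $\mathfrak m$. $R$ is Golod if $$\sum_{i\ge 0}\dim_k\operatorname{Tor}_i^R(k,k)\,z^i=\frac{(1+z)^{\operatorname{edim}(R)}}{1-\sum_{j\ge1}\dim_k H_j(K^R)\,z^{j+1}}.$$ A homogeneous ideal $I$ of a standard graded polynomial ring $Q$ over $k$ is called Golod if $Q/I$ is Golod.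
   Formalization: (ii)⇔(iii) is stated for graphs without isolated vertices, since K_{2,2} plus an isolated vertex satisfies (ii) but not (iii); (i)⇔(ii) is for all finite simple graphs, with the unit ideal (edgeless G) counted as Golod. *)

(* Defs.v *)
From HB Require Import structures.
From mathcomp Require Import all_boot all_order all_algebra.
From mathcomp Require Export mpoly.

Set Implicit Arguments.
Unset Strict Implicit.
Unset Printing Implicit Defensive.

Import GRing.Theory.
Local Open Scope ring_scope.
Local Open Scope quotient_scope.

Definition ideal_gen (R : comNzRingType) (S : R -> Prop) (x : R) : Prop :=
  exists (r : nat) (a g : 'I_r -> R),
    (forall i, S (g i)) /\ x = \sum_(i < r) a i * g i.

Definition regular_seq (R : comNzRingType) (s : seq R) : Prop :=
  (forall i, (i < size s)%N -> forall p : R,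
     ideal_gen (fun z => z \in take i s) (s`_i * p) ->
     ideal_gen (fun z => z \in take i s) p)
  /\ ~ ideal_gen (fun z => z \in s) 1.

Section Golod.

(* [R] is a k-algebra with structure map [iota] and [m] is its distinguished
   maximal ideal, with R = k + m, so that the residue field R/m is k. *)
Variables (k : fieldType) (R : comNzRingType) (iota : {rmorphism k -> R}).
Variable m : R -> Prop.

(* dim_k (U / W) = d, for k-subspaces W <= U of an R-module V, on which k acts
   through [iota]: the classes of the b i form a k-basis of U / W. *)
Definition dim_subquot (V : lmodType R) (U W : V -> Prop) (d : nat) : Prop :=
  exists2 b : 'I_d -> V, (forall i, U (b i)) &
    forall u, U u ->
      exists! c : {ffun 'I_d -> k}, W (u - \sum_(i < d) iota (c i) *: b i).

Definition ideal_square : R -> Prop :=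
  ideal_gen (fun z => exists x y, [/\ m x, m y & z = x * y]).

Definition edim (e : nat) : Prop := @dim_subquot R^o m ideal_square e.

(* The exterior algebra of R^e, a form being given by its coordinates in the
   basis e_S = e_(s1) /\ ... /\ e_(sj), for S = {s1 < ... < sj}. *)
Definition koszul (e : nat) := {ffun {set 'I_e} -> R^o}.

Definition koszul_deg (e j : nat) (f : koszul e) : Prop :=
  forall S : {set 'I_e}, #|S| != j -> f S = 0.

(* The linear map with d(e_S) = \sum_(s in S) (-1)^(#{t in S, t < s}) x_s e_(S \ s),
   read off on the coefficient of e_T. *)
Definition koszul_diff (e : nat) (x : 'I_e -> R) (f : koszul e) : koszul e :=
  [ffun T : {set 'I_e} => \sum_(s < e | s \notin T)
     (-1) ^+ #|[set t in T | (t < s)%N]| * x s * f (s |: T)].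

Definition koszul_homology_dim (e : nat) (x : 'I_e -> R) (j d : nat) : Prop :=
  @dim_subquot (koszul e)
    (fun f => koszul_deg j f /\ koszul_diff x f = 0)
    (fun f => exists2 g, koszul_deg j.+1 g & f = koszul_diff x g) d.

(* A resolution ... -> R^(b 1) -> R^(b 0) -> R/m -> 0 by free modules of finite
   rank.  The differential R^(b i.+1) -> R^(b i) is u |-> u *m D i and the
   augmentation sends u to the class of u *m a modulo m. *)
Definition free_resolution (b : nat -> nat)
    (D : forall i, 'M[R]_(b i.+1, b i)) (a : 'cV[R]_(b 0)) : Prop :=
  [/\ exists u : 'rV[R]_(b 0), m ((u *m a) 0 0 - 1),
      forall u : 'rV[R]_(b 0),
        m ((u *m a) 0 0) <-> exists w, u = w *m D 0 &
      forall i (u : 'rV[R]_(b i.+1)),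
        u *m D i = 0 <-> exists w, u = w *m D i.+1].

Definition entries_in (b : nat) (u : 'rV[R]_b) : Prop := forall j, m (u 0 j).

(* Cycles and boundaries of F (x)_R R/m = F / mF, lifted to F. *)
Definition tensor_cycle (b : nat -> nat) (D : forall i, 'M[R]_(b i.+1, b i))
    (i : nat) : 'rV[R]_(b i) -> Prop :=
  match i with
  | 0 => fun=> True
  | i'.+1 => fun u => entries_in (u *m D i')
  end.

Definition tensor_boundary (b : nat -> nat) (D : forall i, 'M[R]_(b i.+1, b i))
    (i : nat) (u : 'rV[R]_(b i)) : Prop :=
  exists w : 'rV[R]_(b i.+1), entries_in (u - w *m D i).

(* dim_k Tor_i^R(k, k) = d, where k = R/m. *)
Definition tor_dim (i d : nat) : Prop :=
  exists b D a, @free_resolution b D a /\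
    @dim_subquot 'rV[R]_(b i) (@tensor_cycle b D i) (@tensor_boundary b D i) d.

Definition series_mul (f g : nat -> int) (n : nat) : int :=
  \sum_(i < n.+1) f i * g (n - i)%N.

(* Coefficients of 1 - \sum_(j >= 1) h_j z^(j+1). *)
Definition golod_denom (h : nat -> nat) (n : nat) : int :=
  match n with
  | 0 => 1
  | 1 => 0
  | j.+2 => - (h j.+1)%:Z
  end.

(* The denominator is invertible in Z[[z]], so the identity is stated after
   multiplying by it.  A minimal generating set of m is a generating family
   with edim(R) members (irredundancy alone would not suffice if
   inhomogeneous generators are allowed). *)
Definition golod : Prop :=
  exists (e : nat) (x : 'I_e -> R) (t h : nat -> nat),
    [/\ edim e,
        forall r, m r <-> ideal_gen (fun z => exists i, z = x i) r,
        forall i, tor_dim i (t i),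
        forall j, koszul_homology_dim x j (h j) &
        forall n, series_mul (fun i => (t i)%:Z) (golod_denom h) n
                  = 'C(e, n)%:Z].

End Golod.

Section GolodIdeal.

Variables (k : fieldType) (n : nat).

Definition quot_const (I : idealr {mpoly k[n]}) :
    {rmorphism k -> {ideal_quot I}} :=
  \pi_({ideal_quot I}) \o @mpolyC n k.

Definition quot_max_ideal (I : idealr {mpoly k[n]}) : {ideal_quot I} -> Prop :=
  ideal_gen (fun r => exists i : 'I_n, r = \pi_({ideal_quot I}) 'X_i).

(* For homogeneous I.  An [idealr] is a boolean proper ideal; by extensionality
   at most one of them represents I, and one does as soon as 1 is not in I.
   The unit ideal, whose quotient is not a standard graded algebra, counts as
   Golod. *)
Definition golod_ideal (I : {mpoly k[n]} -> Prop) : Prop :=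
  forall I' : idealr {mpoly k[n]}, (forall p, p \in I' <-> I p) ->
    golod (quot_const I') (@quot_max_ideal I').

Definition complete_intersection_two_monomials (I : {mpoly k[n]} -> Prop) :
    Prop :=
  exists u v : 'X_{1..n},
    [/\ (2 <= mdeg u)%N, (2 <= mdeg v)%N,
        regular_seq [:: 'X_[k, u]; 'X_[v]] &
        forall p, I p <-> ideal_gen (fun z => z \in [:: 'X_[k, u]; 'X_[v]]) p].

End GolodIdeal.

Section Graph.

Variables (V : finType) (G : rel V).

Definition vertex_cover (A : {set V}) : bool :=
  [forall x, forall y, G x y ==> (x \in A) || (y \in A)].

(* k[V(G)] is the polynomial ring in #|V| variables, the vertex x being the
   variable of index [enum_rank x]. *)
Definition cover_ideal (k : fieldType) : {mpoly k[#|V|]} -> Prop :=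
  ideal_gen (fun p => exists2 A : {set V}, minset vertex_cover A &
                        p = \prod_(x in A) 'X_(enum_rank x)).

Definition complete_bipartite (m n : nat) : Prop :=
  exists A B : {set V},
    [/\ [disjoint A & B], A :|: B = [set: V], #|A| = m, #|B| = n &
        forall x y, G x y = (x \in A) && (y \in B) || (x \in B) && (y \in A)].

(* Minimal vertex covers avoid isolated vertices, so J(G) only determines G up to
   these: for K_(2,2) plus an isolated vertex, J(G) = (a * b, c * d). *)
Definition no_isolated_vertex : Prop := forall x, exists y, G x y.

End Graph.

Arguments cover_ideal {V} G k p.

(* Main.v *)
(* (ii) and, without isolated vertices, (iii) mean that G has disjoint vertex covers A
   and B, with at least two vertices each, such that all pairs in A x B are edges.  Then
   J(G) = (x^A, x^B), and the Betti numbers of the Tate resolution of k over the quotient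
   violate the Golod series in degree 4.

   Otherwise the Koszul homology, which lives in squarefree degrees, has a homogeneous
   basis of cycles whose pairwise products have no squarefree component: only products
   in degrees A and B for disjoint minimal covers A, B matter; there is a non-edge {a, b}
   between A and B, and the cycles x^(A - a) e_a and x^(B - b) e_b have product 0 because
   the complement of {a, b} is still a cover.  The elements without squarefree component
   form an acyclic ideal of the Koszul complex, inside which all Massey products can be
   trivialised; the resulting resolution of k has the Golod series. *)

Require Import Defs.
From HB Require Import structures.
From mathcomp Require Import all_boot all_order all_algebra.
From mathcomp Require Import ring zify.
From Stdlib Require Import Classical ClassicalEpsilon FunctionalExtensionality.

Set Implicit Arguments.
Unset Strict Implicit.
Unset Printing Implicit Defensive.

Import GRing.Theory.
Local Open Scope ring_scope.
Local Open Scope quotient_scope.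

(** * The Koszul complex *)

Section ExteriorSigns.

Variable e : nat.
Implicit Types (A B C T : {set 'I_e}) (s t : 'I_e).

(** [golod] only asks for some resolution in each degree: proving it takes one explicit minimal
    resolution, refuting it also requires that the dimensions of Tor do not depend on the
    resolution. Both explicit resolutions are Koszul complexes tensored with a graded free module,
    on words in the Golod case and on divided powers in the Tate case, and share the passage to
    matrices. The ring is accessed through coefficients of monomials and an upward closed family of
    nonfaces, the covers. In each multidegree the Koszul complex is a complex of subsets over k, and
    most vanishing statements say that it is a cone over some vertex. The obstacle on the Golod side
    is that products of classes being zero in homology is not enough; representatives are needed
    whose products vanish in squarefree degrees on the nose. The vertex removed from a minimal cover
    must then be chosen coherently for all pairs. This is possible because two disjoint minimal
    covers partition the non-isolated vertices: each determines the other, and one non-edge serves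
    both. *)

Definition nbelow s T : nat := #|[set t in T | (t < s)%N]|.

(** The exponent of the sign relating e_A /\ e_B to the basis element of A :|: B, for disjoint A and
    B. *)
Definition inversions A B : nat := \sum_(a in A) nbelow a B.

Lemma nbelowU s A B : [disjoint A & B] ->
  nbelow s (A :|: B) = (nbelow s A + nbelow s B)%N.
Proof.
move=> dAB; rewrite /nbelow -cardsUI.
rewrite [X in (_ + X)%N](_ : _ = 0%N) ?addn0.
  by apply: eq_card => t; rewrite !inE andb_orl.
apply/eqP; rewrite cards_eq0; apply/eqP/setP => t; rewrite !inE.
by apply/negbTE/negP => /andP[/andP[tA _] /andP[tB _]]; have := disjointFr dAB tA; rewrite tB.
Qed.

Lemma nbelow1 s t : nbelow s [set t] = (t < s)%N.
Proof.
rewrite /nbelow; case: (boolP (t < s)%N) => ts.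
  rewrite (_ : [set _ in _ | _] = [set t]) ?cards1 //.
  by apply/setP => u; rewrite !inE; case: eqP => // ->; rewrite ts.
apply/eqP; rewrite cards_eq0; apply/eqP/setP => u; rewrite !inE.
by case: eqP => //= ->; apply/negbTE.
Qed.

Lemma nbelow0 s : nbelow s set0 = 0%N.
Proof.
by apply/eqP; rewrite cards_eq0; apply/eqP/setP => t; rewrite !inE.
Qed.

Lemma inversions1 s T : inversions [set s] T = nbelow s T.
Proof. by rewrite /inversions big_set1. Qed.

Lemma inversions0l T : inversions set0 T = 0%N.
Proof. by rewrite /inversions big_set0. Qed.

Lemma inversionsUl A B C : [disjoint A & B] ->
  inversions (A :|: B) C = (inversions A C + inversions B C)%N.
Proof.
move=> dAB; rewrite /inversions (eq_bigl (fun i => (i \in A) || (i \in B))).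
  by rewrite bigU.
by move=> i; rewrite inE.
Qed.

Lemma inversionsUr A B C : [disjoint B & C] ->
  inversions A (B :|: C) = (inversions A B + inversions A C)%N.
Proof.
move=> dBC; rewrite /inversions -big_split /=.
by apply: eq_bigr => a _; rewrite nbelowU.
Qed.

End ExteriorSigns.

Section KoszulAlgebra.

Variables (R : comNzRingType) (e : nat).
Local Notation K := (koszul R e).
Implicit Types (A B C T S : {set 'I_e}) (s t : 'I_e) (a b c f g : K).

Definition kmul a b : K :=
  [ffun T : {set 'I_e} => \sum_(A : {set 'I_e} | A \subset T)
     (-1) ^+ inversions A (T :\: A) * ((a A : R) * (b (T :\: A) : R))].

(** The degree involution. It carries the sign of the Leibniz rule, which can then be stated without
    homogeneity of the left factor. *)
Definition kbar a : K := [ffun T : {set 'I_e} => (-1) ^+ #|T| * (a T : R)].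

Definition kbasis A : K := [ffun T : {set 'I_e} => ((T == A)%:R : R)].

Lemma kmulDl a b c : kmul (a + b) c = kmul a c + kmul b c.
Proof.
apply/ffunP => T; rewrite !ffunE -big_split /=.
by apply: eq_bigr => A _; rewrite ffunE mulrDl mulrDr.
Qed.

Lemma kmulDr a b c : kmul a (b + c) = kmul a b + kmul a c.
Proof.
apply/ffunP => T; rewrite !ffunE -big_split /=.
by apply: eq_bigr => A _; rewrite ffunE mulrDr mulrDr.
Qed.

Lemma kmulZl r a b : kmul (r *: a) b = r *: kmul a b.
Proof.
apply/ffunP => T; rewrite !ffunE scaler_sumr.
apply: eq_bigr => A _; rewrite ffunE -!mulrA [in LHS]mulrCA.
by [].
Qed.

Lemma kmulZr r a b : kmul a (r *: b) = r *: kmul a b.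
Proof.
apply/ffunP => T; rewrite !ffunE scaler_sumr.
apply: eq_bigr => A _; rewrite ffunE.
by rewrite [X in _ * X = _]mulrCA [LHS]mulrCA.
Qed.

Lemma kbarD a b : kbar (a + b) = kbar a + kbar b.
Proof. by apply/ffunP => T; rewrite !ffunE mulrDr. Qed.

Lemma kbarZ r a : kbar (r *: a) = r *: kbar a.
Proof. by apply/ffunP => T; rewrite !ffunE mulrCA. Qed.

Lemma kmul0l a : kmul 0 a = 0.
Proof. by rewrite -[X in kmul X](scale0r 0) kmulZl scale0r. Qed.

Lemma kmul0r a : kmul a 0 = 0.
Proof. by rewrite -[X in kmul a X](scale0r 0) kmulZr scale0r. Qed.

Lemma kbar0 : kbar 0 = 0.
Proof. by rewrite -[X in kbar X](scale0r 0) kbarZ scale0r. Qed.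

Lemma kmul_sumr (I : Type) (r : seq I) P (F : I -> K) a :
  kmul a (\sum_(i <- r | P i) F i) = \sum_(i <- r | P i) kmul a (F i).
Proof. exact: (big_morph (kmul a) (kmulDr a) (kmul0r a)). Qed.

Lemma kmul_suml (I : Type) (r : seq I) P (F : I -> K) a :
  kmul (\sum_(i <- r | P i) F i) a = \sum_(i <- r | P i) kmul (F i) a.
Proof. exact: (big_morph (kmul^~ a) (fun b c => kmulDl b c a) (kmul0l a)). Qed.

Lemma kmulNl a b : kmul (- a) b = - kmul a b.
Proof. by rewrite -scaleN1r kmulZl scaleN1r. Qed.

Lemma kmulNr a b : kmul a (- b) = - kmul a b.
Proof. by rewrite -scaleN1r kmulZr scaleN1r. Qed.

Lemma kbar_sum (I : Type) (r : seq I) P (F : I -> K) :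
  kbar (\sum_(i <- r | P i) F i) = \sum_(i <- r | P i) kbar (F i).
Proof. exact: (big_morph kbar kbarD kbar0). Qed.

Lemma kbarN a : kbar (- a) = - kbar a.
Proof. by rewrite -scaleN1r kbarZ scaleN1r. Qed.

Lemma kbarK a : kbar (kbar a) = a.
Proof. by apply/ffunP => T; rewrite !ffunE mulrA -expr2 sqrr_sign mul1r. Qed.

(** Both sides sum over ordered partitions of T into three blocks; the signs agree because
    [inversions] is additive over disjoint unions in each argument. *)
Lemma kmulA a b c : kmul a (kmul b c) = kmul (kmul a b) c.
Proof.
apply/ffunP => T; rewrite !ffunE.
under eq_bigr => A AT.
  rewrite ffunE mulr_sumr mulr_sumr.
  over.
under [RHS]eq_bigr => A AT.
  rewrite ffunE mulr_suml mulr_sumr.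
  over.
rewrite [RHS](exchange_big_dep (fun A => A \subset T)) /=; last first.
  by move=> D A DT AD; apply: subset_trans AD DT.
apply: eq_bigr => A AT.
(* The right side is indexed by the union D of the first two blocks; the second block becomes the
   index. *)
rewrite [RHS](reindex_onto (fun B => A :|: B) (fun D => D :\: A)) /=; last first.
  move=> D /andP[DT AD]; apply/setP => s; rewrite !inE.
  by case: (boolP (s \in A)) => // /(subsetP AD) ->.
apply: eq_big => B.
  rewrite subsetUl andbT subUset AT /=.
  rewrite subsetD; congr (_ && _).
  apply/idP/eqP => [dAB|<-].
    apply/setP => s; rewrite !inE; case: (boolP (s \in A)) => //= sA.
    by rewrite (disjointFl dAB sA).
  by rewrite -setI_eq0; apply/eqP/setP => s; rewrite !inE; case: (s \in A) => //; rewrite andbF.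
rewrite subsetD disjoint_sym => /andP[BT dAB].
have EB : (A :|: B) :\: A = B.
  apply/setP => s; rewrite !inE; case: (boolP (s \in A)) => //= sA.
  by rewrite (disjointFr dAB sA).
have ET : T :\: A :\: B = T :\: (A :|: B) by rewrite setDDl.
rewrite EB ET.
set D := T :\: (A :|: B).
have dAD : [disjoint A & D].
  by rewrite -setI_eq0; apply/eqP/setP => s; rewrite !inE; case: (s \in A); rewrite ?andbF.
have dBD : [disjoint B & D].
  by rewrite -setI_eq0; apply/eqP/setP => s; rewrite !inE; case: (s \in B); rewrite ?orbT ?andbF.
have -> : T :\: A = B :|: D.
  apply/setP => s; rewrite !inE; case: (boolP (s \in B)) => [sB|] /=.
    by rewrite (subsetP BT) // (disjointFl dAB sB).
  by rewrite orbF.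
rewrite inversionsUr // inversionsUl //.
rewrite !exprD.
ring.
Qed.

Definition kone : K := kbasis set0.

Lemma kmul1l a : kmul kone a = a.
Proof.
apply/ffunP => T; rewrite !ffunE (bigD1 set0) ?sub0set //= ffunE eqxx mul1r.
rewrite inversions0l expr0 mul1r setD0 big1 ?addr0 // => A /andP[_ A0].
by rewrite ffunE (negbTE A0) mul0r mulr0.
Qed.

Lemma kbarM a b : kbar (kmul a b) = kmul (kbar a) (kbar b).
Proof.
apply/ffunP => T; rewrite !ffunE mulr_sumr; apply: eq_bigr => A AT.
rewrite !ffunE.
have -> : #|T| = (#|A| + #|T :\: A|)%N.
  by rewrite cardsD (setIidPr AT) subnKC // subset_leq_card.
rewrite exprD; ring.
Qed.

Lemma kbasis_sum a : a = \sum_(A : {set 'I_e}) (a A : R) *: kbasis A.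
Proof.
apply/ffunP => T; rewrite sum_ffunE (bigD1 T) //= !ffunE eqxx.
rewrite big1 ?addr0 => [|A]; first by rewrite [LHS](esym (mulr1 (a T : R))).
by rewrite eq_sym !ffunE => /negbTE->; rewrite scaler0.
Qed.

Definition wedge s a : K := kmul (kbasis [set s]) a.

Lemma wedgeE s a T : wedge s a T =
  (if s \in T then (-1) ^+ nbelow s (T :\ s) * (a (T :\ s) : R) else 0 : R).
Proof.
rewrite ffunE; case: (boolP (s \in T)) => sT.
  rewrite (bigD1 [set s]) ?sub1set //= inversions1 ffunE eqxx mul1r.
  by rewrite big1 ?addr0 // => A /andP[_ /negbTE nA]; rewrite ffunE nA mul0r mulr0.
rewrite big1 // => A AT; rewrite ffunE.
by case: eqP => [EA|]; rewrite ?mul0r ?mulr0 //; rewrite EA sub1set (negbTE sT) in AT.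
Qed.

Lemma wedgeA s a b : kmul (wedge s a) b = wedge s (kmul a b).
Proof. by rewrite /wedge kmulA. Qed.

Lemma kbasis_wedge s A : s \in A ->
  kbasis A = ((-1) ^+ nbelow s (A :\ s)) *: wedge s (kbasis (A :\ s)).
Proof.
move=> sA; apply/ffunP => T; rewrite [RHS]ffunE wedgeE !ffunE.
case: (boolP (s \in T)) => sT; last first.
  rewrite scaler0; case: eqP => // ET; by rewrite ET sA in sT.
case: (T =P A) => [->|nTA].
  by rewrite eqxx mulr1 /GRing.scale /= -expr2 sqrr_sign.
case: eqP => [E|]; last by rewrite mulr0 scaler0.
by case: nTA; rewrite -(setD1K sT) E setD1K.
Qed.

Lemma kbar_basis A : kbar (kbasis A) = (-1) ^+ #|A| *: kbasis A.
Proof.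
apply/ffunP => T; rewrite !ffunE; case: eqP => [->//|_].
by rewrite mulr0 scaler0.
Qed.

Lemma wedge_bar s a : kbar (wedge s a) = - wedge s (kbar a).
Proof. by rewrite kbarM kbar_basis cards1 expr1 scaleN1r kmulNl. Qed.

Lemma kmul_deg i j a b : koszul_deg i a -> koszul_deg j b ->
  koszul_deg (i + j) (kmul a b).
Proof.
move=> ai bj T nT; rewrite ffunE big1 // => A AT.
case: (#|A| =P i) => [Ai|/eqP/ai->]; last by rewrite mul0r mulr0.
rewrite (bj (T :\: A)) ?mulr0 // cardsD (setIidPr AT) Ai.
apply: contra nT => /eqP <-; rewrite subnKC // -Ai; exact: subset_leq_card.
Qed.

Lemma kbar_deg i a : koszul_deg i a -> kbar a = (-1) ^+ i *: a.
Proof.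
move=> ai; apply/ffunP => T; rewrite !ffunE.
case: (#|T| =P i) => [->//|/eqP/ai->]; by rewrite mulr0 scaler0.
Qed.

Lemma koszul_degD i a b : koszul_deg i a -> koszul_deg i b -> koszul_deg i (a + b).
Proof. by move=> ai bi T nT; rewrite ffunE ai // bi // addr0. Qed.

Lemma koszul_degZ i r a : koszul_deg i a -> koszul_deg i (r *: a).
Proof. by move=> ai T nT; rewrite ffunE ai // scaler0. Qed.

Lemma koszul_degN i a : koszul_deg i a -> koszul_deg i (- a).
Proof. by move=> ai T nT; rewrite ffunE ai // oppr0. Qed.

Lemma koszul_deg0 i : koszul_deg i (0 : K).
Proof. by move=> T _; rewrite ffunE. Qed.

Lemma koszul_deg_sum i (I : Type) (r : seq I) (P : pred I) (F : I -> K) :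
  (forall j, P j -> koszul_deg i (F j)) -> koszul_deg i (\sum_(j <- r | P j) F j).
Proof.
move=> H; elim/big_rec: _ => [|j a Pj]; first exact: koszul_deg0.
by apply: koszul_degD; exact: H.
Qed.

Lemma koszul_deg_bar i a : koszul_deg i a -> koszul_deg i (kbar a).
Proof. by move=> ai; rewrite (kbar_deg ai); apply: koszul_degZ. Qed.

Lemma kbasis_deg A : koszul_deg #|A| (kbasis A).
Proof. by move=> T nT; rewrite ffunE; case: (T =P A) nT => // ->; rewrite eqxx. Qed.

Section Differential.

Variable x : 'I_e -> R.
Local Notation d := (koszul_diff x).

Lemma koszul_diffE f T : d f T =
  (\sum_(s < e | s \notin T) (-1) ^+ nbelow s T * x s * (f (s |: T) : R) : R).
Proof. by rewrite ffunE. Qed.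

Lemma koszul_diffD a b : d (a + b) = d a + d b.
Proof.
apply/ffunP => T; rewrite koszul_diffE [RHS]ffunE !koszul_diffE -big_split /=.
by apply: eq_bigr => s _; rewrite ffunE mulrDr.
Qed.

Lemma koszul_diffZ r a : d (r *: a) = r *: d a.
Proof.
apply/ffunP => T; rewrite koszul_diffE [RHS]ffunE koszul_diffE scaler_sumr.
by apply: eq_bigr => s _; rewrite ffunE [LHS]mulrCA.
Qed.

Lemma koszul_diff0 : d 0 = 0.
Proof. by rewrite -[X in d X](scale0r 0) koszul_diffZ scale0r. Qed.

Lemma koszul_diffN a : d (- a) = - d a.
Proof. by rewrite -scaleN1r koszul_diffZ scaleN1r. Qed.

Lemma koszul_diff_sum (I : Type) (r : seq I) P (F : I -> K) :
  d (\sum_(i <- r | P i) F i) = \sum_(i <- r | P i) d (F i).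
Proof. exact: (big_morph d koszul_diffD koszul_diff0). Qed.

Lemma koszul_diff_deg i a : koszul_deg i.+1 a -> koszul_deg i (d a).
Proof.
move=> ai T nT; rewrite koszul_diffE big1 // => s sT.
by rewrite ai ?mulr0 // cardsU1 sT add1n eqSS.
Qed.

Lemma koszul_diff_deg0 a : koszul_deg 0 a -> d a = 0.
Proof.
move=> a0; apply/ffunP => T; rewrite koszul_diffE ffunE big1 // => s sT.
by rewrite a0 ?mulr0 // cardsU1 sT add1n.
Qed.

Lemma koszul_diff_bar a : d (kbar a) = - kbar (d a).
Proof.
apply/ffunP => T; rewrite koszul_diffE [RHS]ffunE [kbar _ T]ffunE koszul_diffE.
rewrite mulr_sumr -sumrN; apply: eq_bigr => s sT.
rewrite ffunE cardsU1 sT add1n exprS; ring.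
Qed.

(** The Leibniz rule for one generator. The general rule and d^2 = 0 follow from it by [kbasis_ind],
    so the comparison of signs is confined to this case. *)
Lemma koszul_diff_wedge s a : d (wedge s a) = x s *: a - wedge s (d a).
Proof.
apply/ffunP => T; rewrite koszul_diffE [RHS]ffunE [X in X + _]ffunE [X in _ + X]ffunE.
rewrite wedgeE; case: (boolP (s \in T)) => sT; last first.
  rewrite subr0 (bigD1 s) //= big1 => [|t /andP[tT ts]].
    rewrite addr0 wedgeE setU11 setU1K //.
    by rewrite /GRing.scale /= mulrAC !mulrA -expr2 sqrr_sign mul1r mulrC.
  by rewrite wedgeE !inE (negbTE sT) eq_sym (negbTE ts) mulr0.
rewrite koszul_diffE mulr_sumr [in RHS](bigD1 s) ?setD11 //=.
have E0 : (-1) ^+ nbelow s (T :\ s) * ((-1) ^+ nbelow s (T :\ s) * x s * a T)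
    = x s *: a T :> R by rewrite !mulrA -expr2 sqrr_sign mul1r.
rewrite setD1K // E0 opprD addrA subrr sub0r -sumrN.
apply: eq_big => [t|t tT].
  by rewrite !inE negb_and negbK; case: eqP => [->|] /=; rewrite ?sT ?andbT.
have ts : t != s by apply: contraNneq tT => ->.
rewrite wedgeE inE sT orbT.
have -> : (t |: T) :\ s = t |: (T :\ s).
  by apply/setP => u; rewrite !inE; case: (u =P t) => // ->; rewrite ts.
have dtT : [disjoint [set t] & T :\ s].
  by rewrite disjoints1 !inE (negbTE tT) andbF.
rewrite nbelowU //.
have E1 : nbelow t T = (nbelow t [set s] + nbelow t (T :\ s))%N.
  by rewrite -nbelowU ?setD1K // disjoints1 !inE eqxx.
rewrite E1 !nbelow1 !exprD.
(* Exactly one of s < t and t < s holds: this is the anticommutation of e_s and e_t. *)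
have : (-1 : R) ^+ (s < t)%N * (-1) ^+ (t < s)%N = -1.
  case: (ltngtP s t) => st; rewrite ?expr0 ?expr1 ?mulr1 ?mul1r //.
  by rewrite (val_inj st) eqxx in ts.
set u := (-1) ^+ (s < t)%N; set v := (-1) ^+ (t < s)%N => uv.
set p := (-1) ^+ _; set q := (-1) ^+ _.
transitivity ((u * v) * (p * q * x t * a (t |: T :\ s))); first by ring.
rewrite uv; ring.
Qed.

(** The exterior algebra is spanned by iterated wedges of generators on 1, so a linear statement
    only has to survive one more wedge. *)
Lemma kbasis_ind (P : K -> Prop) :
  P kone -> (forall s a, P a -> P (wedge s a)) ->
  (forall r a, P a -> P (r *: a)) -> (forall a b, P a -> P b -> P (a + b)) ->
  forall a, P a.
Proof.
move=> P1 Pw PZ PD a; rewrite (kbasis_sum a).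
have Pb A : P (kbasis A).
  have [n] := ubnP #|A|; elim: n A => // n IH A; rewrite ltnS => leA.
  have [->//|[s sA]] := set_0Vmem A.
  rewrite (kbasis_wedge sA); apply/PZ/Pw/IH.
  by apply: leq_trans leA; rewrite [in X in (_ < X)%N](cardsD1 s) sA.
elim/big_rec: _ => [|A b _ Pb']; last by apply: PD => //; apply: PZ.
by rewrite -(scale0r (kbasis set0)); apply: PZ.
Qed.

Lemma koszul_diff1 : d kone = 0.
Proof. by apply: koszul_diff_deg0; rewrite -[X in koszul_deg X](@cards0 'I_e); apply: kbasis_deg. Qed.

Lemma koszul_diffM a b : d (kmul a b) = kmul (d a) b + kmul (kbar a) (d b).
Proof.
elim/kbasis_ind: a b => [|s a IH|r a IH|a a' IH IH'] b.
- by rewrite koszul_diff1 kmul0l add0r kmul1l kbar_basis cards0 expr0 scale1r kmul1l.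
- rewrite wedgeA koszul_diff_wedge IH koszul_diff_wedge wedge_bar.
  rewrite kmulDl !kmulNl kmulZl !wedgeA /wedge kmulDr opprD addrA.
  by [].
- by rewrite kmulZl !koszul_diffZ IH kbarZ !kmulZl scalerDr.
by rewrite kmulDl !koszul_diffD IH IH' kbarD !kmulDl addrACA.
Qed.

Lemma koszul_diffK a : d (d a) = 0.
Proof.
elim/kbasis_ind: a => [|s a IH|r a IH|a b IHa IHb].
- by rewrite koszul_diff1 koszul_diff0.
- rewrite koszul_diff_wedge koszul_diffD koszul_diffN koszul_diffZ.
  by rewrite koszul_diff_wedge IH /wedge kmul0r subr0 subrr.
- by rewrite !koszul_diffZ IH scaler0.
by rewrite !koszul_diffD IHa IHb addr0.
Qed.

End Differential.

End KoszulAlgebra.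

(** * Uniqueness of Betti numbers *)

(** Chain maps and homotopies are sequences whose i-th term has a type depending on i; [Q] is the
    invariant that makes the next step possible, [S] the relation to be recorded. *)
Lemma dependent_choice (X : nat -> Type) (Q : forall i, X i -> Prop)
    (S : forall i, X i -> X i.+1 -> Prop) (x0 : X 0%N) : Q 0%N x0 ->
  (forall i x, Q i x -> exists x', Q i.+1 x' /\ S i x x') ->
  exists f : forall i, X i, f 0%N = x0 /\ forall i, S i (f i) (f i.+1).
Proof.
move=> Q0 H.
have st i (x : {x | Q i x}) : {x' : {x | Q i.+1 x} | S i (sval x) (sval x')}.
  apply: constructive_indefinite_description; case: x => x Qx.
  have [x' [Qx' Sx']] := H _ _ Qx.
  by exists (exist _ x' Qx').
pose f := fix f i : {x | Q i x} :=
  match i with 0 => exist _ x0 Q0 | i'.+1 => sval (st i' (f i')) end.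
by exists (fun i => sval (f i)); split=> // i; apply: (svalP (st i (f i))).
Qed.

Section TorUnique.

Variables (k : fieldType) (R : comNzRingType) (iota : {rmorphism k -> R}).

(** [th] induces an injection of U / W into U' / W'. If d' < d, the coordinates of the images of the
    basis form a matrix with a nonzero vector in its left kernel, that is, a nontrivial combination
    of the [b i] lying in W. *)
Lemma dim_subquot_le (V V' : lmodType R) (U W : V -> Prop) (U' W' : V' -> Prop)
    (th : V -> V') (d d' : nat) :
  (forall r u v, th (r *: u + v) = r *: th u + th v) ->
  U 0 -> (forall c u v, U u -> U v -> U (iota c *: u + v)) ->
  W 0 -> W' 0 -> (forall c u v, W' u -> W' v -> W' (iota c *: u + v)) ->
  (forall u, U u -> U' (th u)) ->
  (forall u, U u -> W' (th u) -> W u) ->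
  dim_subquot iota U W d -> dim_subquot iota U' W' d' -> (d <= d')%N.
Proof.
move=> thL U0 UL W0 W'0 W'L thU thW [b bU bE] [b' bU' bE'].
have th0 : th 0 = 0 by have := thL (-1) 0 0; rewrite scaler0 addr0 scaleN1r addNr.
have /fin_all_exists[M MP] i : exists c : {ffun 'I_d' -> k},
    W' (th (b i) - \sum_(j < d') iota (c j) *: b' j).
  by have [c [cW _]] := bE' _ (thU _ (bU i)); exists c.
rewrite leqNgt; apply/negP => d'd.
pose A := \matrix_(i < d, j < d') M i j.
have kA : kermx A != 0.
  rewrite -mxrank_eq0 mxrank_ker subn_eq0 -ltnNge.
  exact: leq_ltn_trans (rank_leq_col A) d'd.
have /rowV0Pn[v /sub_kermxP vA v0] := kA.
have UL0 : U (\sum_(i < d) iota (v 0 i) *: b i).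
  by elim/big_rec: _ => // i u _ Uu; apply: UL.
have thS : W' (th (\sum_(i < d) iota (v 0 i) *: b i)
    - \sum_(i < d) iota (v 0 i) *: \sum_(j < d') iota (M i j) *: b' j).
  elim/big_ind2: _ => [|y1 x1 y2 x2|i _]; first by rewrite th0 subr0.
    move=> W1 W2; have -> : th (x1 + x2) = th x1 + th x2.
      by rewrite -[x1]scale1r thL !scale1r.
    rewrite opprD addrACA -[th x1 - y1]scale1r -(rmorph1 iota).
    exact: W'L.
  have -> : th (iota (v 0 i) *: b i) = iota (v 0 i) *: th (b i).
    by rewrite -[X in th X]addr0 thL th0 addr0.
  by rewrite -scalerBr -[X in W' X]addr0; apply: W'L.
have S0 : \sum_(i < d) iota (v 0 i) *: \sum_(j < d') iota (M i j) *: b' j = 0.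
  under eq_bigr do rewrite scaler_sumr.
  rewrite exchange_big big1 // => j _ /=.
  under eq_bigr do rewrite scalerA -rmorphM.
  rewrite -scaler_suml -rmorph_sum.
  have := congr1 (fun X : 'rV[k]_d' => X 0 j) vA; rewrite !mxE.
  by under eq_bigr do rewrite mxE; move=> ->; rewrite rmorph0 scale0r.
rewrite S0 subr0 in thS.
(* The kernel vector and 0 are both coordinates of the same element, so uniqueness makes the vector
   vanish. *)
have [c [_ cU]] := bE _ UL0.
have c1 := cU [ffun i => v 0 i].
have c2 := cU [ffun i => 0].
have /c1 E1 : W (\sum_(i < d) iota (v 0 i) *: b i
   - \sum_(i < d) iota ([ffun i => v 0 i] i) *: b i).
  by under [X in _ - X]eq_bigr do rewrite ffunE; rewrite subrr.
have /c2 E2 : W (\sum_(i < d) iota (v 0 i) *: b i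
   - \sum_(i < d) iota ([ffun i => 0] i) *: b i).
  rewrite [X in _ - X]big1 ?subr0; first exact: thW.
  by move=> i _; rewrite ffunE rmorph0 scale0r.
case/negP: v0; apply/eqP/rowP => i; rewrite mxE.
by move/ffunP: (etrans (esym E1) E2) => /(_ i); rewrite !ffunE.
Qed.

Variable m : R -> Prop.
Hypothesis m0 : m 0.
Hypothesis mD : forall r s, m r -> m s -> m (r + s).
Hypothesis mM : forall r s, m s -> m (r * s).

Let mN r : m r -> m (- r). Proof. by move=> mr; rewrite -mulN1r; apply: mM. Qed.
Let mB r s : m r -> m s -> m (r - s). Proof. by move=> mr /mN; apply: mD. Qed.

Lemma entries_inD b (u v : 'rV[R]_b) :
  entries_in m u -> entries_in m v -> entries_in m (u + v).
Proof. by move=> mu mv j; rewrite mxE; apply: mD. Qed.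

Lemma entries_in0 b : entries_in m (0 : 'rV[R]_b).
Proof. by move=> j; rewrite mxE. Qed.

Lemma entries_inZ b r (u : 'rV[R]_b) : entries_in m u -> entries_in m (r *: u).
Proof. by move=> mu j; rewrite mxE; apply: mM. Qed.

Lemma entries_inB b (u v : 'rV[R]_b) :
  entries_in m u -> entries_in m v -> entries_in m (u - v).
Proof. by move=> mu mv; rewrite -scaleN1r; apply/entries_inD/entries_inZ. Qed.

Lemma ideal_sum (I : Type) (r : seq I) (P : pred I) (F : I -> R) :
  (forall i, P i -> m (F i)) -> m (\sum_(i <- r | P i) F i).
Proof. by move=> H; elim/big_rec: _ => // i u Pi mu; apply: mD => //; apply: H. Qed.

Lemma entries_in_mul b c (u : 'rV[R]_b) (A : 'M_(b, c)) :
  entries_in m u -> entries_in m (u *m A).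
Proof. by move=> mu j; rewrite mxE; apply: ideal_sum => i _; rewrite mulrC; apply: mM. Qed.

Lemma row_factor p q r (X : 'M[R]_(p, q)) (D : 'M_(r, q)) :
  (forall i, exists w, row i X = w *m D) -> exists Y, X = Y *m D.
Proof.
move=> /fin_all_exists[f fP]; exists (\matrix_(i < p) f i).
by apply/row_matrixP => i; rewrite row_mul rowK fP.
Qed.

Section Compare.

Variables (b : nat -> nat) (D : forall i, 'M[R]_(b i.+1, b i)) (a : 'cV[R]_(b 0)).
Hypothesis resF : free_resolution m D a.

Lemma res_comp0 i : D i.+1 *m D i = 0.
Proof.
apply/row_matrixP => r; rewrite row_mul row0.
have [_ _ ex] := resF; apply/ex; exists (delta_mx 0 r).
by rewrite -rowE.
Qed.

Lemma res_aug0 (w : 'rV_(b 1)) : m ((w *m D 0 *m a) 0 0).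
Proof. by have [_ ex _] := resF; apply/ex; exists w. Qed.

Lemma res_lift i p (X : 'M_(p, b i.+1)) : X *m D i = 0 -> exists Y, X = Y *m D i.+1.
Proof.
move=> X0; apply: row_factor => r.
by have [_ _ ex] := resF; apply/ex; rewrite -row_mul X0 row0.
Qed.

Lemma res_lift0 p (X : 'M_(p, b 0)) : (forall r, m ((X *m a) r 0)) ->
  exists Y, X = Y *m D 0.
Proof.
move=> X0; apply: row_factor => r.
by have [_ ex _] := resF; apply/ex; rewrite -row_mul mxE.
Qed.

(** Vectors are rows and maps act on the right. A lift of the identity of R/m differs from 1 by a
    homotopy, built degree by degree: what the next map has to bound consists of cycles, and these
    are boundaries by exactness. *)
Lemma null_homotopy (phi : forall i, 'M[R]_(b i)) :
  (forall r, m ((phi 0 *m a - a) r 0)) ->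
  (forall i, phi i.+1 *m D i = D i *m phi i) ->
  exists s : forall i, 'M[R]_(b i, b i.+1),
    phi 0 - 1%:M = s 0 *m D 0 /\
    forall i, phi i.+1 - 1%:M = s i.+1 *m D i.+1 + D i *m s i.
Proof.
move=> aug phiD.
(* The invariant: the rows that the next component of the homotopy has to bound are cycles. *)
pose Q i (s : 'M[R]_(b i, b i.+1)) := (phi i.+1 - 1%:M - D i *m s) *m D i = 0.
have st i (s : 'M[R]_(b i, b i.+1)) : Q i s -> exists s', Q i.+1 s' /\
    phi i.+1 - 1%:M = s' *m D i.+1 + D i *m s.
  move=> /res_lift[s' E].
  have E' : phi i.+1 - 1%:M = s' *m D i.+1 + D i *m s by rewrite -E subrK.
  exists s'; split => //.
  rewrite /Q mulmxBl mulmxBl phiD mul1mx -mulmxA.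
  have -> : phi i.+1 = s' *m D i.+1 + D i *m s + 1%:M by rewrite -E' subrK.
  by rewrite !mulmxDr !mulmxA res_comp0 mul0mx addr0 mulmx1 addrK subrr.
have [s0 E0] : exists s0, phi 0 - 1%:M = s0 *m D 0.
  by apply: res_lift0 => r; rewrite mulmxBl mul1mx; apply: aug.
have Q0 : Q 0 s0.
  by rewrite /Q mulmxBl mulmxBl phiD mul1mx -mulmxA -E0 mulmxBr mulmx1 subrr.
by have [f [f0 fS]] := dependent_choice Q0 st; exists f; rewrite f0.
Qed.

End Compare.

(** Comparison of resolutions: each map exists by exactness of the target, starting from a lift of
    the identity of R/m. *)
Lemma chain_lift b (D : forall i, 'M[R]_(b i.+1, b i)) (a : 'cV[R]_(b 0))
    b' (D' : forall i, 'M[R]_(b' i.+1, b' i)) (a' : 'cV[R]_(b' 0)) :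
  free_resolution m D a -> free_resolution m D' a' ->
  exists f : forall i, 'M[R]_(b i, b' i),
    (forall r, m ((f 0 *m a' - a) r 0)) /\
    forall i, f i.+1 *m D' i = D i *m f i.
Proof.
move=> resF resG.
pose P i (f : 'M[R]_(b i, b' i)) := exists f', f' *m D' i = D i *m f.
have [u ua] : exists u : 'rV_(b' 0), m ((u *m a') 0 0 - 1) by case: resG.
have augE : forall r, m ((a *m u *m a' - a) r 0).
  move=> r; rewrite mxE [X in _ + X]mxE -mulmxA [X in X - _]mxE big_ord1.
  by rewrite -[X in _ - X]mulr1 -mulrBr; apply: mM.
(* [u] has augmentation 1 modulo m, so sending each generator to its augmentation times [u] lifts
   the identity of R/m. *)
have P0 : P 0%N (a *m u).
  have [f' E] : exists f', D 0%N *m (a *m u) = f' *m D' 0%N.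
    apply: (res_lift0 resG) => r.
    have -> : D 0 *m (a *m u) *m a' = D 0 *m (a *m u *m a' - a) + D 0 *m a.
      by rewrite mulmxBr subrK !mulmxA.
    rewrite mxE; apply: mD; first by rewrite mxE; apply: ideal_sum => i _; apply: mM; apply: augE.
    have := res_aug0 resF (delta_mx 0 r).
    by rewrite -mulmxA -rowE mxE.
  by exists f'.
have st i (f : 'M[R]_(b i, b' i)) : P i f -> exists f', P i.+1 f' /\
    f' *m D' i = D i *m f.
  move=> [f' E]; exists f'; split => //.
  have [f'' E''] : exists f'', D i.+1 *m f' = f'' *m D' i.+1.
    by apply: (res_lift resG); rewrite -mulmxA E mulmxA (res_comp0 resF) mul0mx.
  by exists f''.
by have [f [f0 fS]] := dependent_choice P0 st; exists f; rewrite f0.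
Qed.

(** The chain maps in both directions compose to a map homotopic to the identity, so the map induced
    on Tor is injective and [dim_subquot_le] applies. *)
Lemma tor_dim_le i d d' : tor_dim iota m i d -> tor_dim iota m i d' -> (d <= d')%N.
Proof.
move=> [b [D [a [resF dimF]]]] [b' [D' [a' [resG dimG]]]].
have [g [augg gD]] := chain_lift resF resG.
have [f [augf fD]] := chain_lift resG resF.
have [s [s0 sS]] : exists s : forall i, 'M[R]_(b i, b i.+1),
    g 0 *m f 0 - 1%:M = s 0 *m D 0 /\
    forall i, g i.+1 *m f i.+1 - 1%:M = s i.+1 *m D i.+1 + D i *m s i.
  apply: (null_homotopy resF (phi := fun i => g i *m f i)) => [r|j].
    have -> : g 0 *m f 0 *m a - a = g 0 *m (f 0 *m a - a') + (g 0 *m a' - a).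
      by rewrite mulmxBr mulmxA addrA subrK.
    rewrite mxE; apply: mD => //.
    by rewrite mxE; apply: ideal_sum => j _; apply: mM.
  by rewrite -mulmxA fD mulmxA gD mulmxA.
apply: (dim_subquot_le (th := fun u => u *m g i)) dimF dimG.
- by move=> r u v; rewrite mulmxDl -scalemxAl.
- by case: i => // i; rewrite /tensor_cycle mul0mx; apply: entries_in0.
- case: i => // i c u v cu cv; rewrite /tensor_cycle mulmxDl -scalemxAl.
  by apply: entries_inD cv; apply: entries_inZ.
- by exists 0; rewrite mul0mx subr0; apply: entries_in0.
- by exists 0; rewrite mul0mx subr0; apply: entries_in0.
- move=> c u v [w uw] [w' vw]; exists (iota c *: w + w').
  rewrite mulmxDl -scalemxAl opprD addrACA -scalerBr.
  by apply: entries_inD vw; apply: entries_inZ.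
- by case: i => // i u cu; rewrite /tensor_cycle -mulmxA gD mulmxA; apply: entries_in_mul.
move=> u cu [w uw].
(* For a cycle u of F/mF the homotopy leaves a boundary and a term u D s, whose entries lie in m
   because those of u D do. *)
have uE : exists w' v, entries_in m v /\ u *m (g i *m f i - 1%:M) = w' *m D i + v.
  case: i u cu w uw => [|i] u cu w uw.
    by exists (u *m s 0), 0; rewrite s0 mulmxA addr0; split => //; apply: entries_in0.
  exists (u *m s i.+1), (u *m D i *m s i); split; first exact: entries_in_mul.
  by rewrite sS mulmxDr !mulmxA.
case: uE => w' [v [mv uE]].
exists (w *m f i.+1 - w').
have -> : u - (w *m f i.+1 - w') *m D i = (u *m g i - w *m D' i) *m f i - v.
  rewrite mulmxBr mulmx1 mulmxA in uE.
  rewrite !mulmxBl -!mulmxA fD.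
  have {}uE : u *m g i *m f i = w' *m D i + v + u by rewrite -uE subrK.
  rewrite mulmxA uE; set p := w' *m D i; set q := w *m _.
  by rewrite opprB; apply/matrixP => r c; rewrite !mxE; ring.
by apply: entries_inB mv; apply: entries_in_mul.
Qed.

Lemma tor_dim_unique i d d' : tor_dim iota m i d -> tor_dim iota m i d' -> d = d'.
Proof. by move=> h h'; apply/anti_leq; rewrite (tor_dim_le h h') (tor_dim_le h' h). Qed.

End TorUnique.

(** * Resolutions obtained by twisting the Koszul complex *)

Section TwistedResolution.

Variables (k : fieldType) (R : comNzRingType) (iota : {rmorphism k -> R}).
Variable m : R -> Prop.
Hypothesis m0 : m 0.
Hypothesis mD : forall r s, m r -> m s -> m (r + s).
Hypothesis mM : forall r s, m s -> m (r * s).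
Hypothesis m_res : forall r, exists c, m (r - iota c).
Hypothesis m_iota : forall c, m (iota c) -> c = 0.

Variable e : nat.
Local Notation K := (koszul R e).

Variables (W : eqType) (wt : W -> nat) (Wle : nat -> seq W) (w0 : W).
Hypothesis Wle_uniq : forall i, uniq (Wle i).
Hypothesis mem_Wle : forall i w, (w \in Wle i) = (wt w <= i)%N.
Hypothesis wt0 : forall w, (wt w == 0%N) = (w == w0).

(* A map [W -> K] stands for an element of K (x) T, where T is free on [W] with
   [w] in degree [wt w]. *)
Definition twisted_deg (i : nat) (f : W -> K) : Prop :=
  forall w (A : {set 'I_e}), (wt w + #|A|)%N != i -> f w A = 0.

Definition twisted_basis (i : nat) : seq (W * {set 'I_e}) :=
  [seq (w, A) | w <- Wle i, A <- enum [set A : {set 'I_e} | #|A| == (i - wt w)%N]].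

Definition twisted_rank (i : nat) : nat := size (twisted_basis i).

Lemma twisted_rankE i : twisted_rank i = (\sum_(w <- Wle i) 'C(e, i - wt w))%N.
Proof.
rewrite /twisted_rank /twisted_basis size_allpairs_dep sumnE big_map.
apply: eq_bigr => w _; rewrite -cardE.
by rewrite card_draws card_ord.
Qed.

Lemma mem_twisted_basis i w A :
  ((w, A) \in twisted_basis i) = ((wt w + #|A|)%N == i).
Proof.
apply/allpairsPdep/eqP => [[w' [A' []]]|E].
  rewrite mem_Wle mem_enum inE => wi /eqP Si [-> ->].
  by rewrite Si subnKC.
exists w, A; split=> //; first by rewrite mem_Wle -E leq_addr.
by rewrite mem_enum inE -E addKn.
Qed.

Lemma twisted_basis_uniq i : uniq (twisted_basis i).
Proof.
apply: allpairs_uniq_dep => // [w _|[w A] [w' A'] _ _ [-> ->]//].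
exact: enum_uniq.
Qed.

Local Notation tn i r := (tnth (in_tuple (twisted_basis i)) r).

Definition twisted_delta i (r : 'I_(twisted_rank i)) : W -> K :=
  fun w => [ffun A : {set 'I_e} => ((tn i r == (w, A))%:R : R)].

Definition row_twisted i (u : 'rV[R]_(twisted_rank i)) : W -> K :=
  fun w => \sum_r (u 0 r : R) *: twisted_delta r w.

Definition twisted_row i (f : W -> K) : 'rV[R]_(twisted_rank i) :=
  \row_r (f (tn i r).1 (tn i r).2 : R).

Lemma row_twistedE i (u : 'rV[R]_(twisted_rank i)) w A :
  row_twisted u w A = \sum_r u 0 r * (tn i r == (w, A))%:R.
Proof. by rewrite sum_ffunE; apply: eq_bigr => r _; rewrite !ffunE. Qed.

Lemma twisted_basis_inj i : injective (fun r => tn i r).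
Proof. by apply/tuple_uniqP; apply: twisted_basis_uniq. Qed.

Lemma row_twistedK i (u : 'rV[R]_(twisted_rank i)) : twisted_row i (row_twisted u) = u.
Proof.
apply/rowP => r; rewrite mxE row_twistedE (bigD1 r) //= -surjective_pairing.
rewrite eqxx mulr1 big1 ?addr0 // => s sr.
by rewrite (inj_eq (@twisted_basis_inj i)) (negbTE sr) mulr0.
Qed.

Lemma row_twisted_deg i (u : 'rV[R]_(twisted_rank i)) : twisted_deg i (row_twisted u).
Proof.
move=> w A nA; rewrite row_twistedE big1 // => r _.
case: eqP => [E|]; last by rewrite mulr0.
have := mem_tnth r (in_tuple (twisted_basis i)).
by rewrite E mem_twisted_basis (negbTE nA).
Qed.

Lemma twisted_rowK i f : twisted_deg i f -> row_twisted (twisted_row i f) = f.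
Proof.
move=> fi; apply: functional_extensionality => w; apply/ffunP => A.
rewrite row_twistedE; case: (boolP ((w, A) \in twisted_basis i)) => [|nA].
  move=> /(tnthP (in_tuple (twisted_basis i)))[r E].
  rewrite (bigD1 r) //= mxE -E eqxx mulr1 big1 ?addr0 // => s sr.
  by rewrite E (inj_eq (@twisted_basis_inj i)) (negbTE sr) mulr0.
rewrite big1 => [|r _].
  by rewrite fi // -mem_twisted_basis.
case: eqP => [E|]; last by rewrite mulr0.
have := mem_tnth r (in_tuple (twisted_basis i)).
by rewrite E (negbTE nA).
Qed.

(** [D i] goes from degree i.+1 to degree i. The index allows a differential given by a sum over
    infinitely many words to be truncated according to the degree. *)
Variable D : nat -> (W -> K) -> (W -> K).
Hypothesis D_lin : forall i r f g w,
  D i (fun w => (r : R) *: f w + g w) w = r *: D i f w + D i g w.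
Hypothesis D_deg : forall i f, twisted_deg i.+1 f -> twisted_deg i (D i f).

Definition twisted_mx i : 'M[R]_(twisted_rank i.+1, twisted_rank i) :=
  \matrix_(r, c) (D i (twisted_delta r) (tn i c).1 (tn i c).2 : R).

(** Translates between the matrices required by [tor_dim] and the maps W -> K in which the
    differentials are written. *)
Lemma row_twisted_mul i (u : 'rV[R]_(twisted_rank i.+1)) :
  row_twisted (u *m twisted_mx i) = D i (row_twisted u).
Proof.
rewrite -[RHS](twisted_rowK (i := i)); last exact/D_deg/row_twisted_deg.
congr row_twisted; apply/rowP => c; rewrite !mxE.
rewrite /row_twisted; set w := (tn i c).1; set A := (tn i c).2.
have D0 w' : D i (fun=> 0) w' = 0.
  have := D_lin i (-1) (fun=> 0) (fun=> 0) w'.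
  rewrite [in RHS]scaleN1r [in RHS]addNr => E; rewrite -[RHS]E; congr (D i _ w').
  by apply: functional_extensionality => v; rewrite scaler0 addr0.
have -> : D i (fun w => \sum_r u 0 r *: twisted_delta r w) w =
    \sum_r u 0 r *: D i (twisted_delta r) w.
  elim: (index_enum _) => [|r s IH].
    rewrite big_nil -(D0 w); congr (D i _ w).
    by apply: functional_extensionality => v; rewrite big_nil.
  rewrite big_cons -IH -D_lin; congr (D i _ w).
  by apply: functional_extensionality => v; rewrite big_cons.
by rewrite sum_ffunE; apply: eq_bigr => r _; rewrite mxE ffunE.
Qed.

Hypothesis D_ex0 : forall f, twisted_deg 0 f ->
  (m (f w0 set0) <-> exists2 g, twisted_deg 1 g & f = D 0 g).
Hypothesis D_ex : forall i f, twisted_deg i.+1 f ->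
  ((forall w, D i f w = 0) <-> exists2 g, twisted_deg i.+2 g & f = D i.+1 g).
Hypothesis D_min : forall i f w A, twisted_deg i.+1 f -> m (D i f w A).

Definition twisted_aug : 'cV[R]_(twisted_rank 0) := \col_r (tn 0 r == (w0, set0))%:R.

Lemma twisted_resolution : free_resolution m twisted_mx twisted_aug.
Proof.
have augE (u : 'rV_(twisted_rank 0)) : (u *m twisted_aug) 0 0 = row_twisted u w0 set0.
  by rewrite row_twistedE mxE; apply: eq_bigr => r _; rewrite mxE.
have inj i (u v : 'rV_(twisted_rank i)) : row_twisted u = row_twisted v -> u = v.
  by move=> E; rewrite -[u]row_twistedK E row_twistedK.
split.
- exists (twisted_row 0 (fun w => [ffun A : {set 'I_e} => ((w == w0) && (A == set0))%:R : R])).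
  rewrite augE twisted_rowK; last first.
    move=> w A; rewrite addn_eq0 wt0 cards_eq0 ffunE.
    by case: (_ && _).
  by rewrite ffunE !eqxx subrr.
- move=> u; rewrite augE; rewrite D_ex0; last exact: row_twisted_deg.
  split=> [[g g1 E]|[w ->]].
    exists (twisted_row 1 g); apply: inj.
    by rewrite row_twisted_mul twisted_rowK.
  by exists (row_twisted w); [exact: row_twisted_deg | rewrite row_twisted_mul].
move=> i u.
have [ex1 ex2] := D_ex (row_twisted_deg u).
split=> [uD|[w ->]].
  have [|g gi E] := ex1.
    move=> w; rewrite -row_twisted_mul uD; rewrite /row_twisted big1 // => r _.
    by rewrite mxE scale0r.
  exists (twisted_row i.+2 g); apply: inj.
  by rewrite row_twisted_mul twisted_rowK.
apply: inj; rewrite !row_twisted_mul.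
have [_ ex2'] := D_ex (row_twisted_deg (w *m twisted_mx i.+1)).
have Dw : exists2 g, twisted_deg i.+2 g & row_twisted (w *m twisted_mx i.+1) = D i.+1 g.
  by exists (row_twisted w); [exact: row_twisted_deg | rewrite row_twisted_mul].
move/ex2': Dw; rewrite row_twisted_mul => Dw.
apply: functional_extensionality => v; rewrite Dw /row_twisted big1 // => r _.
by rewrite mxE scale0r.
Qed.

Lemma twisted_mx_min i (u : 'rV_(twisted_rank i.+1)) : entries_in m (u *m twisted_mx i).
Proof.
move=> j; rewrite -[u *m _]row_twistedK row_twisted_mul mxE.
apply: D_min; exact: row_twisted_deg.
Qed.

(** By minimality F/mF has zero differential, so Tor_i is F_i/mF_i and the standard basis gives a
    k-basis. *)
Lemma twisted_tor_dim i : tor_dim iota m i (twisted_rank i).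
Proof.
exists twisted_rank, twisted_mx, twisted_aug; split; first exact: twisted_resolution.
exists (fun r => delta_mx 0 r) => [r|u _].
  by case: i r => // i r; apply: twisted_mx_min.
have Eu (c : {ffun 'I_(twisted_rank i) -> k}) :
    u - \sum_(r < twisted_rank i) iota (c r) *: delta_mx 0 r =
    \row_r (u 0 r - iota (c r)).
  apply/rowP => r; rewrite !mxE summxE (bigD1 r) //= !mxE !eqxx mulr1.
  by rewrite big1 ?addr0 // => s sr; rewrite !mxE eqxx eq_sym (negbTE sr) mulr0.
have /fin_all_exists[c cP] : forall r, exists c, m (u 0 r - iota c).
  by move=> r; apply: m_res.
exists [ffun r => c r]; split=> [|c' [w]]; rewrite Eu.
  by exists 0 => r; rewrite mul0mx subr0 mxE ffunE.
move=> mw; apply/ffunP => r; rewrite ffunE.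
apply/eqP; rewrite -subr_eq0; apply/eqP/m_iota; rewrite rmorphB.
have := mw r; rewrite !mxE => mw'.
have /mD/(_ (twisted_mx_min w r)) := mw'; rewrite mxE subrK => mw''.
have -> : iota (c r) - iota (c' r) = (-1) * (u 0 r - iota (c r)) + (u 0 r - iota (c' r)).
  by ring.
by apply: mD mw''; apply: mM.
Qed.

End TwistedResolution.

(** * Stanley-Reisner rings *)

Section MonomialSets.

Variable e : nat.
Implicit Types (A B S T : {set 'I_e}) (u w al be : 'X_{1..e}).

Definition mset A : 'X_{1..e} := [multinom (i \in A : nat) | i < e].

Definition mnm_support u : {set 'I_e} := [set i | (0 < u i)%N].

Definition squarefree u : bool := [forall i, (u i <= 1)%N].

Lemma msetE A i : mset A i = (i \in A).
Proof. exact: mnmE. Qed.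

Lemma mset_le A al : (mset A <= al)%MM = (A \subset mnm_support al).
Proof.
apply/mnm_lepP/subsetP => [H i iA|H i]; first by have := H i; rewrite msetE iA inE.
by rewrite msetE; case: (boolP (i \in A)) => // /H; rewrite inE.
Qed.

Lemma mset_squarefree A : squarefree (mset A).
Proof. by apply/forallP => i; rewrite msetE leq_b1. Qed.

Lemma squarefree_mset u : squarefree u -> u = mset (mnm_support u).
Proof.
move=> /forallP su; apply/mnmP => i; rewrite msetE inE.
by have := su i; case: (u i) => [|[]].
Qed.

Lemma squarefree_le u w : (u <= w)%MM -> squarefree w -> squarefree u.
Proof.
move=> /mnm_lepP uw /forallP sw; apply/forallP => i; exact: leq_trans (uw i) (sw i).
Qed.

Lemma support_mset A : mnm_support (mset A) = A.
Proof. by apply/setP => i; rewrite inE msetE lt0b. Qed.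

Lemma support_msetB A B : mnm_support (mset A - mset B)%MM = A :\: B.
Proof.
apply/setP => i; rewrite !inE mnmBE !msetE.
by case: (i \in A); case: (i \in B).
Qed.

Lemma mset_inj : injective mset.
Proof. by move=> A B E; rewrite -(support_mset A) E support_mset. Qed.

Lemma mnm_leD u w al be : (u <= al)%MM -> (w <= be)%MM -> (u + w <= al + be)%MM.
Proof.
move=> /mnm_lepP H /mnm_lepP H'; apply/mnm_lepP => i.
by rewrite !mnmDE leq_add.
Qed.

Lemma subm1_lt u i : (0 < u i)%N -> (mdeg (u - U_(i)) < mdeg u)%N.
Proof.
move=> ui; have {2}-> : u = (u - U_(i) + U_(i))%MM.
  by rewrite submK // lep1mP -lt0n.
by rewrite mdegD mdeg1 addn1.
Qed.

End MonomialSets.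

Section StanleyReisner.

Variables (k : fieldType) (R : comNzRingType) (iota : {rmorphism k -> R}).
Variables (e : nat) (x : 'I_e -> R) (C : pred {set 'I_e}).
Variable co : 'X_{1..e} -> R -> k.

Local Notation K := (koszul R e).
Local Notation Kk := (koszul k e).
Local Notation d := (koszul_diff x).
Local Notation dk := (koszul_diff (fun=> 1 : k)).
Implicit Types (A B S T : {set 'I_e}) (u w al be : 'X_{1..e}) (r s : R).

Definition nonface u : bool := C (mnm_support u).

Definition xmon u : R := \prod_i x i ^+ u i.

(* [R] is the Stanley-Reisner ring k[x_1, .., x_e] / (x^u | C (supp u)) and
   [co u r] is the coefficient of x^u in the normal form of [r]. *)
Record stanley_reisner : Prop := StanleyReisner {
  sr_up : forall A B, A \subset B -> C A -> C B;
  sr_set0 : ~~ C set0;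
  sr_set1 : forall i, ~~ C [set i];
  sr_coD : forall u r s, co u (r + s) = co u r + co u s;
  sr_coZ : forall u c r, co u (iota c * r) = c * co u r;
  sr_co_nonface : forall u r, nonface u -> co u r = 0;
  sr_coX : forall u i r, ~~ nonface u ->
    co u (x i * r) = if (0 < u i)%N then co (u - U_(i))%MM r else 0;
  sr_co1 : forall u, co u 1 = (u == 0%MM)%:R;
  sr_co_inj : forall r, (forall u, co u r = 0) -> r = 0;
  sr_gen : forall r, exists (l : seq 'X_{1..e}) (c : 'X_{1..e} -> k),
    r = \sum_(u <- l) iota (c u) * xmon u
}.

Hypothesis SR : stanley_reisner.
Let C_up := sr_up SR.
Let coD := sr_coD SR.
Let coZ := sr_coZ SR.
Let co_nonface := sr_co_nonface SR.
Let coX := sr_coX SR.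
Let co1 := sr_co1 SR.
Let co_inj := sr_co_inj SR.
Let R_gen := sr_gen SR.

Lemma nonface_le u w : (u <= w)%MM -> nonface u -> nonface w.
Proof.
move=> /mnm_lepP uw; apply: C_up; apply/subsetP => i; rewrite !inE => ui.
exact: leq_trans ui (uw i).
Qed.

Lemma nonface0 : ~~ nonface 0%MM.
Proof.
rewrite /nonface (_ : mnm_support _ = set0) ?(sr_set0 SR) //.
by apply/setP => i; rewrite !inE mnm0E.
Qed.

Lemma nonface1 i : ~~ nonface U_(i)%MM.
Proof.
rewrite /nonface (_ : mnm_support _ = [set i]) ?(sr_set1 SR) //.
by apply/setP => j; rewrite !inE mnm1E eq_sym; case: eqP.
Qed.

Lemma co0 u : co u 0 = 0.
Proof. by rewrite -(mul0r 0) -(rmorph0 iota) coZ mul0r. Qed.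

Lemma coB u r s : co u (r - s) = co u r - co u s.
Proof. by rewrite -mulN1r -(rmorphN1 iota) coD coZ mulN1r. Qed.

Lemma co_sum u (I : Type) (l : seq I) (P : pred I) (F : I -> R) :
  co u (\sum_(j <- l | P j) F j) = \sum_(j <- l | P j) co u (F j).
Proof. exact: (big_morph (co u) (coD u) (co0 u)). Qed.

Lemma coZs u n r : co u ((-1) ^+ n * r) = (-1) ^+ n * co u r.
Proof. by rewrite -(rmorphN1 iota) -rmorphXn coZ. Qed.

Lemma co_eq r s : (forall u, co u r = co u s) -> r = s.
Proof. by move=> E; apply/eqP; rewrite -subr_eq0; apply/eqP/co_inj => u; rewrite coB E subrr. Qed.

Lemma xmon0 : xmon 0%MM = 1.
Proof. by rewrite /xmon big1 // => i _; rewrite mnm0E expr0. Qed.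

Lemma xmonD u w : xmon (u + w)%MM = xmon u * xmon w.
Proof. by rewrite /xmon -big_split; apply: eq_bigr => i _ /=; rewrite mnmDE exprD. Qed.

Lemma xmon1 i : xmon U_(i)%MM = x i.
Proof.
rewrite /xmon (bigD1 i) //= mnm1E eqxx expr1 big1 ?mulr1 // => j ji.
by rewrite mnm1E eq_sym (negbTE ji) expr0.
Qed.

Lemma xmonB u i : (0 < u i)%N -> xmon u = x i * xmon (u - U_(i))%MM.
Proof. by move=> ui; rewrite -xmon1 -xmonD addmC submK // lep1mP -lt0n. Qed.

Lemma coM_xmon u w r : co u (xmon w * r) =
  if ~~ nonface u && (w <= u)%MM then co (u - w)%MM r else 0.
Proof.
case: (boolP (nonface u)) => [Nu|Nu] /=; first by rewrite co_nonface.
have [n] := ubnP (mdeg w); elim: n w u Nu => // n IH w u Nu; rewrite ltnS => leA.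
have [/eqP w0|] := boolP (w == 0%MM).
  have -> : (w <= u)%MM by apply/mnm_lepP => i; rewrite w0 mnm0E.
  by rewrite w0 xmon0 mul1r subm0.
move=> w0; have [i wi] : exists i, (0 < w i)%N.
  apply/existsP; apply: contraNT w0; rewrite negb_exists => /forallP H.
  by apply/eqP/mnmP => i; rewrite mnm0E; apply/eqP; rewrite -leqn0 leqNgt.
rewrite (xmonB wi) -mulrA coX //; case: ltnP => ui; last first.
  case: mnm_lepP => // /(_ i); rewrite leqNgt.
  by rewrite (leq_ltn_trans _ wi) //.
rewrite IH; last 2 first.
- by apply: contra Nu; apply: nonface_le; apply: lem_subr.
- exact: leq_trans (subm1_lt wi) leA.
have Ew : w = (U_(i) + (w - U_(i)))%MM by rewrite addmC submK // lep1mP -lt0n.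
have Eu : u = (U_(i) + (u - U_(i)))%MM by rewrite addmC submK // lep1mP -lt0n.
have -> : (w <= u)%MM = (w - U_(i) <= u - U_(i))%MM.
  rewrite {1}Ew {1}Eu; apply/mnm_lepP/mnm_lepP => H j; have := H j.
    by rewrite !(mnmDE, mnmBE) leq_add2l.
  by move=> H'; rewrite mnmDE [(U_(i) + _)%MM j]mnmDE leq_add2l.
case: ifP => // _; congr (co _ r).
by apply/mnmP => j; rewrite !mnmBE -!subnDA; congr (_ - _)%N; rewrite [in RHS]Ew mnmDE mnmBE.
Qed.

Lemma co_xmon u w : co u (xmon w) = (~~ nonface u && (u == w))%:R.
Proof.
rewrite -[xmon w]mulr1 coM_xmon co1; case: (nonface u) => //=.
case: (boolP (w <= u)%MM) => wu; last first.
  by case: eqP wu => // ->; rewrite lepm_refl.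
congr (_%:R); congr nat_of_bool; apply/eqP/eqP => [E|->]; last by apply/mnmP => i; rewrite mnmBE subnn mnm0E.
by rewrite -(submK wu) E add0m.
Qed.

Lemma xmon_nonface u : nonface u -> xmon u = 0.
Proof.
move=> Nu; apply: co_inj => w; rewrite co_xmon.
by case: eqP => [->|]; rewrite ?Nu ?andbF.
Qed.

Lemma mon_expansion r : exists2 l : seq 'X_{1..e}, uniq l &
  r = \sum_(u <- l) iota (co u r) * xmon u /\ forall u, u \notin l -> co u r = 0.
Proof.
have [l [c E]] := R_gen r; exists (undup l); first exact: undup_uniq.
have cl u : u \notin undup l -> co u r = 0.
  rewrite mem_undup => ul; rewrite E co_sum big1_seq // => w /andP[_ wl].
  rewrite coZ co_xmon; case: eqP => [Ew|]; last by rewrite andbF mulr0.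
  by rewrite Ew wl in ul.
split=> //; apply: co_eq => u; rewrite co_sum.
have [ul|ul] := boolP (u \in undup l); last first.
  rewrite cl // big1_seq // => w /andP[_ wl].
  rewrite coZ co_xmon; case: eqP => [Ew|]; last by rewrite andbF mulr0.
  by rewrite Ew wl in ul.
rewrite (bigD1_seq u) ?undup_uniq //= big1 => [|w wu].
  rewrite addr0 coZ co_xmon eqxx andbT.
  by case: (boolP (nonface u)) => [/co_nonface->|]; rewrite ?mul0r ?mulr1.
by rewrite coZ co_xmon eq_sym (negbTE wu) andbF mulr0.
Qed.

(** A coefficient of a product only involves coefficients of a factor at divisors of the monomial.
    This makes the elements without squarefree component an ideal. *)
Lemma co_mul_eq0 u r s : (forall w, (w <= u)%MM -> co w r = 0) -> co u (r * s) = 0.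
Proof.
move=> H; have [l _ [-> _]] := mon_expansion s.
rewrite mulr_sumr co_sum big1 // => w _; rewrite mulrCA coZ mulrC [r * _]mulrC coM_xmon.
by case: ifP => _; rewrite ?mul0r // H ?mul0r //; apply: lem_subr.
Qed.

Lemma max_ideal_gen r : co 0%MM r = 0 -> exists s : 'I_e -> R, r = \sum_i x i * s i.
Proof.
move=> r0; have [l ul [E _]] := mon_expansion r.
suff [s Es] : exists s : 'I_e -> R, \sum_(u <- l) iota (co u r) * xmon u = \sum_i x i * s i.
  by exists s; rewrite -Es.
elim: l {E ul} => [|u l [s Es]].
  by exists (fun=> 0); rewrite big_nil big1 // => i _; rewrite mulr0.
rewrite big_cons Es; have [/eqP->|u0] := boolP (u == 0%MM).
  by exists s; rewrite r0 rmorph0 mul0r add0r.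
have [i ui] : exists i, (0 < u i)%N.
  apply/existsP; apply: contraNT u0; rewrite negb_exists => /forallP H.
  by apply/eqP/mnmP => i; rewrite mnm0E; apply/eqP; rewrite -leqn0 leqNgt.
exists (fun j => (if j == i then iota (co u r) * xmon (u - U_(i))%MM else 0) + s j).
under [RHS]eq_bigr do rewrite mulrDr.
rewrite big_split /=; congr (_ + _).
rewrite (bigD1 i) //= eqxx big1 ?addr0 => [|j /negbTE->]; last by rewrite mulr0.
by rewrite (xmonB ui) mulrCA.
Qed.

Lemma co0X i r : co 0%MM (x i * r) = 0.
Proof. by rewrite coX ?nonface0 // mnm0E. Qed.

Lemma co0M r s : co 0%MM r = 0 -> co 0%MM (s * r) = 0.
Proof.
move=> r0; rewrite mulrC; apply: co_mul_eq0 => w w0.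
suff -> : w = 0%MM by [].
apply/mnmP => i; apply/eqP; rewrite mnm0E -leqn0.
by have /mnm_lepP/(_ i) := w0; rewrite mnm0E.
Qed.

Lemma co0_iota c : co 0%MM (iota c) = c.
Proof. by rewrite -[iota c]mulr1 coZ co1 eqxx mulr1. Qed.

(** * Multigraded components of the Koszul complex *)

Section Components.

Implicit Types (c : Kk) (f g : K).

(** The sum of the c_S x^(al - S) e_S, homogeneous of multidegree al. Different [c] may give the
    same element, since x^(al - S) can vanish in R. *)
Definition kmono al (c : Kk) : K :=
  [ffun S : {set 'I_e} =>
     (if (mset S <= al)%MM then iota (c S) * xmon (al - mset S)%MM else 0 : R)].

Definition kcomp al (f : K) : Kk :=
  [ffun S : {set 'I_e} =>
     (if (mset S <= al)%MM then co (al - mset S)%MM (f S) else 0 : k)].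

(** Coefficients at other sets are invisible in [kmono al c] but would come back through the
    differential [dk]. *)
Definition subdeg al (c : Kk) : Prop := forall S, ~~ (mset S <= al)%MM -> c S = 0.

(** The S for which x^(al - S) e_S is a nonzero element; these elements form a k-basis of the
    component of degree al. *)
Definition inface al S : bool := (mset S <= al)%MM && ~~ nonface (al - mset S)%MM.

Lemma co_kmono u al c S : co u (kmono al c S) =
  if inface al S && (u == al - mset S)%MM then (c S : k) else 0.
Proof.
rewrite ffunE /inface; case: ifP => /= Sal; last exact: co0.
rewrite coZ co_xmon; case: eqP => [->|]; rewrite ?andbF ?mulr0 //.
by rewrite !andbT; case: (nonface _); rewrite ?mulr1 ?mulr0.
Qed.

Lemma kmono_eq al (c c' : Kk) : (forall S, inface al S -> c S = c' S) -> kmono al c = kmono al c'.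
Proof.
move=> H; apply/ffunP => S; apply: co_eq => u; rewrite !co_kmono.
by case: (boolP (inface al S)) => //= /H->.
Qed.

Lemma kmono_eq0 al c : (forall S, inface al S -> c S = 0) -> kmono al c = 0.
Proof.
move=> H; apply/ffunP => S; apply: co_eq => u; rewrite co_kmono ffunE co0.
by case: (boolP (inface al S)) => //= /H->; rewrite if_same.
Qed.

Lemma kmonoD al (c c' : Kk) : kmono al (c + c') = kmono al c + kmono al c'.
Proof.
apply/ffunP => S; rewrite !ffunE; case: ifP => _; last by rewrite addr0.
by rewrite rmorphD mulrDl.
Qed.

Lemma kmonoZ al (r : k) c : kmono al (r *: c) = iota r *: kmono al c.
Proof.
apply/ffunP => S; rewrite !ffunE; case: ifP => _; last by rewrite scaler0.
by rewrite rmorphM -mulrA.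
Qed.

Lemma kmono0 al : kmono al 0 = 0.
Proof. by rewrite -[X in kmono al X](scale0r 0) kmonoZ rmorph0 scale0r. Qed.

Lemma kmonoK al c S : inface al S -> kcomp al (kmono al c) S = c S.
Proof.
by move=> H; rewrite ffunE co_kmono H eqxx; case/andP: H => ->.
Qed.

Lemma kcompZ al (r : k) f : kcomp al (iota r *: f) = r *: kcomp al f.
Proof.
apply/ffunP => S; rewrite !ffunE; case: ifP; rewrite ?scaler0 // => _.
exact: coZ.
Qed.

Lemma kcomp0 al : kcomp al 0 = 0.
Proof. by rewrite -[X in kcomp al X](scale0r 0) -(rmorph0 iota) kcompZ scale0r. Qed.

Lemma kmono_deg j al c : koszul_deg j c -> koszul_deg j (kmono al c).
Proof. by move=> cj S nS; rewrite ffunE cj // rmorph0 mul0r if_same. Qed.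

Lemma kcomp_deg j al f : koszul_deg j f -> koszul_deg j (kcomp al f).
Proof. by move=> fj S nS; rewrite ffunE fj // co0 if_same. Qed.

Lemma kcomp_subdeg al f : subdeg al (kcomp al f).
Proof. by move=> S nS; rewrite ffunE (negbTE nS). Qed.

Lemma koszul_decomposition f : exists2 l : seq 'X_{1..e}, uniq l &
  f = \sum_(al <- l) kmono al (kcomp al f).
Proof.
have /fin_all_exists[ls lsP] : forall S : {set 'I_e},
    exists l : seq 'X_{1..e}, forall u, u \notin l -> co u (f S) = 0.
  by move=> S; have [l _ [_ H]] := mon_expansion (f S); exists l.
(* The multidegrees of the terms x^u e_B of f. *)
exists (undup (flatten [seq [seq (u + mset B)%MM | u <- ls B] | B <- enum {set 'I_e}])).
  exact: undup_uniq.
set l := undup _; apply/ffunP => S; apply: co_eq => u; rewrite sum_ffunE co_sum.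
have aux al : co u (kmono al (kcomp al f) S) =
    if al == (u + mset S)%MM then co u (f S) else 0.
  rewrite co_kmono ffunE; case: (al =P (u + mset S)%MM) => [->|nal].
    rewrite /inface addmK eqxx andbT lem_addl /=.
    by case: (boolP (nonface u)) => //= /co_nonface->.
  case: (boolP (inface al S)) => //= /andP[Sal _]; case: eqP => // Eu.
  by case: nal; rewrite Eu submK.
under eq_bigr do rewrite aux.
have [ul|ul] := boolP ((u + mset S)%MM \in l).
  rewrite (bigD1_seq _ ul) ?undup_uniq //= eqxx big1 ?addr0 // => al /negbTE->//.
rewrite big1_seq => [|al /andP[_ all]]; last by case: eqP => // E; rewrite -E all in ul.
apply: lsP; apply: contra ul => ul; rewrite mem_undup.
apply/flattenP; exists [seq (u + mset S)%MM | u <- ls S]; last exact: map_f.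
by apply/mapP; exists S; rewrite ?mem_enum.
Qed.

Lemma mset_setU1 (s : 'I_e) T : s \notin T -> mset (s |: T) = (U_(s) + mset T)%MM.
Proof.
move=> sT; apply/mnmP => i; rewrite mnmDE !msetE mnm1E !inE eq_sym.
by case: eqP => [<-|]; rewrite ?(negbTE sT).
Qed.

(** In a fixed multidegree S determines the monomial in front of e_S, so the differential becomes
    the simplicial boundary over k, the Koszul differential with all variables set to 1. *)
Lemma kdiff_mono al c : subdeg al c -> d (kmono al c) = kmono al (dk c).
Proof.
move=> cal; apply/ffunP => T; rewrite koszul_diffE [RHS]ffunE koszul_diffE.
case: ifP => Tal; last first.
  rewrite big1 // => s sT; rewrite ffunE; case: ifP; rewrite ?mulr0 //.
  move=> sTal; case/negP: (negbT Tal); rewrite mset_le in sTal *.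
  by rewrite mset_le; apply: subset_trans sTal; apply: subsetUr.
rewrite rmorph_sum mulr_suml; apply: eq_bigr => s sT.
rewrite ffunE mulr1; case: ifP => [sTal|/negbT/cal->]; last by rewrite mulr0 mulr0 rmorph0 mul0r.
rewrite rmorphM rmorphXn rmorphN1 -!mulrA; congr (_ * _).
rewrite mulrCA; congr (_ * _).
rewrite (xmonB (u := (al - mset T)%MM) (i := s)); last first.
  rewrite mnmBE msetE (negbTE sT) subn0.
  by move/mnm_lepP/(_ s): sTal; rewrite msetE setU11.
congr (_ * xmon _); apply/mnmP => i.
by rewrite !mnmBE mset_setU1 // mnmDE -subnDA addnC.
Qed.

Lemma kcomp_diff al f T : inface al T -> kcomp al (d f) T = dk (kcomp al f) T.
Proof.
move=> /andP[Tal NT]; rewrite ffunE Tal !koszul_diffE co_sum; apply: eq_bigr => s sT.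
rewrite -mulrA coZs mulr1 coX // ffunE; congr (_ * _).
rewrite mnmBE msetE (negbTE sT) subn0.
have -> : (0 < al s)%N = (mset (s |: T) <= al)%MM.
  rewrite !mset_le subUset sub1set inE -mset_le Tal andbT //.
case: ifP => // _; congr (co _ _); apply/mnmP => i.
by rewrite !mnmBE mset_setU1 // mnmDE -subnDA addnC.
Qed.

Lemma kcomp_cycle al f : d f = 0 -> forall S, inface al S -> dk (kcomp al f) S = 0.
Proof. by move=> f0 S iS; rewrite -kcomp_diff // f0 kcomp0 ffunE. Qed.

Lemma subdeg_wedge al v c : (0 < al v)%N -> subdeg al c -> subdeg al (wedge v c).
Proof.
move=> av cal S nS; rewrite wedgeE; case: ifP => // vS.
rewrite cal ?mulr0 //; apply: contra nS; rewrite !mset_le => H.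
by rewrite -(setD1K vS) subUset H andbT sub1set inE.
Qed.

Lemma wedge_deg (Q : comNzRingType) j v (c : koszul Q e) :
  koszul_deg j c -> koszul_deg j.+1 (wedge v c).
Proof.
move=> cj; rewrite -add1n; apply: kmul_deg => //.
by rewrite -[X in koszul_deg X](cards1 v); apply: kbasis_deg.
Qed.

(* Cartan homotopy for [e_v /\ _]. *)
Lemma kmono_homotopy al v c : (0 < al v)%N -> subdeg al c ->
  kmono al c = d (kmono al (wedge v c)) + kmono al (wedge v (dk c)).
Proof.
move=> av cal; rewrite kdiff_mono; last exact: subdeg_wedge.
by rewrite koszul_diff_wedge scale1r -kmonoD subrK.
Qed.

(** If the basis of the component is stable under removing v, it is a cone with apex v: the
    correction term of the homotopy only involves dk c at sets S :\ v, where it vanishes. *)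
Lemma kmono_cone_boundary al v c : (0 < al v)%N -> subdeg al c ->
  (forall S, v \in S -> inface al S -> inface al (S :\ v)) ->
  (forall S, inface al S -> dk c S = 0) ->
  kmono al c = d (kmono al (wedge v c)).
Proof.
move=> av cal cone c0; rewrite (kmono_homotopy av cal) [X in _ + X]kmono_eq0 ?addr0 //.
move=> S iS; rewrite wedgeE; case: ifP => // vS.
by rewrite c0 ?mulr0 //; apply: cone.
Qed.

(** Since x_v^2 divides x^al, the monomial x^(al - S) is still divisible by x_v when v is in S, and
    putting back one more factor x_v does not change its support. *)
Lemma cone_nonsquarefree al v : (1 < al v)%N ->
  forall S, v \in S -> inface al S -> inface al (S :\ v).
Proof.
move=> av S vS /andP[Sal NS]; apply/andP; split.
  by move: Sal; rewrite !mset_le; apply: subset_trans; apply: subD1set.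
apply: contra NS; rewrite /nonface; apply: C_up; apply/subsetP => i.
rewrite !inE !mnmBE !msetE !inE; case: eqP => [->|//] _.
by rewrite vS subn_gt0.
Qed.

End Components.

(** * The acyclic ideal of elements without squarefree component *)

Section NonSquarefreePart.

Implicit Types (c : Kk) (f g : K).

Definition nonsquarefree_part (f : K) : Prop :=
  forall S u, squarefree (u + mset S)%MM -> co u (f S) = 0.
Local Notation M := nonsquarefree_part.

Lemma nsqfD f g : M f -> M g -> M (f + g).
Proof. by move=> Mf Mg S u su; rewrite ffunE coD Mf // Mg // addr0. Qed.

Lemma nsqf0 : M 0.
Proof. by move=> S u su; rewrite ffunE co0. Qed.

Lemma nsqfN f : M f -> M (- f).
Proof. by move=> Mf S u su; rewrite ffunE -sub0r coB co0 Mf // subr0. Qed.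

Lemma nsqf_bar f : M f -> M (kbar f).
Proof. by move=> Mf S u su; rewrite ffunE coZs Mf // mulr0. Qed.

Lemma nsqf_mull f g : M f -> M (kmul f g).
Proof.
move=> Mf T u su; rewrite ffunE co_sum big1 // => A AT; rewrite coZs.
rewrite co_mul_eq0 ?mulr0 // => w wu; apply: Mf; apply: squarefree_le su.
apply: mnm_leD => //; rewrite mset_le support_mset //.
Qed.

Lemma nsqf_mulr f g : M g -> M (kmul f g).
Proof.
move=> Mf T u su; rewrite ffunE co_sum big1 // => A AT; rewrite coZs.
rewrite [X in co u X]mulrC co_mul_eq0 ?mulr0 // => w wu; apply: Mf.
apply: squarefree_le su.
by apply: mnm_leD => //; rewrite mset_le support_mset subsetDl.
Qed.

Lemma nsqf_kmono al c : ~~ squarefree al -> M (kmono al c).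
Proof.
move=> nal S u su; rewrite co_kmono.
case: (boolP (inface al S)) => //= /andP[Sal _]; case: eqP => // Eu.
by rewrite Eu submK // (negbTE nal) in su.
Qed.

Lemma nsqf_kmono_mul al be (c c' : Kk) : ~~ squarefree (al + be)%MM ->
  M (kmul (kmono al c) (kmono be c')).
Proof.
move=> nab T u su; rewrite ffunE co_sum big1 // => A AT; rewrite coZs.
suff -> : co u ((kmono al c A : R) * (kmono be c' (T :\: A) : R)) = 0 by rewrite mulr0.
rewrite !ffunE; case: ifP => Aal; last by rewrite mul0r co0.
case: ifP => Bbe; last by rewrite mulr0 co0.
rewrite mulrACA -rmorphM -xmonD coZ co_xmon; case: eqP => [Eu|]; rewrite ?andbF ?mulr0 //.
case/negP: nab; move: su; congr (is_true (squarefree _)); apply/mnmP => i.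
rewrite Eu !mnmDE !mnmBE !msetE inE.
have /mnm_lepP/(_ i) := Aal; have /mnm_lepP/(_ i) := Bbe; rewrite !msetE inE.
have := subsetP AT i; case: (i \in A); case: (i \in T) => //=; lia.
Qed.

Lemma nsqf_kcomp f al : M f -> squarefree al -> kcomp al f = 0.
Proof.
move=> Mf sal; apply/ffunP => S; rewrite !ffunE; case: ifP => // Sal.
by apply: Mf; rewrite submK.
Qed.

(** In every multidegree that occurs some exponent is at least 2, and its vertex is the apex of a
    cone. The primitive has the same multidegree and so stays in the ideal. *)
Lemma nsqf_boundary f : M f -> d f = 0 -> exists g,
  [/\ M g, d g = f & forall i, koszul_deg i f -> koszul_deg i.+1 g].
Proof.
move=> Mf df; have [l ul E] := koszul_decomposition f.
pose bd al (g : K) := [/\ M g, d g = kmono al (kcomp al f) &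
   forall i, koszul_deg i f -> koszul_deg i.+1 g].
have bdP al : exists g, bd al g.
  have [sal|nal] := boolP (squarefree al).
    exists 0; split; first exact: nsqf0.
      by rewrite koszul_diff0 nsqf_kcomp // kmono0.
    by move=> i _; apply: koszul_deg0.
  have [v av] : exists v, (1 < al v)%N.
    by move: nal; rewrite negb_forall => /existsP[v]; rewrite -ltnNge; exists v.
  exists (kmono al (wedge v (kcomp al f))); split.
  - exact: nsqf_kmono.
  - rewrite -kmono_cone_boundary //; first exact: ltnW.
    + exact: kcomp_subdeg.
    + exact: cone_nonsquarefree.
    + exact: kcomp_cycle.
  by move=> i fi; apply/kmono_deg/wedge_deg/kcomp_deg.
suff [g [Mg dg deg]] : exists g, [/\ M g, d g = \sum_(al <- l) kmono al (kcomp al f) &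
   forall i, koszul_deg i f -> koszul_deg i.+1 g].
  by exists g; split=> //; rewrite dg -E.
elim: l {ul E} => [|al l [g [Mg dg deg]]].
  exists 0; rewrite big_nil koszul_diff0; split=> //; first exact: nsqf0.
  by move=> i _; apply: koszul_deg0.
have [g' [Mg' dg' deg']] := bdP al.
exists (g' + g); rewrite big_cons koszul_diffD dg dg'; split=> //.
  exact: nsqfD.
by move=> i fi; apply: koszul_degD; [apply: deg'|apply: deg].
Qed.

(** The constant term of f S contributes in multidegree S, which is squarefree. Values of a Massey
    operation chosen in this ideal therefore have entries in the maximal ideal. *)
Lemma nsqf_max f S : M f -> co 0%MM (f S) = 0.
Proof. by move=> Mf; apply: Mf; rewrite add0m mset_squarefree. Qed.

End NonSquarefreePart.

End StanleyReisner.

(** * The Golod resolution *)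

Lemma ideal_gen_lin (R : comNzRingType) (S : R -> Prop) a x y :
  ideal_gen S x -> ideal_gen S y -> ideal_gen S (a * x + y).
Proof.
move=> [r [b [g [gP ->]]]] [r' [b' [g' [gP' ->]]]]; exists (r + r')%N.
exists (fun i => match split i with inl i => a * b i | inr i => b' i end).
exists (fun i => match split i with inl i => g i | inr i => g' i end); split.
  by move=> i; case: (split i).
rewrite big_split_ord mulr_sumr /=; congr (_ + _); apply: eq_bigr => i _.
  by rewrite (unsplitK (inl i)) mulrA.
by rewrite (unsplitK (inr i)).
Qed.

Section GolodResolution.

Variables (k : fieldType) (R : comNzRingType) (iota : {rmorphism k -> R}).
Variable m : R -> Prop.
Hypothesis m0 : m 0.
Hypothesis mD : forall r s, m r -> m s -> m (r + s).
Hypothesis mM : forall r s, m s -> m (r * s).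
Hypothesis m_res : forall r, exists c, m (r - iota c).
Hypothesis m_iota : forall c, m (iota c) -> c = 0.

Variables (e : nat) (x : 'I_e -> R).
Hypothesis m_x : forall i, m (x i).
Hypothesis m_gen : forall r, m r -> exists s : 'I_e -> R, r = \sum_i x i * s i.

Local Notation K := (koszul R e).
Local Notation d := (koszul_diff x).

Lemma kone_boundary r : m r -> exists2 g : K, koszul_deg 1 g & d g = r *: kone R e.
Proof.
move=> /m_gen[s ->]; exists (\sum_i s i *: wedge i (kone R e)).
  apply: koszul_deg_sum => i _; apply: koszul_degZ; apply: wedge_deg.
  by rewrite -[X in koszul_deg X](@cards0 'I_e); apply: kbasis_deg.
rewrite koszul_diff_sum scaler_suml; apply: eq_bigr => i _.
rewrite koszul_diffZ koszul_diff_wedge koszul_diff1 /wedge kmul0r subr0.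
by rewrite scalerA mulrC.
Qed.

(** The product of f with a primitive of r times 1: the maximal ideal annihilates Koszul homology.
    This is why the hypotheses on [gam] can use coefficients in R modulo m instead of k. *)
Lemma m_boundary r j (f : K) : m r -> koszul_deg j f -> d f = 0 ->
  exists2 g : K, koszul_deg j.+1 g & d g = r *: f.
Proof.
move=> /kone_boundary[g g1 dg] fj df; exists (kmul g f).
  by rewrite -add1n; apply: kmul_deg.
by rewrite koszul_diffM dg df kmul0r addr0 kmulZl kmul1l.
Qed.

Variables (I : finType) (jd : I -> nat) (gam : seq I -> K).

(** The letter g stands for a homology class of degree jd g + 1, shifted by one as in a bar
    construction. *)
Definition letter_weight (g : I) : nat := (jd g).+2.

Definition word_weight (w : seq I) : nat := sumn (map letter_weight w).

(** A letter has positive weight, so a word of weight at most i has length at most i and is found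
    among the bounded sequences. *)
Definition words_le (i : nat) : seq (seq I) :=
  filter (fun w => word_weight w <= i)%N (map val (enum {bseq i of I})).

Local Notation wtl := letter_weight.
Local Notation wt := word_weight.

(* [gam] is a trivial Massey operation on the classes of the cycles [gam [:: g]]. *)
Hypothesis gam0 : gam [::] = 0.
Hypothesis gam_deg : forall p, koszul_deg (wt p).-1 (gam p).
Hypothesis gam_diff : forall p, d (gam p) =
  - \sum_(j < (size p).+1) kmul (kbar (gam (take j p))) (gam (drop j p)).
Hypothesis gam_min : forall p S, m (gam p S).
Hypothesis gam_span : forall j f, koszul_deg j.+1 f -> d f = 0 ->
  exists (r : I -> R) (h : K), koszul_deg j.+2 h /\
    f = \sum_(g | jd g == j) r g *: gam [:: g] + d h.
Hypothesis gam_ind : forall j (r : I -> R) (h : K), koszul_deg j.+2 h ->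
  \sum_(g | jd g == j) r g *: gam [:: g] = d h ->
  forall g, jd g = j -> m (r g).

Lemma word_weight_cat p q : wt (p ++ q) = (wt p + wt q)%N.
Proof. by rewrite /wt map_cat sumn_cat. Qed.

Lemma word_weight_rcons p g : wt (rcons p g) = (wt p + wtl g)%N.
Proof. by rewrite -cats1 word_weight_cat /wt /= addn0. Qed.

Lemma size_le_word_weight p : (size p <= wt p)%N.
Proof. by elim: p => //= g p IH; rewrite /wt /= -addn1 addnC leq_add. Qed.

Lemma word_weight0 p : (wt p == 0%N) = (p == [::]).
Proof. by case: p => //= g p. Qed.

Lemma words_le_uniq i : uniq (words_le i).
Proof. by rewrite filter_uniq // map_inj_uniq ?enum_uniq //; apply: val_inj. Qed.

Lemma mem_words_le i w : (w \in words_le i) = (wt w <= i)%N.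
Proof.
rewrite mem_filter; case: (boolP (wt w <= i)%N) => //= wi.
apply/mapP; exists (Bseq (leq_trans (size_le_word_weight w) wi)) => //.
by rewrite mem_enum.
Qed.

Lemma words_le_rcons i : perm_eq (words_le i)
  ([::] :: flatten [seq [seq rcons w g | w <- words_le (i - wtl g)]
                   | g <- enum I & (wtl g <= i)%N]).
Proof.
apply: uniq_perm; first exact: words_le_uniq.
  rewrite /=; apply/andP; split.
    by apply/flattenP => -[s /mapP[g _ ->] /mapP[w _]]; case: w.
  apply: (allpairs_uniq_dep (f := fun g w => rcons w g)).
  - by rewrite filter_uniq // enum_uniq.
  - by move=> g _; apply: words_le_uniq.
  move=> [g w] [g' w'] /= _ _ /rcons_inj[-> ->] //.
move=> w; rewrite mem_words_le inE; case/lastP: w => [|w g].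
  by rewrite eqxx.
rewrite word_weight_rcons -size_eq0 size_rcons /=.
apply/idP/flattenP => [wi|[s /mapP[g' gi ->] /mapP[w' w'i /rcons_inj[-> ->]]]].
  exists [seq rcons w g | w <- words_le (i - wtl g)].
    by apply: map_f; rewrite mem_filter mem_enum andbT (leq_trans _ wi) ?leq_addl.
  by apply: map_f; rewrite mem_words_le leq_subRL ?(leq_trans _ wi) ?leq_addl // addnC.
move: gi w'i; rewrite mem_filter mem_words_le => /andP[gi _].
by rewrite leq_subRL // addnC.
Qed.

Definition golod_rank (i : nat) : nat := twisted_rank e wt words_le i.

(** Splitting off the last letter. For the generating series P this says P = (1 + z)^e + P Z, where
    Z sums z^(wtl g) over the letters: the Golod formula. *)
Lemma golod_rank_rec i : golod_rank i =
  ('C(e, i) + \sum_(g | (wtl g <= i)%N) golod_rank (i - wtl g))%N.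
Proof.
rewrite /golod_rank twisted_rankE.
rewrite (perm_big _ (words_le_rcons i)) /= big_cons.
rewrite {1}/wt /= subn0; congr (_ + _)%N.
rewrite big_flatten big_map big_filter /= big_enum_cond /=.
apply: eq_bigr => g gi; rewrite big_map.
rewrite twisted_rankE.
by apply: eq_bigr => w _; rewrite word_weight_rcons subnDA subnAC.
Qed.

(* [N] only makes the sum finite: see [golod_diff_bound]. *)
Definition golod_diff (N : nat) (f : seq I -> K) (w : seq I) : K :=
  d (f w) + \sum_(p <- words_le N) kmul (kbar (f (p ++ w))) (gam p).

Local Notation DN := golod_diff.
Local Notation tdeg := (twisted_deg wt).

Lemma golod_diffD N f g w : DN N (fun w => f w + g w) w = DN N f w + DN N g w.
Proof.
rewrite /DN koszul_diffD addrACA -big_split; congr (_ + _).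
by apply: eq_bigr => p _; rewrite kbarD kmulDl.
Qed.

Lemma golod_diffZ N r f w : DN N (fun w => (r : R) *: f w) w = r *: DN N f w.
Proof.
rewrite /DN koszul_diffZ scalerDr scaler_sumr; congr (_ + _).
by apply: eq_bigr => p _; rewrite kbarZ kmulZl.
Qed.

Lemma golod_diffB N f g w : DN N (fun w => f w - g w) w = DN N f w - DN N g w.
Proof.
rewrite -[in RHS]scaleN1r -golod_diffZ -golod_diffD; congr (DN N _ w).
by apply: functional_extensionality => v; rewrite scaleN1r.
Qed.

Lemma golod_diff_deg N i f : tdeg i.+1 f -> tdeg i (DN N f).
Proof.
move=> fi w S nS; rewrite ffunE sum_ffunE.
have -> : d (f w) S = 0.
  rewrite koszul_diffE big1 // => s sS; rewrite fi ?mulr0 //.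
  by rewrite cardsU1 sS add1n addnS eqSS.
rewrite add0r big1 // => p _; rewrite ffunE big1 // => A AS.
have [->|p0] := eqVneq p [::]; first by rewrite gam0 [X in _ * (_ * X)]ffunE !mulr0.
case: (boolP (wt (p ++ w) + #|A| == i.+1)%N) => [/eqP E|nE]; last first.
  by rewrite ffunE fi // mulr0 mul0r mulr0.
rewrite gam_deg ?mulr0 ?mulr0 //.
have pw : (0 < wt p)%N by rewrite lt0n word_weight0.
rewrite cardsD (setIidPr AS); have := subset_leq_card AS.
move: E nS; rewrite word_weight_cat; move: (wt p) (wt w) pw => a b; lia.
Qed.

Lemma golod_diff_bound N N' i f w : tdeg i f -> (i <= N)%N -> (i <= N')%N -> DN N f w = DN N' f w.
Proof.
suff H M : tdeg i f -> (i <= M)%N -> DN M f w = DN i f w.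
  by move=> fi iN iN'; rewrite (H N) // (H N').
move=> fi iM; rewrite /DN; congr (_ + _).
rewrite (bigID (fun p => wt p <= i)%N) /= [X in _ + X]big1 ?addr0; last first.
  move=> p ni; rewrite [f _](_ : _ = 0) ?kbar0 ?kmul0l //.
  apply/ffunP => S; rewrite ffunE fi //; apply: contra ni => /eqP <-.
  by rewrite word_weight_cat -addnA leq_addr.
rewrite -big_filter; apply: perm_big; apply: uniq_perm.
- by rewrite filter_uniq // words_le_uniq.
- exact: words_le_uniq.
move=> p; rewrite mem_filter !mem_words_le; case: (boolP (wt p <= i)%N) => // pi.
by rewrite (leq_trans pi).
Qed.

(** The first list indexes the terms of [gam_diff], one for each cut of a word, the second one the
    pairs of prefixes removed when the differential is applied twice. *)
Lemma word_splits N : perm_eq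
  [seq (take j r, drop j r) | r <- words_le N, j <- seq.iota 0 (size r).+1]
  [seq pq <- [seq (p, q) | p <- words_le N, q <- words_le N] | (wt (pq.1 ++ pq.2) <= N)%N].
Proof.
apply: uniq_perm.
- apply: allpairs_uniq_dep; first exact: words_le_uniq.
    by move=> r _; apply: iota_uniq.
  move=> [r j] [r' j'] /flattenP[s /mapP[r1 _ ->] /mapP[j1 jr E1]].
  have Ej : j = j1 := congr1 (fun p : {_ : seq I & nat} => tagged p) E1.
  have Er : r = r1 := congr1 (fun p : {_ : seq I & nat} => tag p) E1.
  subst r1 j1 => {E1}.
  move=> /flattenP[s' /mapP[r2 _ ->] /mapP[j2 jr' E2]].
  have Ej : j' = j2 := congr1 (fun p : {_ : seq I & nat} => tagged p) E2.
  have Er : r' = r2 := congr1 (fun p : {_ : seq I & nat} => tag p) E2.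
  subst r2 j2 => {E2}.
  move=> [E1 E2].
  have Err : r = r' by rewrite -(cat_take_drop j r) E1 E2 cat_take_drop.
  subst r'; congr existT.
  have := congr1 size E1; rewrite !size_take_min.
  by move: jr jr'; rewrite !mem_iota !add0n /= !ltnS => /minn_idPl-> /minn_idPl->.
- rewrite filter_uniq //; apply: allpairs_uniq; try exact: words_le_uniq.
  by move=> [a b] [a' b'] _ _ [-> ->].
move=> [p q]; rewrite mem_filter.
apply/allpairsPdep/andP => /= [[r [j [rN _ [-> ->]]]]|[pqN _]].
  rewrite cat_take_drop; move: rN; rewrite mem_words_le => rN; split=> //.
  apply/allpairsP; exists (take j r, drop j r); split => //=.
    rewrite mem_words_le; apply: leq_trans rN.
    by rewrite -[X in (_ <= wt X)%N](cat_take_drop j r) word_weight_cat leq_addr.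
  rewrite mem_words_le; apply: leq_trans rN.
  by rewrite -[X in (_ <= wt X)%N](cat_take_drop j r) word_weight_cat leq_addl.
exists (p ++ q), (size p); split.
- by rewrite mem_words_le.
- by rewrite inE mem_iota size_cat; case: (size p) => //= n; lia.
by rewrite take_size_cat // drop_size_cat.
Qed.

(** The terms involving one prefix cancel by the Leibniz rule, those involving two by the Massey
    relation [gam_diff]. *)
Lemma golod_diffK N i f : tdeg i f -> (i <= N)%N -> forall w, DN N (DN N f) w = 0.
Proof.
move=> fi iN w; rewrite {1}/DN {1}/DN koszul_diffD koszul_diffK add0r koszul_diff_sum.
under eq_bigr do rewrite koszul_diffM koszul_diff_bar kmulNl kbarK.
under [X in _ + X]eq_bigr do rewrite /DN kbarD kmulDl.
rewrite !big_split /= sumrN addrACA addNr add0r.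
under [X in _ + X]eq_bigr do rewrite kbar_sum kmul_suml.
pose F (pq : seq I * seq I) :=
  kmul (f (pq.1 ++ pq.2 ++ w)) (kmul (kbar (gam pq.1)) (gam pq.2)).
have -> : \sum_(p <- words_le N) kmul (f (p ++ w)) (d (gam p)) =
    - \sum_(pq <- [seq (take j r, drop j r) | r <- words_le N, j <- seq.iota 0 (size r).+1]) F pq.
  rewrite big_allpairs_dep -sumrN; apply: eq_bigr => r _.
  rewrite gam_diff kmulNr kmul_sumr -(big_mkord xpredT (fun j => kmul (f (r ++ w)) (kmul (kbar (gam (take j r))) (gam (drop j r))))).
  congr (- _); rewrite /index_iota subn0; apply: eq_bigr => j _.
  by rewrite /F /= catA cat_take_drop.
rewrite (perm_big _ (word_splits N)) /= big_filter.
have -> : \sum_(q <- words_le N) \sum_(p <- words_le N)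
     kmul (kbar (kmul (kbar (f (p ++ q ++ w))) (gam p))) (gam q) =
   \sum_(pq <- [seq (p, q) | p <- words_le N, q <- words_le N]) F pq.
  rewrite exchange_big big_allpairs; apply: eq_bigr => p _; apply: eq_bigr => q _.
  by rewrite kbarM kbarK -kmulA.
(* Pairs whose concatenation is heavier than N have no counterpart, but f vanishes there for reasons
   of degree. *)
rewrite [X in _ + X](bigID (fun pq => wt (pq.1 ++ pq.2) <= N)%N) /=.
rewrite addrA addNr add0r big1 // => -[p q] /= npq.
rewrite /F /= [f _](_ : _ = 0) ?kmul0l //.
apply/ffunP => S; rewrite ffunE fi //; apply: contra npq => /eqP E.
by apply: leq_trans iN; rewrite -E catA [X in (_ <= X + _)%N]word_weight_cat -addnA leq_addr.
Qed.

(** The differential only removes prefixes, so it commutes with fixing the last letter. *)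
Lemma golod_diff_rcons N f w g : DN N f (rcons w g) = DN N (fun w => f (rcons w g)) w.
Proof. by rewrite /DN; congr (_ + _); apply: eq_bigr => p _; rewrite rcons_cat. Qed.

Lemma letters_sum N (F : seq I -> K) : (forall p, size p != 1%N -> F p = 0) ->
  \sum_(p <- words_le N) F p = \sum_(g | (wtl g <= N)%N) F [:: g].
Proof.
move=> F0; rewrite (bigID (fun p => size p == 1%N)) /= [X in _ + X]big1 // addr0.
have -> : \sum_(g | (wtl g <= N)%N) F [:: g] =
    \sum_(g <- [seq g <- enum I | (wtl g <= N)%N]) F [:: g].
  by rewrite big_filter big_enum_cond.
rewrite -big_filter -(big_map (fun g => [:: g]) xpredT F); apply: perm_big; apply: uniq_perm.
- by rewrite filter_uniq // words_le_uniq.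
- rewrite map_inj_uniq; first by rewrite filter_uniq // enum_uniq.
  by move=> g g' [->].
move=> p; rewrite mem_filter mem_words_le.
apply/andP/mapP => [[]|[g + ->]]; last by rewrite mem_filter mem_enum /wt /= addn0 andbT.
case: p => // g [] // _; rewrite /wt /= addn0 => gN.
by exists g => //; rewrite mem_filter mem_enum gN.
Qed.

Lemma tdegD i (f g : seq I -> K) : tdeg i f -> tdeg i g -> tdeg i (fun w => f w + g w).
Proof. by move=> fi gi w S nS; rewrite ffunE fi // gi // addr0. Qed.

Lemma tdegB i (f g : seq I -> K) : tdeg i f -> tdeg i g -> tdeg i (fun w => f w - g w).
Proof. by move=> fi gi w S nS; rewrite !ffunE fi // gi // subr0. Qed.

Lemma koszul_deg0E (f : K) : koszul_deg 0 f -> f = (f set0 : R) *: kone R e.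
Proof.
move=> f0; apply/ffunP => S; rewrite !ffunE; case: eqP => [->|/eqP S0].
  by rewrite [LHS](esym (mulr1 (f set0 : R))).
by rewrite scaler0 f0 // cards_eq0.
Qed.

Lemma kone_deg : koszul_deg 0 (kone R e).
Proof. by rewrite -[X in koszul_deg X](@cards0 'I_e); apply: kbasis_deg. Qed.

(* Modulo the words of length 0 the complex is a sum of shifted copies of itself,
   one for each last letter, which gives the induction; what is left is supported
   on words of length at most 1 and is handled by the Koszul homology. *)
Lemma golod_exact N i f : tdeg i.+1 f -> (i.+2 <= N)%N -> (forall w, DN N f w = 0) ->
  exists2 g, tdeg i.+2 g & f = DN N g.
Proof.
have [n] := ubnP i; elim: n i f => // n IH i f; rewrite ltnS => lein fi iN Df.
(* The part of f with last letter g is a cycle of degree i.+1 - wtl g. It bounds by induction unless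
   this degree is 0; the letters of weight i.+1 are left to [r1] below. *)
have /fin_all_exists[h hP] (g : I) : exists h : seq I -> K,
    [/\ forall w (S : {set 'I_e}), (wt w + wtl g + #|S|)%N != i.+2 -> h w S = 0 &
       wtl g != i.+1 -> forall w, f (rcons w g) = DN N h w].
  pose fg w := f (rcons w g).
  have Dfg w : DN N fg w = 0 by rewrite -golod_diff_rcons.
  case: (ltngtP (wtl g) i.+1) => gi; last first.
  - by exists (fun=> 0); split => // w S _; rewrite ffunE.
  - exists (fun=> 0); split => [w S _|_ w]; first by rewrite ffunE.
    rewrite /DN big1 ?addr0; last by move=> p _; rewrite kbar0 kmul0l.
    rewrite koszul_diff0; apply/ffunP => S; rewrite ffunE fi // word_weight_rcons.
    by apply/negP => /eqP; move: gi; move: (wtl g) (wt w) #|S| => b a c; lia.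
  have gE : i.+1 = ((i - wtl g).+1 + wtl g)%N by lia.
  have [||||h hdeg hE] := IH (i - wtl g)%N fg.
  - by apply: leq_trans lein; move: gi; rewrite /wtl; lia.
  - move=> w S nS; rewrite /fg fi // word_weight_rcons; apply: contra nS => /eqP E.
    by apply/eqP; move: gi E; move: (wtl g) (wt w) #|S| => b a c; lia.
  - by apply: leq_trans iN; lia.
  - exact: Dfg.
  exists h; split; last by move=> _ w; rewrite -[LHS]/(fg w) hE.
  move=> w S nS; rewrite hdeg //; apply: contra nS => /eqP E; apply/eqP.
  by move: gi E; move: (wtl g) (wt w) #|S| => b a c; lia.
pose H w : K := if w is a :: s then h (last a s) (belast a s) else 0.
have H_rcons w g : H (rcons w g) = h g w.
  by case: w => //= a s; rewrite last_rcons belast_rcons.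
have Hdeg : tdeg i.+2 H.
  move=> w S; case/lastP: w => [|w g]; first by rewrite ffunE.
  by rewrite H_rcons word_weight_rcons; case: (hP g) => Hg _; apply: Hg.
(* What remains lives on the empty word and on the one-letter words of weight i.+1, where it
   consists of scalars. *)
pose f1 w := f w - DN N H w.
have f1deg : tdeg i.+1 f1 by apply: tdegB => //; apply: golod_diff_deg.
have Df1 w : DN N f1 w = 0 by rewrite golod_diffB Df (golod_diffK Hdeg iN) subr0.
have f1_rcons w g : wtl g != i.+1 -> f1 (rcons w g) = 0.
  move=> gi; rewrite /f1 golod_diff_rcons; case: (hP g) => _ /(_ gi w)->.
  rewrite (_ : (fun w => H (rcons w g)) = h g) ?subrr //.
  by apply: functional_extensionality => v; apply: H_rcons.
have f1_2 w : (1 < size w)%N -> f1 w = 0.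
  case/lastP: w => // w g; rewrite size_rcons ltnS => w0.
  have [gi|/f1_rcons->//] := eqVneq (wtl g) i.+1.
  apply/ffunP => S; rewrite [RHS]ffunE f1deg // word_weight_rcons gi.
  apply/negP => /eqP; have : (0 < wt w)%N by rewrite lt0n word_weight0 -size_eq0 -lt0n.
  by move: (wt w) => a; lia.
pose r1 g : R := f1 [:: g] set0.
have f1_1 g : wtl g = i.+1 -> f1 [:: g] = r1 g *: kone R e.
  move=> gi; apply: koszul_deg0E => S nS; apply: f1deg.
  by rewrite /wt /= gi addn0 -[X in _ != X]addn0 eqn_add2l.
(* On the empty word the cycle condition makes the combination of the [gam [:: g]] with these
   scalars a boundary, so [gam_ind] puts them in m. Then [H2] removes them. *)
have r1m g : wtl g = i.+1 -> m (r1 g).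
  move=> gi; have gi' : jd g = i.-1 by move: gi; rewrite /wtl; lia.
  have i0 : (0 < i)%N by move: gi; rewrite /wtl; lia.
  apply: (gam_ind (j := i.-1) (h := - f1 [::]) _ _ gi').
    move=> S nS; rewrite [LHS]ffunE f1deg ?oppr0 // /wt /= add0n.
    by apply: contra nS => /eqP->; apply/eqP; lia.
  rewrite koszul_diffN; apply/eqP; rewrite -subr_eq0 opprK addrC.
  apply/eqP; rewrite -[RHS](Df1 [::]) /DN; congr (_ + _).
  under [RHS]eq_bigr do rewrite cats0.
  rewrite letters_sum => [|p]; last first.
    case: p => [|g' [|g'' p]] // _; first by rewrite gam0 kmul0r.
    by rewrite f1_2 // kbar0 kmul0l.
  rewrite [RHS](bigID (fun g => jd g == i.-1)) /= [X in _ + X]big1 ?addr0; last first.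
    move=> g' /andP[_ ng']; rewrite -[[:: g']]/(rcons [::] g') f1_rcons ?kbar0 ?kmul0l //.
    by apply: contra ng' => /eqP; rewrite /wtl => E; apply/eqP; lia.
  apply: eq_big => [g'|g' /eqP g'i].
    case: eqP => [E|]; last by rewrite andbF.
    by rewrite andbT; symmetry; rewrite /wtl E; apply/idP; lia.
  rewrite f1_1; last by rewrite /wtl g'i; lia.
  by rewrite kbarZ (kbar_deg kone_deg) expr0 scale1r kmulZl kmul1l.
have /fin_all_exists[kg kgP] g : exists kg : K, koszul_deg 1 kg /\
    (wtl g = i.+1 -> d kg = r1 g *: kone R e).
  have [/r1m/kone_boundary[kg kg1 E]|ng] := eqVneq (wtl g) i.+1; first by exists kg.
  by exists 0; split; [exact: koszul_deg0|move=> E; rewrite E eqxx in ng].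
pose H2 w : K := if w is [:: g] then if wtl g == i.+1 then kg g else 0 else 0.
have H2deg : tdeg i.+2 H2.
  move=> [|g [|g' w]] S nS; rewrite /= ?ffunE //; case: eqP => gi; last by rewrite ffunE.
  case: (kgP g) => + _; apply; apply: contra nS => /eqP ->.
  by rewrite /wt /= gi; apply/eqP; lia.
pose f2 w := f1 w - DN N H2 w.
have f2deg : tdeg i.+1 f2 by apply: tdegB => //; apply: golod_diff_deg.
have Df2 w : DN N f2 w = 0 by rewrite golod_diffB Df1 (golod_diffK H2deg iN) subr0.
have f2_0 w : w != [::] -> f2 w = 0.
  case: w => // g w _; rewrite /f2 /DN.
  rewrite big1 ?addr0 => [|p _]; last first.
    case: p => [|g' p]; first by rewrite gam0 kmul0r.
    by rewrite (_ : H2 _ = 0) ?kbar0 ?kmul0l //= /H2; case: p.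
  case: w => [|g' w] /=; last by rewrite f1_2 // koszul_diff0 subr0.
  case: eqP => [gi|/eqP gi]; last first.
    by rewrite koszul_diff0 subr0; apply: (f1_rcons [::]).
  by case: (kgP g) => _ ->; rewrite // f1_1 // subrr.
(* Only a Koszul cycle on the empty word is left. Its class is absorbed by the letters with jd g =
   i, which have weight i.+2. *)
have [|| s [h3 [h3deg h3E]]] := @gam_span i (f2 [::]).
- move=> S nS; apply: f2deg; by rewrite /wt /= add0n.
- rewrite -[RHS](Df2 [::]) /DN big1 ?addr0 // => p _; rewrite cats0.
  by have [->|/f2_0->] := eqVneq p [::]; rewrite ?gam0 ?kmul0r // kbar0 kmul0l.
pose H3 w : K := match w with
  | [::] => h3 | [:: g] => if jd g == i then s g *: kone R e else 0 | _ => 0 end.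
have H3deg : tdeg i.+2 H3.
  move=> [|g [|g' w]] S nS; rewrite /= ?ffunE //.
    by apply: h3deg; apply: contra nS => /eqP->; rewrite /wt /= add0n.
  case: eqP => gi; last by rewrite ffunE.
  apply: (koszul_degZ _ kone_deg); apply: contra nS => /eqP->.
  by rewrite /wt /= /wtl gi; apply/eqP; lia.
have f3E w : f2 w = DN N H3 w.
  case: w => [|g w]; last first.
    rewrite f2_0 // /DN big1 ?addr0 => [|p _]; last first.
      case: p => [|g' p]; first by rewrite gam0 kmul0r.
      by rewrite (_ : H3 _ = 0) ?kbar0 ?kmul0l //= /H3; case: p.
    case: w => [|g' w] /=; last by rewrite koszul_diff0.
    by case: eqP => _; rewrite ?koszul_diffZ ?koszul_diff1 ?scaler0 ?koszul_diff0.
  rewrite h3E addrC /DN; congr (_ + _).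
  under [RHS]eq_bigr do rewrite cats0.
  rewrite letters_sum => [|p]; last first.
    by case: p => [|g' [|g'' p]] // _; rewrite ?gam0 ?kmul0r // kbar0 kmul0l.
  rewrite [RHS](bigID (fun g => jd g == i)) /= [X in _ + X]big1 ?addr0; last first.
    by move=> g' /andP[_ /negbTE->]; rewrite kbar0 kmul0l.
  apply: eq_big => [g'|g' /eqP g'i].
    case: eqP => [E|]; last by rewrite andbF.
    by rewrite andbT; symmetry; rewrite /wtl E; apply/idP; lia.
  by rewrite g'i eqxx kbarZ (kbar_deg kone_deg) expr0 scale1r kmulZl kmul1l.
exists (fun w => H w + (H2 w + H3 w)); first by do 2!apply: tdegD => //.
apply: functional_extensionality => w.
rewrite !golod_diffD -f3E /f2 /f1; by rewrite [DN N H2 w + _]addrC subrK addrC subrK.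
Qed.

Lemma m_opp r : m r -> m (- r).
Proof. by move=> mr; rewrite -mulN1r; apply: mM. Qed.

Lemma golod_diff_min N f w S : m (DN N f w S).
Proof.
rewrite ffunE; apply: mD.
  rewrite koszul_diffE; apply: (ideal_sum m0 mD) => s _.
  by rewrite mulrC; apply: mM; apply: mM.
rewrite sum_ffunE; apply: (ideal_sum m0 mD) => p _; rewrite ffunE.
by apply: (ideal_sum m0 mD) => A _; do 2!apply: mM.
Qed.

Lemma golod_tor_dim i : tor_dim iota m i (golod_rank i).
Proof.
(* The differential leaving degree j.+1 is truncated at weight j.+1; by [golod_diff_bound] any
   larger bound gives the same map. *)
apply: (twisted_tor_dim m0 mD mM m_res m_iota (w0 := [::]) words_le_uniq mem_words_le word_weight0
  (D := fun j => golod_diff j.+1)).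
- by move=> j r f g w; rewrite golod_diffD golod_diffZ.
- by move=> j f; apply: golod_diff_deg.
- move=> f f0; split=> [/kone_boundary[g g1 Eg]|[g g1 ->]]; last exact: golod_diff_min.
  exists (fun w => if w is [::] then g else 0).
    by move=> [|a w] S nS; rewrite ?ffunE // g1.
  apply: functional_extensionality => w; rewrite /DN big1 ?addr0; last first.
    move=> p _; case: p => [|a p]; first by rewrite gam0 kmul0r.
    by rewrite kbar0 kmul0l.
  case: w => [|a w]; last first.
    rewrite koszul_diff0; apply/ffunP => S; rewrite ffunE f0 //.
  rewrite Eg; apply: koszul_deg0E => S nS; exact: f0.
- move=> j f fj; split=> [Df|[g gj ->] w].
    have [w|g gj E] := @golod_exact j.+2 j f fj (leqnn _).
      by rewrite (@golod_diff_bound _ j.+1 j.+1).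
    by exists g.
  have gj' := golod_diff_deg j.+2 gj.
  by rewrite (@golod_diff_bound j.+1 j.+2 j.+1) // (golod_diffK gj).
- by move=> j f w S _; apply: golod_diff_min.
Qed.

Definition letter_count (j : nat) : nat :=
  if j is j'.+1 then #|[pred g | jd g == j']| else 1%N.

Lemma m_iota_eq r c c' : m (r - iota c) -> m (r - iota c') -> c = c'.
Proof.
move=> mc mc'; apply/eqP; rewrite -subr_eq0; apply/eqP/m_iota.
have -> : iota (c - c') = (r - iota c') - (r - iota c) by rewrite rmorphB; ring.
by apply: mD mc' _; apply: m_opp.
Qed.

Lemma golod_homology0 : koszul_homology_dim iota x 0 1.
Proof.
exists (fun=> kone R e) => [_|u [u0 _]].
  by split; [exact: kone_deg|exact: koszul_diff1].
have [c mc] := m_res (u set0 : R).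
have Eu (c' : {ffun 'I_1 -> k}) : u - \sum_(i < 1) iota (c' i) *: kone R e =
    ((u set0 : R) - iota (c' 0)) *: kone R e.
  by rewrite big_ord1 scalerBl -koszul_deg0E.
exists [ffun=> c]; split=> [|c' [g g1]].
  rewrite Eu ffunE; have [g g1 <-] := kone_boundary mc; by exists g.
rewrite Eu => /ffunP/(_ set0); rewrite koszul_diffE !ffunE eqxx => E.
apply/ffunP => i; rewrite ord1 ffunE; apply: (m_iota_eq mc).
rewrite -[_ - _]mulr1 [_ * 1]E; apply: (ideal_sum m0 mD) => s _.
by rewrite mulrC; apply: mM; apply: mM.
Qed.

Lemma golod_homology j : koszul_homology_dim iota x j (letter_count j).
Proof.
case: j => [|j]; first exact: golod_homology0.
pose A := [pred g | jd g == j].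
have dz g : d (gam [:: g]) = 0.
  rewrite gam_diff big1 ?oppr0 // => -[[|[|i]] Hi] _ //=.
    by rewrite gam0 kbar0 kmul0l.
  by rewrite gam0 kmul0r.
have zdeg g : koszul_deg (jd g).+1 (gam [:: g]).
  by have := @gam_deg [:: g]; rewrite /wt /= addn0.
have reidx (V : nmodType) (F : I -> V) :
    \sum_(i < #|A|) F (enum_val i) = \sum_(g | jd g == j) F g.
  by rewrite -(big_enum_val (A := A) F); apply: eq_bigl => g; rewrite inE.
exists (fun i : 'I_#|A| => gam [:: enum_val i]) => [i|u [uj du]].
  split; last exact: dz.
  by have := enum_valP i; rewrite inE => /eqP <-; apply: zdeg.
have [r [h [hj E]]] := gam_span uj du.
have /fin_all_exists[c cP] g : exists c, m (r g - iota c) by apply: m_res.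
have Ec (c' : {ffun 'I_#|A| -> k}) :
    u - \sum_(i < #|A|) iota (c' i) *: gam [:: enum_val i] =
    \sum_(i < #|A|) (r (enum_val i) - iota (c' i)) *: gam [:: enum_val i] + d h.
  rewrite E -(reidx _ (fun g => r g *: gam [:: g])) addrAC; congr (_ + _).
  by rewrite -sumrB; apply: eq_bigr => i _; rewrite scalerBl.
exists [ffun i => c (enum_val i)]; split=> [|c' [g gj]].
  rewrite Ec; suff [g gj ->] : exists2 g : K, koszul_deg j.+2 g &
      \sum_(i < #|A|) (r (enum_val i) - iota ([ffun i => c (enum_val i)] i)) *:
        gam [:: enum_val i] = d g.
    by exists (g + h); [exact: koszul_degD|rewrite koszul_diffD].
  elim/big_ind: _ => [|f f' [g gj ->] [g' gj' ->]|i _].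
  - by exists 0; [exact: koszul_deg0|rewrite koszul_diff0].
  - by exists (g + g'); [exact: koszul_degD|rewrite koszul_diffD].
  rewrite ffunE; have /eqP ij : jd (enum_val i) == j by have := enum_valP i; rewrite inE.
  have [g gj dg] := m_boundary (cP (enum_val i)) (zdeg (enum_val i)) (dz _).
  by exists g; rewrite -?ij.
(* Uniqueness: another choice c' gives a relation with coefficients r - iota c', which [gam_ind]
   forces into m. *)
rewrite Ec => Eg; apply/ffunP => i; rewrite ffunE.
apply: m_iota_eq (cP (enum_val i)) _.
have iA := enum_valP i.
pose r' g := r g - iota (c' (enum_rank_in iA g)).
have r'E i' : r' (enum_val i') = r (enum_val i') - iota (c' i').
  by rewrite /r' enum_valK_in.
rewrite -r'E; apply: (gam_ind (j := j) (h := g - h)).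
- by apply: koszul_degD => //; apply: koszul_degN.
- rewrite koszul_diffD koszul_diffN -Eg addrK -(reidx _ (fun g => r' g *: gam [:: g])).
  by apply: eq_bigr => i' _; rewrite r'E.
by apply/eqP; have := iA; rewrite inE.
Qed.

(** The denominator is 1 minus the sum of the z^(wtl g) over the letters, so this is
    [golod_rank_rec] with one term moved to the other side. *)
Lemma golod_series n :
  series_mul (fun i => (golod_rank i)%:Z) (golod_denom letter_count) n = 'C(e, n)%:Z.
Proof.
rewrite /series_mul big_ord_recr /= subnn mulr1.
have den (i : 'I_n) : golod_denom letter_count (n - i) =
    - (\sum_(g : I) (wtl g == (n - i)%N))%N%:Z.
  have : (0 < n - i)%N by rewrite subn_gt0.
  case: (n - i)%N => // -[|j] _ /=; first by rewrite big1.
  congr (- _%:Z); rewrite -sum1_card big_mkcond /=; apply: eq_bigr => g _.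
  by rewrite /wtl !eqSS inE; case: eqP.
under eq_bigr do rewrite den mulrN -PoszM big_distrr /=.
rewrite sumrN -(big_morph Posz PoszD (erefl _)) exchange_big /=.
have -> : (\sum_(g : I) \sum_(i < n) golod_rank i * (wtl g == (n - i)%N))%N =
    (\sum_(g | (wtl g <= n)%N) golod_rank (n - wtl g))%N.
  rewrite [RHS]big_mkcond; apply: eq_bigr => g _; case: ifP => gn.
    have lt : (n - wtl g < n)%N by move: gn; rewrite /wtl; lia.
    rewrite (bigD1 (Ordinal lt)) //= subKn // eqxx muln1 big1 ?addn0 // => i ni.
    case: eqP => [E|]; last by rewrite muln0.
    case/negP: ni; apply/eqP/val_inj => /=; rewrite E subKn //; exact: ltnW.
  rewrite big1 // => i _; case: eqP => [E|]; last by rewrite muln0.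
  by rewrite E leq_subr in gn.
rewrite (golod_rank_rec n) PoszD; ring.
Qed.

Hypothesis m_ind : forall c : 'I_e -> k,
  ideal_square m (\sum_i iota (c i) * x i) -> forall i, c i = 0.

Lemma golod_edim : edim iota m e.
Proof.
exists x => // u mu; have [s Es] := m_gen mu.
have /fin_all_exists[c cP] i : exists c, m (s i - iota c) by apply: m_res.
have Ec (c' : {ffun 'I_e -> k}) : (u : R^o) - \sum_(i < e) iota (c' i) *: (x i : R^o) =
   \sum_i x i * (s i - iota (c' i)) :> R.
  rewrite Es -sumrB; apply: eq_bigr => i _.
  by rewrite mulrBr; congr (_ - _); apply: mulrC.
have sqc : ideal_square m (\sum_i x i * (s i - iota ([ffun i => c i] i))).
  exists e, (fun=> 1), (fun i => x i * (s i - iota (c i))); split.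
    by move=> i; exists (x i), (s i - iota (c i)).
  by apply: eq_bigr => i _; rewrite mul1r ffunE.
exists [ffun i => c i]; split=> [|c' sc']; first by rewrite Ec.
rewrite Ec in sc'; apply/ffunP => i; apply/eqP; rewrite -subr_eq0; apply/eqP.
apply: (m_ind (c := fun i => [ffun i => c i] i - c' i)).
have := ideal_gen_lin (-1) sqc sc'.
rewrite mulN1r addrC -sumrB; congr (ideal_square m _).
by apply: eq_bigr => j _; rewrite rmorphB; ring.
Qed.

Lemma golod_of_trivial_massey : golod iota m.
Proof.
exists e, x, golod_rank, letter_count; split.
- exact: golod_edim.
- move=> r; split=> [/m_gen[s ->]|[n [a [g [gP ->]]]]].
    exists e, s, x; split=> [i|]; first by exists i.
    by apply: eq_bigr => i _; rewrite mulrC.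
  by apply: (ideal_sum m0 mD) => i _; have [j ->] := gP i; apply: mM.
- exact: golod_tor_dim.
- exact: golod_homology.
exact: golod_series.
Qed.

End GolodResolution.

Lemma choice_on (T U : Type) (P : T -> Prop) (Q : T -> U -> Prop) : U ->
  (forall t, P t -> exists u, Q t u) -> exists f, forall t, P t -> Q t (f t).
Proof.
move=> u0 H; apply: (choice (fun t u => P t -> Q t u)) => t.
by case: (classic (P t)) => [/H[u]|nP]; [exists u|exists u0].
Qed.

Section MaximalIndependent.

Variables (k : fieldType) (R : comNzRingType) (iota : {rmorphism k -> R}).
Variables (V : lmodType R) (W Q : V -> Prop).
Hypothesis W_lin : forall c u v, W u -> W v -> W (iota c *: u + v).

Definition independent_mod n (b : 'I_n -> V) : Prop :=
  forall c : 'I_n -> k, W (\sum_i iota (c i) *: b i) -> forall i, c i = 0.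

(** A family that does not yet span can be enlarged by a member of Q, and the bound N stops this.
    The point is that the resulting basis consists of elements of Q, later the good cycles. *)
Lemma maximal_independent N :
  (forall n (b : 'I_n -> V), (forall i, Q (b i)) -> independent_mod b -> (n <= N)%N) ->
  exists n (b : 'I_n -> V), [/\ forall i, Q (b i), independent_mod b &
    forall z, Q z -> exists c : 'I_n -> k, W (z - \sum_i iota (c i) *: b i)].
Proof.
move=> bound.
have H j : forall n (b : 'I_n -> V), (forall i, Q (b i)) -> independent_mod b ->
    (N < n + j)%N -> exists n (b : 'I_n -> V), [/\ forall i, Q (b i), independent_mod b &
    forall z, Q z -> exists c : 'I_n -> k, W (z - \sum_i iota (c i) *: b i)].
  elim: j => [|j IH] n b Qb ib; first by rewrite addn0 ltnNge (bound _ b).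
  move=> Nnj; case: (classic (forall z, Q z ->
      exists c : 'I_n -> k, W (z - \sum_i iota (c i) *: b i))) => [H|].
    by exists n, b.
  move=> /not_all_ex_not[z nH]; have [Qz nz] := imply_to_and _ _ nH.
  pose b' (i : 'I_n.+1) := if unlift ord0 i is Some j then b j else z.
  apply: (IH n.+1 b'); last by rewrite addSnnS.
    by move=> i; rewrite /b'; case: unliftP => [l _|_].
  move=> c; rewrite big_ord_recl {1}/b' unlift_none => Wc.
  have Wc' : W (iota (c ord0) *: z + \sum_i iota (c (lift ord0 i)) *: b i).
    by move: Wc; congr (W (_ + _)); apply: eq_bigr => i _; rewrite /b' liftK.
  have c0 : c ord0 = 0.
    apply/eqP/negP => /negP c0; apply: nz.
    exists (fun i => - (c ord0)^-1 * c (lift ord0 i)).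
    have W0 : W 0 by have := W_lin (-1) Wc Wc; rewrite rmorphN1 scaleN1r addNr.
    have := W_lin (c ord0)^-1 Wc' W0; rewrite addr0 scalerDr scalerA -rmorphM mulVf //.
    rewrite rmorph1 scale1r scaler_sumr -sumrN; congr (W (_ + _)).
    apply: eq_bigr => i _; rewrite mulNr rmorphN scaleNr opprK scalerA rmorphM.
    by [].
  have cl i : c (lift ord0 i) = 0.
    apply: (ib (fun i => c (lift ord0 i))); move: Wc'.
    by rewrite c0 rmorph0 scale0r add0r.
  by move=> i; case: (unliftP ord0 i) => [l ->|->].
apply: (H N.+1 0%N (fun i => 0)) => //; first by case.
by move=> c _ [].
Qed.

End MaximalIndependent.

(** * Trivial Massey operations *)

Section Massey.

Variables (R : comNzRingType) (e : nat) (x : 'I_e -> R).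
Local Notation K := (koszul R e).
Local Notation d := (koszul_diff x).
Variables (I : finType) (jd : I -> nat) (z : I -> K) (M : K -> Prop) (bound : K -> K).
Hypothesis M_add : forall f g, M f -> M g -> M (f + g).
Hypothesis M_0 : M 0.
Hypothesis M_opp : forall f, M f -> M (- f).
Hypothesis M_mull : forall f g, M f -> M (kmul f g).
Hypothesis M_mulr : forall f g, M g -> M (kmul f g).
Hypothesis M_bar : forall f, M f -> M (kbar f).
Hypothesis boundP : forall f, M f -> d f = 0 ->
  [/\ M (bound f), d (bound f) = f & forall i, koszul_deg i f -> koszul_deg i.+1 (bound f)].
Hypothesis z_deg : forall g, koszul_deg (jd g).+1 (z g).
Hypothesis z_cycle : forall g, d (z g) = 0.
Hypothesis z_mul : forall g g', M (kmul (kbar (z g)) (z g')).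

(** Prefixes and suffixes are not structural subterms, hence the fuel; the length of the word
    suffices. In the terms j = 0 and j = size p the whole word is evaluated with too little fuel,
    but the other factor is the value 0 at the empty word. *)
Fixpoint massey_fuel (n : nat) (p : seq I) : K :=
  if n is n'.+1 then
    match p with
    | [::] => 0
    | [:: g] => z g
    | _ => bound (- \sum_(j < (size p).+1)
             kmul (kbar (massey_fuel n' (take j p))) (massey_fuel n' (drop j p)))
    end
  else 0.

Definition massey (p : seq I) : K := massey_fuel (size p) p.

Definition massey_obstruction (p : seq I) : K :=
  - \sum_(j < (size p).+1) kmul (kbar (massey (take j p))) (massey (drop j p)).

Lemma massey_fuelS n p : (1 < size p)%N -> massey_fuel n.+1 p =
  bound (- \sum_(j < (size p).+1)
    kmul (kbar (massey_fuel n (take j p))) (massey_fuel n (drop j p))).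
Proof. by case: p => [|g [|g' p]]. Qed.

Lemma massey_fuel0 n : massey_fuel n [::] = 0.
Proof. by case: n. Qed.

Lemma massey_fuelE n p : (size p <= n)%N -> massey_fuel n p = massey p.
Proof.
elim/ltn_ind: n p => -[|n] IH p; first by rewrite leqn0 size_eq0 => /eqP->.
case: p => [|g [|g' p]] // sn.
rewrite /massey /=; congr (bound (- _)); apply: eq_bigr => -[j /= jp] _.
have [->|j0] := posnP j.
  by rewrite take0 !massey_fuel0 kbar0 !kmul0l.
have [jE|jlt] := eqVneq j (size p).+2.
  by rewrite drop_oversize ?jE // !massey_fuel0 !kmul0r.
have jl : (j < (size p).+2)%N by rewrite ltn_neqAle jlt -ltnS.
have st : (size (take j [:: g, g' & p]) <= (size p).+1)%N by rewrite size_takel // ltnW.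
have sd : (size (drop j [:: g, g' & p]) <= (size p).+1)%N.
  by rewrite size_drop /=; move: j0; lia.
have IHn q : (size q <= (size p).+1)%N -> massey_fuel n q = massey_fuel (size p).+1 q.
  move=> sq; rewrite !IH //; exact: leq_trans sq _.
by rewrite !IHn.
Qed.

Lemma massey_nil : massey [::] = 0.
Proof. by []. Qed.

Lemma masseyE p : (1 < size p)%N -> massey p = bound (massey_obstruction p).
Proof.
move=> p2; rewrite {1}/massey -(prednK (ltnW p2)) massey_fuelS //.
congr (bound (- _)); apply: eq_bigr => -[j /= jp] _.
have [->|j0] := posnP j.
  by rewrite take0 !massey_fuel0 massey_nil kbar0 !kmul0l.
have [jE|jlt] := eqVneq j (size p).
  by rewrite drop_oversize ?jE // !massey_fuel0 massey_nil !kmul0r.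
have jl : (j < size p)%N by rewrite ltn_neqAle jlt -ltnS.
rewrite !massey_fuelE //; first by rewrite size_drop; lia.
by rewrite size_takel; lia.
Qed.

(** A splitting of p into three pieces arises by cutting the prefix of one two-piece splitting or
    the suffix of another. The two contributions to the differential have opposite signs. *)
Lemma massey_obstruction_cycle p :
  (forall q, (size q < size p)%N -> d (massey q) = massey_obstruction q) ->
  d (massey_obstruction p) = 0.
Proof.
move=> IH; rewrite /massey_obstruction koszul_diffN koszul_diff_sum.
set n := size p.
pose T i j := kmul (massey (take i p))
  (kmul (kbar (massey (drop i (take j p)))) (massey (drop j p))).
(* At j = 0 and j = n, where the induction hypothesis does not apply, both sides vanish because of
   the empty factor. *)
have E (j : 'I_n.+1) : d (kmul (kbar (massey (take j p))) (massey (drop j p))) =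
    \sum_(i < n.+1 | (i <= j)%N) T i j - \sum_(l < n.+1 | (j <= l)%N) T j l.
  have [j0|j0] := posnP j.
    rewrite j0 take0 massey_nil kbar0 kmul0l koszul_diff0.
    have T0 l : T 0%N l = 0 by rewrite /T take0 massey_nil kmul0l.
    rewrite big1 => [|i]; last by rewrite leqn0 => /eqP->; apply: T0.
    by rewrite big1 ?subrr // => l _; apply: T0.
  have [jE|jlt] := eqVneq (j : nat) n.
    rewrite jE drop_oversize // massey_nil kmul0r koszul_diff0.
    have Tn l : T l n = 0 by rewrite /T (@drop_oversize _ n) // massey_nil !kmul0r.
    rewrite big1 => [|i _]; last exact: Tn.
    rewrite big1 ?subrr // => l nl.
    have -> : (l : nat) = n by apply/eqP; rewrite eqn_leq nl -ltnS ltn_ord.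
    exact: Tn.
  have jl : (j < n)%N by rewrite ltn_neqAle jlt -ltnS ltn_ord.
  rewrite koszul_diffM koszul_diff_bar kbarK kmulNl !IH; last 2 first.
  - by rewrite size_drop -/n; move: j0; lia.
  - by rewrite size_takel // ltnW.
  rewrite /massey_obstruction kbarN kmulNl opprK kbar_sum kmul_suml kmulNr kmul_sumr.
  congr (_ - _).
    rewrite size_takel; last exact: ltnW.
    rewrite (big_ord_widen_cond n.+1 xpredT (fun i => kmul (kbar (kmul
      (kbar (massey (take i (take j p)))) (massey (drop i (take j p))))) (massey (drop j p)))) //.
    apply: eq_bigr => i; rewrite ltnS => ij; rewrite kbarM kbarK -kmulA /T take_takel //.
  rewrite size_drop -/n -(big_mkord xpredT (fun l => kmul (massey (take j p)) (kmul
     (kbar (massey (take l (drop j p)))) (massey (drop l (drop j p)))))).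
  have -> : \sum_(l < n.+1 | (j <= l)%N) T j l = \sum_(j <= l < n.+1) T j l.
    by rewrite big_geq_mkord.
  rewrite -[X in _ = \sum_(X <= l < _) _]add0n [RHS]big_addn subSn ?(ltnW jl) //.
  apply: eq_big_nat => l _; rewrite /T take_drop drop_drop.
  by [].
under eq_bigr do rewrite E.
rewrite sumrB [X in X - _](exchange_big_dep xpredT) //=.
by rewrite subrr oppr0.
Qed.

(** Products of two values lie in the ideal M: for two letters by [z_mul], otherwise because a
    factor of length at least 2 is already in M. So the obstruction is a cycle of M and bounds
    inside M. *)
Lemma masseyP p :
  [/\ (1 < size p)%N -> M (massey p), d (massey p) = massey_obstruction p &
      koszul_deg (word_weight jd p).-1 (massey p)].
Proof.
have [n] := ubnP (size p); elim: n p => // n IH p; rewrite ltnS => pn.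
have [p1|p2] := leqP (size p) 1.
  case: p p1 pn => [|g [|g' p]] // _ _; split => //.
  - rewrite massey_nil koszul_diff0 /massey_obstruction big1 ?oppr0 // => j _.
    by rewrite massey_nil kmul0r.
  - exact: koszul_deg0.
  - rewrite z_cycle /massey_obstruction big1 ?oppr0 // => -[[|[|j]] jp] _ //=.
      by rewrite massey_nil kbar0 kmul0l.
    by rewrite massey_nil kmul0r.
  by rewrite /word_weight /= addn0; apply: z_deg.
have IHd q : (size q < size p)%N -> d (massey q) = massey_obstruction q.
  by move=> qp; case: (IH q) => //; apply: leq_trans qp pn.
have term (P : K -> Prop) (j : 'I_(size p).+1) : P 0 ->
   (forall q r, q ++ r = p -> (0 < size q < size p)%N -> (0 < size r < size p)%N ->
    P (kmul (kbar (massey q)) (massey r))) ->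
   P (kmul (kbar (massey (take j p))) (massey (drop j p))).
  move=> P0 H; have [j0|j0] := posnP j.
    by rewrite j0 take0 massey_nil kbar0 kmul0l.
  have [jE|jlt] := eqVneq (j : nat) (size p).
    by rewrite jE drop_oversize // massey_nil kmul0r.
  have jl : (j < size p)%N by rewrite ltn_neqAle jlt -ltnS ltn_ord.
  apply: H; first exact: cat_take_drop.
    by rewrite size_takel ?j0 // ltnW.
  by rewrite size_drop subn_gt0 jl /= -subn_gt0 subKn // ltnW.
have Mobs : M (massey_obstruction p).
  apply: M_opp; elim/big_ind: _ => // j _; apply: term => // q r qr /andP[q0 qp] /andP[r0 rp].
  have [q1|q2] := leqP (size q) 1; last first.
    by apply: M_mull; apply: M_bar; case: (IH q) => [|/(_ q2)//]; apply: leq_trans qp pn.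
  have [r1|r2] := leqP (size r) 1; last first.
    by apply: M_mulr; case: (IH r) => [|/(_ r2)//]; apply: leq_trans rp pn.
  case: q r q0 r0 q1 r1 {qr qp rp} => [|g [|? ?]] // [|g' [|? ?]] // _ _ _ _.
  exact: z_mul.
have dobs := massey_obstruction_cycle IHd.
have [Mb db degb] := boundP Mobs dobs.
rewrite masseyE //; split => //.
have -> : (word_weight jd p).-1 = (word_weight jd p - 2).+1.
  by have := leq_trans p2 (size_le_word_weight jd p); move: (word_weight jd p) => a; lia.
apply: degb; apply: koszul_degN; apply: koszul_deg_sum => j _.
apply: (term (koszul_deg (word_weight jd p - 2))); first exact: koszul_deg0.
move=> q r qr /andP[q0 qp] /andP[r0 rp].
have -> : (word_weight jd p - 2 = (word_weight jd q).-1 + (word_weight jd r).-1)%N.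
  rewrite -qr word_weight_cat.
  have := size_le_word_weight jd q; have := size_le_word_weight jd r; move: q0 r0.
  move: (word_weight jd q) (word_weight jd r) => a b; lia.
apply: kmul_deg; first apply: koszul_deg_bar.
  by case: (IH q) => //; apply: leq_trans qp pn.
by case: (IH r) => //; apply: leq_trans rp pn.
Qed.

End Massey.

(** * Golod Stanley-Reisner rings *)

Section GolodStanleyReisner.

Variables (k : fieldType) (R : comNzRingType) (iota : {rmorphism k -> R}).
Variables (e : nat) (x : 'I_e -> R) (C : pred {set 'I_e}).
Variable co : 'X_{1..e} -> R -> k.
Hypothesis SR : stanley_reisner iota x C co.

Local Notation K := (koszul R e).
Local Notation Kk := (koszul k e).
Local Notation d := (koszul_diff x).
Local Notation dk := (koszul_diff (fun=> 1 : k)).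
Local Notation kmono := (kmono iota x).
Local Notation kcomp := (kcomp co).
Implicit Types (A B S T : {set 'I_e}) (u al : 'X_{1..e}) (r : R) (c : Kk).

Variable m : R -> Prop.
Hypothesis mE : forall r, m r <-> co 0%MM r = 0.

Lemma sr_m0 : m 0.
Proof. by rewrite mE (co0 SR). Qed.

Lemma sr_mD r s : m r -> m s -> m (r + s).
Proof. by rewrite !mE (sr_coD SR) => -> ->; rewrite addr0. Qed.

Lemma sr_mM r s : m s -> m (r * s).
Proof. by rewrite !mE => s0; apply: (co0M SR). Qed.

Lemma sr_m_res r : exists c : k, m (r - iota c).
Proof.
by exists (co 0%MM r); rewrite mE (coB SR) (co0_iota SR) subrr.
Qed.

Lemma sr_m_iota (c : k) : m (iota c) -> c = 0.
Proof. by rewrite mE (co0_iota SR). Qed.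

Lemma sr_m_x i : m (x i).
Proof. by rewrite mE -[x i]mulr1 (co0X SR). Qed.

Lemma sr_m_gen r : m r -> exists s : 'I_e -> R, r = \sum_i x i * s i.
Proof. by rewrite mE; apply: (max_ideal_gen SR). Qed.

Lemma sr_m_ind (c : 'I_e -> k) : ideal_square m (\sum_i iota (c i) * x i) -> forall i, c i = 0.
Proof.
move=> [n [a [g [gP E]]]] i.
have := congr1 (co U_(i)%MM) E.
rewrite !(co_sum SR) (bigD1 i) //= [X in _ + X]big1 ?addr0; last first.
  move=> j ji; rewrite (sr_coZ SR) -[x j]mulr1 (sr_coX SR) ?(nonface1 SR) //.
  by rewrite mnm1E eq_sym (negbTE ji) mulr0.
rewrite (sr_coZ SR) -[x i]mulr1 (sr_coX SR) ?(nonface1 SR) // mnm1E eqxx /=.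
have -> : (U_(i) - U_(i))%MM = 0%MM :> 'X_{1..e}.
  by apply/mnmP => j; rewrite mnmBE subnn mnm0E.
rewrite (sr_co1 SR) eqxx mulr1 => ->; apply: big1 => j _.
have [y [z [my mz ->]]] := gP j; have [t ->] := sr_m_gen mz.
rewrite !mulr_sumr (co_sum SR) big1 // => l _.
have -> : a j * (y * (x l * t l)) = x l * (a j * t l * y) by ring.
rewrite (sr_coX SR) ?(nonface1 SR) // mnm1E; case: eqP => [<-|//].
have -> : (U_(i) - U_(i))%MM = 0%MM :> 'X_{1..e}.
  by apply/mnmP => q; rewrite mnmBE subnn mnm0E.
by apply: (co0M SR); apply/mE.
Qed.

Lemma inface_mset A S : inface C (mset A) S = (S \subset A) && ~~ C (A :\: S).
Proof. by rewrite /inface mset_le support_mset /nonface support_msetB. Qed.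

(** For v in A the set A :\ v indexes a basis element, as {v} is not in C, and there dk c equals c A
    up to sign. Cycles in such a degree thus have entries in the maximal ideal. *)
Lemma kmono_top A c : subdeg (mset A) c -> (forall S, inface C (mset A) S -> dk c S = 0) ->
  C A -> c A = 0.
Proof.
move=> cA dc CA.
have [A0|[v vA]] := set_0Vmem A; first by rewrite A0 (negbTE (sr_set0 SR)) in CA.
have /dc : inface C (mset A) (A :\ v).
  rewrite inface_mset subD1set (_ : A :\: (A :\ v) = [set v]) ?(sr_set1 SR) //.
  by apply/setP => i; rewrite !inE; case: eqP => [->|] /=; rewrite ?vA ?andNb.
rewrite koszul_diffE (bigD1 v) ?setD11 //= setD1K // mulr1 [X in _ + X]big1.
  by rewrite addr0 => /eqP; rewrite mulf_eq0 signr_eq0 => /eqP.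
move=> s /andP[sA sv]; rewrite cA ?mulr0 //.
rewrite mset_le support_mset; apply/negP => /subsetP/(_ s).
by rewrite !inE eqxx /= => /(_ isT) sA'; rewrite !inE sv sA' in sA.
Qed.

Variable rho : {set 'I_e} -> {set 'I_e}.

Definition minimal_cover A : Prop := C A /\ forall v, v \in A -> ~~ C (A :\ v).

(** For a graph, the other end of an edge at v would lie both in A :\ v and in B. So v is isolated,
    and the component of degree A is a cone with apex v. *)
Hypothesis C_free : forall A B v, [disjoint A & B] -> C A -> C B ->
  v \in A -> C (A :\ v) -> forall S, C (S :\ v) = C S.
(* For disjoint minimal covers A and B this makes the product of x^(A - a) e_a
   and x^(B - b) e_b vanish. *)
Hypothesis rhoP : forall A B, [disjoint A & B] -> minimal_cover A -> minimal_cover B ->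
  (exists2 a, a \in A & rho A = [set a]) /\ C ((A :\: rho A) :|: (B :\: rho B)).

(* The homogeneous cycle representatives allowed in the basis of the Koszul
   homology: in a degree having a disjoint cover only x^(A - a) e_a, {a} = rho A. *)
Definition good_cycle j (f : K) : Prop :=
  [/\ koszul_deg j.+1 f, d f = 0 & exists A c,
    [/\ f = kmono (mset A) c, subdeg (mset A) c, C A &
     forall B, [disjoint A & B] -> C B ->
       minimal_cover A /\ c = kbasis k (rho A)]].

Lemma minimal_cover_exists B : C B -> exists2 B' : {set 'I_e}, B' \subset B & minimal_cover B'.
Proof.
have [n] := ubnP #|B|; elim: n B => // n IH B; rewrite ltnS => Bn CB.
case: (boolP [exists v in B, C (B :\ v)]) => [/exists_inP[v vB CBv]|].
  have [|B' B'B mB'] := IH (B :\ v) _ CBv.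
    by apply: leq_trans Bn; rewrite [in X in (_ < X)%N](cardsD1 v) vB.
  by exists B' => //; apply: subset_trans B'B (subD1set _ _).
rewrite negb_exists_in => /forall_inP H; by exists B.
Qed.

Lemma rho_in A B : [disjoint A & B] -> minimal_cover A -> C B ->
  exists2 a, a \in A & rho A = [set a].
Proof.
move=> dAB mA CB; have [B' B'B mB'] := minimal_cover_exists CB.
by have [] := rhoP (disjointWr B'B dAB) mA mB'.
Qed.

Lemma mset_add_squarefree A B : squarefree (mset A + mset B)%MM -> [disjoint A & B].
Proof.
move=> /forallP sAB; rewrite -setI_eq0; apply/eqP/setP => i; rewrite !inE.
by have := sAB i; rewrite mnmDE !msetE; case: (i \in A); case: (i \in B).
Qed.

(** If A and B meet, the product has a degree that is not squarefree. If they are disjoint, both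
    cycles have the special form and the monomial of their product vanishes by [rhoP]. *)
Lemma good_cycle_mul j j' f f' : good_cycle j f -> good_cycle j' f' ->
  nonsquarefree_part co (kmul (kbar f) f').
Proof.
move=> [fj _ [A [c [Ef cA CA spA]]]] [_ _ [B [c' [Ef' cB CB spB]]]].
rewrite (kbar_deg fj) kmulZl; set g := kmul f f'.
suff Mg : nonsquarefree_part co g by move=> S u su; rewrite ffunE (coZs SR) Mg // mulr0.
rewrite /g; case: (boolP (squarefree (mset A + mset B)%MM)) => [sAB|nsAB]; last first.
  by rewrite Ef Ef'; apply: (nsqf_kmono_mul SR).
have dAB := mset_add_squarefree sAB.
have [mA Ec] := spA _ dAB CB.
have [mB Ec'] : minimal_cover B /\ c' = kbasis k (rho B).
  by apply: spB CA; rewrite disjoint_sym.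
have [_ CAB] := rhoP dAB mA mB.
suff -> : kmul f f' = 0 by apply: (nsqf0 SR).
apply/ffunP => T; rewrite !ffunE big1 // => X XT.
suff -> : (f X : R) * (f' (T :\: X) : R) = 0 by rewrite mulr0.
rewrite Ef Ef' !ffunE; case: ifP => XA; last by rewrite mul0r.
case: ifP => YB; last by rewrite mulr0.
rewrite Ec Ec' !ffunE; case: eqP => [EX|]; last by rewrite rmorph0 !mul0r.
case: eqP => [EY|]; last by rewrite rmorph0 mul0r mulr0.
rewrite !rmorph1 !mul1r -xmonD (xmon_nonface SR) // /nonface.
rewrite EY EX; congr (is_true (C _)): CAB; apply/setP => i.
rewrite !inE mnmDE !mnmBE !msetE.
by case: (i \in rho A); case: (i \in rho B); case: (i \in A); case: (i \in B).
Qed.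

Definition kbound j (f : K) : Prop := exists2 g : K, koszul_deg j.+1 g & f = d g.

Lemma kbound_lin j a f g : kbound j f -> kbound j g -> kbound j ((a : R) *: f + g).
Proof.
move=> [f' f'j ->] [g' g'j ->]; exists (a *: f' + g').
  by apply: koszul_degD => //; apply: koszul_degZ.
by rewrite koszul_diffD koszul_diffZ.
Qed.

Lemma kboundD j f g : kbound j f -> kbound j g -> kbound j (f + g).
Proof. by move=> bf bg; rewrite -[f]scale1r; apply: kbound_lin. Qed.

Lemma kbound0 j : kbound j 0.
Proof. by exists 0; [exact: koszul_deg0|rewrite koszul_diff0]. Qed.

Lemma kboundB j f g : kbound j f -> kbound j g -> kbound j (f - g).
Proof. by move=> bf bg; rewrite addrC -scaleN1r; apply: kbound_lin. Qed.

Lemma nonsquarefree_bound j al f : ~~ squarefree al -> koszul_deg j.+1 f -> d f = 0 ->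
  kbound j.+1 (kmono al (kcomp al f)).
Proof.
move=> nal fj df; have dc S : inface C al S -> dk (kcomp al f) S = 0 by apply: (kcomp_cycle SR).
have [||g [_ dg gd]] := @nsqf_boundary _ _ _ _ _ _ _ SR (kmono al (kcomp al f)).
- exact: (nsqf_kmono SR).
- by rewrite kdiff_mono ?(kmono_eq0 SR) //; apply: kcomp_subdeg.
by exists g; rewrite ?dg //; apply/gd/kmono_deg/(kcomp_deg SR).
Qed.

Lemma cone_bound j A v c : v \in A -> subdeg (mset A) c -> koszul_deg j.+1 c ->
  (forall S, v \in S -> inface C (mset A) S -> inface C (mset A) (S :\ v)) ->
  (forall S, inface C (mset A) S -> dk c S = 0) -> kbound j.+1 (kmono (mset A) c).
Proof.
move=> vA cA cj cone dc; exists (kmono (mset A) (wedge v c)); first exact/kmono_deg/wedge_deg.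
by rewrite (kmono_cone_boundary SR (v := v)) ?msetE ?vA.
Qed.

Lemma empty_degree_bound j c : koszul_deg j.+1 c -> kbound j.+1 (kmono (mset set0) c).
Proof.
move=> cj; rewrite (_ : kmono _ c = 0); first exact: kbound0.
apply/ffunP => S; rewrite !ffunE mset_le support_mset subset0; case: eqP => // ->.
by rewrite cj ?rmorph0 ?mul0r // cards0.
Qed.

Lemma inface_sub A S v : ~~ C (A :\ v) -> v \in S -> S \subset A -> inface C (mset A) S.
Proof.
move=> nC vS SA; rewrite inface_mset SA; apply: contra nC; apply: (sr_up SR).
by apply: setDS; rewrite sub1set.
Qed.

(** Only covers carry homology. A cover without disjoint cover puts no condition on the cycle; a
    nonminimal one with a disjoint cover gives a cone by [C_free]. For a minimal one the basis is
    indexed by the nonempty subsets of A: this is the unaugmented chain complex of a simplex, with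
    the class of the vertex a as its only class. *)
Lemma good_cycle_span j A c : subdeg (mset A) c -> koszul_deg j.+1 c ->
  (forall S, inface C (mset A) S -> dk c S = 0) ->
  exists a f, (kbound j.+1 f \/ good_cycle j f) /\ kbound j.+1 (kmono (mset A) c - iota a *: f).
Proof.
move=> cA cj dc.
have bnd v : v \in A -> (forall S, v \in S -> inface C (mset A) S -> inface C (mset A) (S :\ v)) ->
    exists a f, (kbound j.+1 f \/ good_cycle j f) /\
      kbound j.+1 (kmono (mset A) c - iota a *: f).
  move=> vA cone; exists 0, 0; split; first by left; apply: kbound0.
  by rewrite rmorph0 scale0r subr0; apply: (cone_bound vA).
case: (boolP (C A)) => CA; last first.
  have [A0|[v vA]] := set_0Vmem A.
    exists 0, 0; split; first by left; apply: kbound0.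
    by rewrite rmorph0 scale0r subr0 A0; apply: empty_degree_bound.
  apply: (bnd v vA) => S vS; rewrite !inface_mset => /andP[SA _].
  rewrite (subset_trans (subD1set _ _) SA) /=.
  by apply: contra CA; apply: (sr_up SR); apply: subsetDl.
case: (classic (exists2 B : {set 'I_e}, [disjoint A & B] & C B)) => [[B dAB CB]|nB]; last first.
  exists 1, (kmono (mset A) c); rewrite rmorph1 scale1r subrr; split; last exact: kbound0.
  right; split.
  - exact: kmono_deg.
  - by rewrite kdiff_mono //; apply: (kmono_eq0 SR).
  exists A, c; split => // B dAB CB; case: nB; by exists B.
case: (boolP [exists v in A, C (A :\ v)]) => [/exists_inP[v vA CAv]|].
  apply: (bnd v vA) => S vS; rewrite !inface_mset => /andP[SA nC].
  rewrite (subset_trans (subD1set _ _) SA) /=.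
  apply: contra nC; rewrite -(C_free dAB CA CB vA CAv (A :\: (S :\ v))).
  apply: (sr_up SR); apply/subsetP => i; rewrite !inE.
  by case: eqP => //= _ /andP[-> ->].
rewrite negb_exists_in => /forall_inP mA'.
have mA : minimal_cover A by [].
have [a aA rhoA] := rho_in dAB mA CB.
pose b := kbasis k [set a].
have bE S : b S = ((S == [set a])%:R : k) by rewrite ffunE.
have bA : subdeg (mset A) b.
  move=> S; rewrite mset_le support_mset => nS; rewrite bE.
  by case: (S =P [set a]) nS => // ->; rewrite sub1set aA.
(* The empty set does not index a basis element, so dk c need not vanish there; its value is all
   that the homotopy leaves over, at S = {a}. *)
have Ew : kmono (mset A) (wedge a (dk c)) = iota (dk c set0) *: kmono (mset A) b.
  rewrite -kmonoZ; apply: (kmono_eq SR) => S iS; rewrite wedgeE [RHS]ffunE bE.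
  case: (boolP (a \in S)) => aS; last first.
    case: eqP => [ES|]; last by rewrite scaler0.
    by rewrite ES inE eqxx in aS.
  have [S0|[s]] := set_0Vmem (S :\ a).
    have -> : S = [set a] by rewrite -(setD1K aS) S0 setU0.
    by rewrite eqxx setDv nbelow0 expr0 mul1r [RHS]mulr1.
  move=> sS; rewrite dc ?mulr0; last first.
    have SA : S \subset A by move: iS; rewrite inface_mset => /andP[].
    apply: (inface_sub (v := s)) => //.
      by apply: mA'; apply: (subsetP SA); move: sS; rewrite !inE => /andP[].
    exact: subset_trans (subD1set _ _) SA.
  by case: eqP => [ES|]; rewrite ?scaler0 //; move: sS; rewrite ES setDv inE.
have hE : kbound j.+1 (kmono (mset A) c - iota (dk c set0) *: kmono (mset A) b).
  rewrite (kmono_homotopy iota x (v := a) (al := mset A) (c := c)) ?msetE ?aA //.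
  rewrite Ew addrK; exists (kmono (mset A) (wedge a c)) => //.
  exact/kmono_deg/wedge_deg.
(* In higher degrees c has no term at a singleton, so this value is 0 and the cycle bounds. *)
case: j cj bnd hE => [|j] cj bnd hE; last first.
  exists 0, 0; split; first by left; apply: kbound0.
  rewrite rmorph0 scale0r subr0; move: hE.
  rewrite koszul_diffE big1 ?rmorph0 ?scale0r ?subr0 // => s _.
  by rewrite cj ?mulr0 // setU0 cards1.
exists (dk c set0), (kmono (mset A) b); split => //; right; split.
- by apply: kmono_deg; rewrite -[X in koszul_deg X](cards1 a); apply: kbasis_deg.
- rewrite kdiff_mono // (kmono_eq0 SR) // => S iS.
  rewrite koszul_diffE big1 // => s sS; rewrite bE; case: eqP => [ES|]; last by rewrite mulr0.
  have S0 : S = set0.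
    apply/setP => t; rewrite inE; apply/negP => tS.
    have : t \in s |: S by rewrite inE tS orbT.
    rewrite ES inE => /eqP ta; have : s \in s |: S by rewrite setU11.
    by rewrite ES inE => /eqP sa; rewrite sa -ta tS in sS.
  by move: iS; rewrite S0 inface_mset setD0 CA andbF.
by exists A, b; split => // B' _ _; rewrite rhoA.
Qed.

(** Good cycles live in squarefree multidegrees and are determined by their coefficients at the
    pairs (A, S). More cycles than pairs would satisfy a linear relation. *)
Lemma good_cycle_bound j n (b : 'I_n -> K) :
  (forall i, good_cycle j (b i)) -> independent_mod iota (kbound j.+1) b ->
  (n <= #|{: {set 'I_e} * {set 'I_e}}|)%N.
Proof.
move=> Qb ib; rewrite leqNgt; apply/negP => Nn.
pose X := \matrix_(i < n, p < #|{: {set 'I_e} * {set 'I_e}}|)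
  (kcomp (mset (enum_val p).1) (b i) (enum_val p).2 : k).
have : kermx X != 0.
  rewrite -mxrank_eq0 mxrank_ker subn_eq0 -ltnNge.
  exact: leq_ltn_trans (rank_leq_col X) Nn.
move=> /rowV0Pn[v /sub_kermxP vX v0]; case/negP: v0; apply/eqP/rowP => i; rewrite mxE.
apply: (ib (fun i => v 0 i)).
suff -> : \sum_i iota (v 0 i) *: b i = 0 by apply: kbound0.
apply/ffunP => S; apply: (co_eq SR) => u; rewrite sum_ffunE [in RHS]ffunE (co0 SR) (co_sum SR).
under eq_bigr do rewrite ffunE (sr_coZ SR).
case: (boolP (squarefree (u + mset S)%MM)) => su.
  have := congr1 (fun Y : 'rV[k]__ => Y 0 (enum_rank (mnm_support (u + mset S)%MM, S))) vX.
  rewrite !mxE => {2}<-; apply: eq_bigr => l _; rewrite mxE enum_rankK /= ffunE.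
  by rewrite -squarefree_mset // lem_addl addmK.
rewrite big1 // => l _; case: (Qb l) => _ _ [A [c [-> _ _ _]]].
rewrite (co_kmono SR); case: (boolP (inface C (mset A) S)) => [/andP[SA _]|] /=; last by rewrite mulr0.
case: eqP => [E|]; last by rewrite mulr0.
by rewrite E submK // mset_squarefree in su.
Qed.

(** A maximal independent family of good cycles spans all cycles: each multigraded component of a
    cycle bounds if its degree is not squarefree, and is covered by [good_cycle_span] otherwise. *)
Lemma good_cycle_basis j : exists n (b : 'I_n -> K),
  [/\ forall i, good_cycle j (b i), independent_mod iota (kbound j.+1) b &
   forall f, koszul_deg j.+1 f -> d f = 0 ->
     exists c : 'I_n -> k, kbound j.+1 (f - \sum_i iota (c i) *: b i)].
Proof.
have [n [b [Qb ib sb]]] := maximal_independent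
  (fun (a : k) f g => @kbound_lin j.+1 (iota a) f g) (@good_cycle_bound j).
exists n, b; split=> // f fj df.
pose insp (t : K) := exists c : 'I_n -> k, kbound j.+1 (t - \sum_i iota (c i) *: b i).
have insp_bd t : kbound j.+1 t -> insp t.
  move=> bt; exists (fun=> 0); rewrite big1 ?subr0 // => i _.
  by rewrite rmorph0 scale0r.
have insp_lin a t t' : insp t -> insp t' -> insp (iota a *: t + t').
  move=> [c ct] [c' ct']; exists (fun i => a * c i + c' i).
  have -> : iota a *: t + t' - \sum_i iota (a * c i + c' i) *: b i =
      iota a *: (t - \sum_i iota (c i) *: b i) + (t' - \sum_i iota (c' i) *: b i).
    rewrite scalerBr addrACA -opprD scaler_sumr -big_split; congr (_ - _).
    by apply: eq_bigr => i _; rewrite rmorphD rmorphM scalerDl scalerA.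
  exact: kbound_lin.
have inspD t t' : insp t -> insp t' -> insp (t + t').
  by move=> it it'; rewrite -[t]scale1r -(rmorph1 iota); apply: insp_lin.
rewrite -/(insp f); have [l _ ->] := koszul_decomposition SR f.
elim/big_ind: _ => [||al _]; [by apply/insp_bd/kbound0|exact: inspD|].
have cyc S : inface C al S -> dk (kcomp al f) S = 0 by apply: (kcomp_cycle SR).
case: (boolP (squarefree al)) => sal; last first.
  by apply/insp_bd/nonsquarefree_bound.
move: cyc; rewrite (squarefree_mset sal) => cyc.
have [|a [g [bg gE]]] := good_cycle_span (kcomp_subdeg _ _) (j := j) _ cyc.
  exact: (kcomp_deg SR).
have ig : insp g by case: bg => [/insp_bd//|/sb].
rewrite -[kmono _ _](subrK (iota a *: g)) addrC.
by apply: insp_lin => //; apply: insp_bd.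
Qed.

Theorem golod_stanley_reisner : golod iota m.
Proof.
have sE : forall j : 'I_e, exists s : {n & 'I_n -> K},
    [/\ forall i, good_cycle j (projT2 s i), independent_mod iota (kbound j.+1) (projT2 s) &
   forall f, koszul_deg j.+1 f -> d f = 0 ->
     exists c : 'I_(projT1 s) -> k, kbound j.+1 (f - \sum_i iota (c i) *: projT2 s i)].
  by move=> j; have [n [b H]] := good_cycle_basis j; exists (existT _ n b).
have [s sP] := fin_all_exists sE.
(* A letter with tag j is a class of degree j.+1. There are no Koszul chains above degree e, so the
   tags range over ['I_e] and the alphabet is finite. *)
pose I := {j : 'I_e & 'I_(projT1 (s j))}.
pose jd (g : I) : nat := tag g.
pose z (g : I) : K := projT2 (s (tag g)) (tagged g).
have zgood g : good_cycle (jd g) (z g) by have [Qb _ _] := sP (tag g); apply: Qb.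
have sumI (W : nmodType) (j : 'I_e) (F : I -> W) :
    \sum_(g | jd g == j) F g = \sum_(i < projT1 (s j)) F (Tagged (fun j => 'I_(projT1 (s j))) i).
  rewrite -(big_pred1_eq +%R j (fun j => \sum_(i < projT1 (s j)) F (Tagged (fun j => 'I_(projT1 (s j))) i))).
  rewrite (sig_big_dep _ (fun=> xpredT)) /=.
  by apply: eq_big => [[l i]|[l i] _] //=; rewrite andbT.
have /(choice_on (0 : K))[bound bP] f : nonsquarefree_part co f /\ d f = 0 -> exists g,
    [/\ nonsquarefree_part co g, d g = f & forall i, koszul_deg i f -> koszul_deg i.+1 g].
  by case=> Mf df; exact: (nsqf_boundary SR Mf df).
have boundP f Mf df := bP f (conj Mf df).
have zdeg g : koszul_deg (jd g).+1 (z g) by case: (zgood g).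
have zcyc g : d (z g) = 0 by case: (zgood g).
have zmul g g' : nonsquarefree_part co (kmul (kbar (z g)) (z g')).
  exact: good_cycle_mul (zgood g) (zgood g').
have masP := masseyP (nsqfD SR) (nsqf0 SR) (@nsqfN _ _ _ _ _ _ _ SR) (@nsqf_mull _ _ _ _ _ _ _ SR)
  (@nsqf_mulr _ _ _ _ _ _ _ SR) (@nsqf_bar _ _ _ _ _ _ _ SR) boundP zdeg zcyc zmul.
pose gam := massey z bound.
have gam1 g : gam [:: g] = z g by [].
apply: (@golod_of_trivial_massey _ _ _ _ sr_m0 sr_mD sr_mM sr_m_res sr_m_iota _ _
  sr_m_x sr_m_gen I jd gam).
- by [].
- by move=> p; case: (masP p).
- by move=> p; case: (masP p).
(* Entries in m: for longer words by [nsqf_max], for a letter because its cycle of degree A has no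
   term e_A. *)
- move=> p S; apply/mE; have [p1|p2] := leqP (size p) 1; last first.
    by apply: (nsqf_max S); case: (masP p) => /(_ p2).
  case: p p1 => [|g [|g' p]] // _; first by rewrite ffunE (co0 SR).
  rewrite gam1; case: (zgood g) => _ dz [A [c [zE cA CA _]]].
  rewrite zE (co_kmono SR); case: (boolP (inface C (mset A) S)) => //= iS.
  case: eqP => // E.
  have SA : S = A.
    apply/mset_inj/mnmP => i; have /mnmP/(_ i) := E; rewrite mnm0E mnmBE.
    by move: iS; rewrite /inface => /andP[/mnm_lepP/(_ i)]; lia.
  rewrite SA; apply: kmono_top => // T iT.
  have := congr1 (fun f => kcomp (mset A) f T) dz; rewrite zE kdiff_mono //.
  by rewrite (kmonoK SR) // (kcomp0 SR) [X in _ = X -> _]ffunE.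
- move=> j f fj df; have [je|ej] := ltnP j e; last first.
    exists (fun=> 0), 0; split; first exact: koszul_deg0.
    rewrite koszul_diff0 addr0 big1 => [|g _]; last by rewrite scale0r.
    apply/ffunP => S; rewrite ffunE fj //; apply/negP => /eqP SE.
    by have := max_card (mem S); rewrite card_ord SE ltnNge ej.
  have cc (l : 'I_e) : {c : 'I_(projT1 (s l)) -> k | l = Ordinal je ->
      kbound j.+1 (f - \sum_i iota (c i) *: projT2 (s l) i)}.
    apply: constructive_indefinite_description; case: (eqVneq l (Ordinal je)) => [El|nl].
      have [_ _ sp] := sP l; have [c cP] : exists c : 'I_(projT1 (s l)) -> k,
          kbound l.+1 (f - \sum_i iota (c i) *: projT2 (s l) i) by apply: sp; rewrite // El.
      by exists c => _; move: cP; have -> : nat_of_ord l = j by rewrite El.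
    by exists (fun=> 0) => El; rewrite El eqxx in nl.
  have [h hj hE] := svalP (cc (Ordinal je)) (erefl _).
  exists (fun g : I => iota (sval (cc (tag g)) (tagged g))), h; split=> //.
  rewrite -hE -[LHS](subrK (\sum_i iota (sval (cc (Ordinal je)) i) *: projT2 (s (Ordinal je)) i)).
  rewrite addrC; congr (_ + _).
  by rewrite (sumI _ (Ordinal je) (fun g : I => iota (sval (cc (tag g)) (tagged g)) *: gam [:: g])).
(* Replacing each coefficient by its residue in k changes the sum by a boundary, which reduces the
   claim to independence over k. *)
- move=> j r h hj E g gj.
  have [c cP] : exists c : I -> k, forall g, m (r g - iota (c g)).
    by have /fin_all_exists := fun g => sr_m_res (r g).
  rewrite -[r g](subrK (iota (c g))); apply: sr_mD => //.
  suff -> : c g = 0 by rewrite rmorph0; apply: sr_m0.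
  case: g gj => l i /= gj; have [_ il _] := sP l.
  apply: (il (fun i => c (Tagged (fun j => 'I_(projT1 (s j))) i))).
  rewrite /jd /= in gj; rewrite gj.
  have -> : \sum_i iota (c (Tagged (fun j => 'I_(projT1 (s j))) i)) *: projT2 (s l) i =
      \sum_(g | jd g == j) r g *: gam [:: g] -
      \sum_(g | jd g == j) (r g - iota (c g)) *: gam [:: g].
    rewrite -sumrB -gj sumI; apply: eq_bigr => i' _.
    by rewrite scalerBl subKr.
  apply: kboundB; first by rewrite E; exists h.
  elim/big_ind: _ => [|*|g /eqP gE]; [exact: kbound0|exact: kboundD|].
  have [q qj dq] := m_boundary sr_m_gen (cP g) (zdeg g) (zcyc g).
  by exists q; rewrite ?dq // -gE.
exact: sr_m_ind.
Qed.

End GolodStanleyReisner.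

(** * Complete intersections of two monomials *)

Section TateResolution.

Variables (k : fieldType) (R : comNzRingType) (iota : {rmorphism k -> R}).
Variable m : R -> Prop.
Hypothesis m0 : m 0.
Hypothesis mD : forall r s, m r -> m s -> m (r + s).
Hypothesis mM : forall r s, m s -> m (r * s).
Hypothesis m_res : forall r, exists c, m (r - iota c).
Hypothesis m_iota : forall c, m (iota c) -> c = 0.

Variables (e : nat) (x : 'I_e -> R).
Hypothesis m_x : forall i, m (x i).
Hypothesis m_gen : forall r, m r -> exists s : 'I_e -> R, r = \sum_i x i * s i.

Local Notation K := (koszul R e).
Local Notation d := (koszul_diff x).
Local Notation one := (kone R e).

Variables y z : K.
Hypothesis y_deg : koszul_deg 1 y.
Hypothesis z_deg : koszul_deg 1 z.
Hypothesis dy : d y = 0.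
Hypothesis dz : d z = 0.
Hypothesis y_sq : kmul y y = 0.
Hypothesis z_sq : kmul z z = 0.
Hypothesis zy : kmul z y = - kmul y z.
Hypothesis y_min : forall S, m (y S).
Hypothesis z_min : forall S, m (z S).
Hypothesis span1 : forall f, koszul_deg 1 f -> d f = 0 -> exists (r s : R) (h : K),
  koszul_deg 2 h /\ f = r *: y + s *: z + d h.
Hypothesis span2 : forall f, koszul_deg 2 f -> d f = 0 -> exists (t : R) (h : K),
  koszul_deg 3 h /\ f = t *: kmul y z + d h.
Hypothesis span3 : forall j f, koszul_deg j.+3 f -> d f = 0 -> exists2 h : K,
  koszul_deg j.+4 h & f = d h.
Hypothesis ind1 : forall (r s : R) (h : K), r *: y + s *: z = d h -> m r /\ m s.
Hypothesis ind2 : forall (t : R) (h : K), t *: kmul y z = d h -> m t.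

(** The pair (p, q) stands for the product of divided powers Y^(p) Z^(q), where Y and Z have degree
    2 and boundaries y and z. *)
Definition tate_weight (w : nat * nat) : nat := (w.1 + w.2).*2.

Definition tate_words (i : nat) : seq (nat * nat) :=
  [seq w <- [seq (p, q) | p <- seq.iota 0 i.+1, q <- seq.iota 0 i.+1] | (tate_weight w <= i)%N].

(** The boundary of the divided power Y^(p+1) is y Y^(p): no integer coefficients occur, so the
    characteristic of k does not matter. *)
Definition tate_diff (f : nat * nat -> K) (w : nat * nat) : K :=
  d (f w) + kmul (kbar (f (w.1.+1, w.2))) y + kmul (kbar (f (w.1, w.2.+1))) z.

Local Notation D := tate_diff.
Local Notation wt := tate_weight.
Local Notation tdeg := (twisted_deg wt).

Lemma tate_words_uniq i : uniq (tate_words i).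
Proof.
rewrite filter_uniq // allpairs_uniq ?iota_uniq //.
by move=> [p q] [p' q'] _ _ [-> ->].
Qed.

Lemma mem_tate_words i w : (w \in tate_words i) = (wt w <= i)%N.
Proof.
rewrite mem_filter andb_idr // => wi.
apply/allpairsP; exists w; case: w wi => p q; rewrite /wt [_.1]/= [_.2]/= => wi.
by split; rewrite // mem_iota; lia.
Qed.

Lemma tate_weight0 w : (wt w == 0%N) = (w == (0%N, 0%N)).
Proof. by case: w => [[|p] [|q]]. Qed.

Lemma tate_diffD f g w : D (fun w => f w + g w) w = D f w + D g w.
Proof.
by rewrite /D koszul_diffD !kbarD !kmulDl [X in X + _ = _]addrACA [LHS]addrACA.
Qed.

Lemma tate_diffZ r f w : D (fun w => (r : R) *: f w) w = r *: D f w.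
Proof. by rewrite /D koszul_diffZ !kbarZ !kmulZl !scalerDr. Qed.

Lemma tate_diffB f g w : D (fun w => f w - g w) w = D f w - D g w.
Proof.
rewrite -[in RHS]scaleN1r -tate_diffZ -tate_diffD; congr (D _ w).
by apply: functional_extensionality => v; rewrite scaleN1r.
Qed.

Lemma tate_diff_deg i f : tdeg i.+1 f -> tdeg i (D f).
Proof.
move=> fi [p q] S nS; rewrite ffunE [X in X + _]ffunE.
have -> : d (f (p, q)) S = 0.
  rewrite koszul_diffE big1 // => s sS; rewrite fi ?mulr0 //.
  by rewrite cardsU1 sS add1n addnS eqSS.
have aux w (v : K) : wt w = (wt (p, q)).+2 -> koszul_deg 1 v -> kmul (kbar (f w)) v S = 0.
  move=> ww v1; rewrite ffunE big1 // => X XS.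
  case: (boolP (wt w + #|X| == i.+1)%N) => [/eqP E|nE]; last first.
    by rewrite ffunE fi // mulr0 mul0r mulr0.
  rewrite v1 ?mulr0 // cardsD (setIidPr XS); have := subset_leq_card XS.
  by move: E nS; rewrite ww; move: (wt (p, q)) => n; lia.
by rewrite !aux ?addr0 // /wt /= ?addSn ?addnS doubleS.
Qed.

Lemma tate_diffK f w : D (D f) w = 0.
Proof.
rewrite /D /= !koszul_diffD koszul_diffK add0r !koszul_diffM dy dz !kmul0r !addr0.
rewrite !koszul_diff_bar !kbarD !kmulDl !kbarM !kbarK.
rewrite (kbar_deg y_deg) (kbar_deg z_deg) expr1 !scaleN1r.
rewrite !kmulNl !kmulNr !kmulNl -!kmulA y_sq z_sq zy !kmul0r kmulNr !oppr0 opprK.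
set u := kmul _ y; set v := kmul _ z; set t := kmul _ (kmul y z).
by rewrite !addr0 [X in X + _]addrACA addNr add0r addrACA addNr subrr addr0.
Qed.

Lemma tate_diff_min f w S : m (D f w S).
Proof.
rewrite ffunE [X in X + _]ffunE; apply: mD; [apply: mD|].
- rewrite koszul_diffE; apply: (ideal_sum m0 mD) => s _.
  by rewrite mulrC; apply: mM; apply: mM.
- by rewrite ffunE; apply: (ideal_sum m0 mD) => X _; do 2!apply: mM.
by rewrite ffunE; apply: (ideal_sum m0 mD) => X _; do 2!apply: mM.
Qed.

Lemma tate_reduce N i f : (forall g, tdeg i.+1 g -> (forall w, D g w = 0) ->
    (forall w, (N <= w.1 + w.2)%N -> g w = 0) -> exists2 h, tdeg i.+2 h & g = D h) ->
  tdeg i.+1 f -> (forall w, D f w = 0) ->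
  (exists2 g, tdeg i.+2 g & forall w, (N <= w.1 + w.2)%N -> f w = D g w) ->
  exists2 h, tdeg i.+2 h & f = D h.
Proof.
move=> IH fi Df [g gi gE].
have [|w|w wN|h hi hE] := IH (fun w => f w - D g w).
- by move=> w S nS; rewrite [LHS]ffunE [X in _ + X]ffunE fi // (tate_diff_deg gi) // subr0.
- by rewrite tate_diffB Df tate_diffK subr0.
- by rewrite gE ?subrr.
exists (fun w => h w + g w); first by move=> w S nS; rewrite ffunE hi // gi // addr0.
apply: functional_extensionality => w; rewrite tate_diffD -(congr1 (fun F => F w) hE).
by rewrite subrK.
Qed.

(** Induction on a bound for the total exponent. The terms of top exponent N are Koszul cycles of
    degree l = i.+1 - 2N, removed by means of the Koszul homology; for l = 0 and l = 1 the cycle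
    equations at exponent N - 1 supply the relations between their coefficients. *)
Lemma tate_exact i f : tdeg i.+1 f -> (forall w, D f w = 0) ->
  exists2 g, tdeg i.+2 g & f = D g.
Proof.
move=> fi Df.
have [N f0] : exists N, forall w, (N <= w.1 + w.2)%N -> f w = 0.
  exists i.+2 => w wi; apply/ffunP => S; rewrite ffunE fi // /wt -addnn; lia.
elim: N f fi Df f0 => [|N IH] f fi Df f0.
  exists (fun=> 0); first by move=> w S _; rewrite ffunE.
  by apply: functional_extensionality => w; rewrite f0 // /D koszul_diff0 kbar0 !kmul0l !addr0.
apply: (tate_reduce (N := N) IH fi Df).
have top p q : (p + q)%N = N -> d (f (p, q)) = 0.
  move=> pq; rewrite -[RHS](Df (p, q)) /D /=.
  rewrite (f0 (p.+1, q)) ?(f0 (p, q.+1)) /= ?addSn ?addnS ?pq //.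
  by rewrite kbar0 !kmul0l !addr0.
have below : forall p q, (p + q).+1 = N ->
    d (f (p, q)) + kmul (kbar (f (p.+1, q))) y + kmul (kbar (f (p, q.+1))) z = 0.
  by move=> p q pq; rewrite -[RHS](Df (p, q)).
have fdeg p q l : (p + q)%N = N -> i.+1 = (N.*2 + l)%N -> koszul_deg l (f (p, q)).
  move=> pq E S nS; apply: fi; rewrite /wt /= pq; apply: contra nS => /eqP; rewrite E.
  by move/addnI->.
(* If the top terms are Koszul boundaries, their primitives placed at exponent N are enough. *)
have bnd : (forall p q, (p + q)%N = N -> exists2 h : K, koszul_deg (i.+2 - N.*2) h & f (p, q) = d h) ->
    exists2 g, tdeg i.+2 g & forall w, (N <= w.1 + w.2)%N -> f w = D g w.
  move=> H; have /(choice_on (0 : K))[h hP] w : (w.1 + w.2)%N = N ->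
      exists h : K, koszul_deg (i.+2 - N.*2) h /\ f w = d h.
    by case: w => p q /H[h hj hE]; exists h.
  exists (fun w => if ((w.1 + w.2)%N == N) && (N.*2 <= i.+2)%N then h w else 0).
    move=> w S nS; case: ifP => [/andP[/eqP wN Ni]|_]; last by rewrite ffunE.
    have [hj _] := hP w wN; apply: hj; apply: contra nS => /eqP->.
    by rewrite /wt wN subnKC.
  move=> w; rewrite leq_eqVlt => /orP[/eqP/esym wN|wN].
    rewrite /D /= !addSn !addnS wN eqxx /= (gtn_eqF (ltnSn N)) /=.
    rewrite kbar0 !kmul0l !addr0; have [hj hE] := hP w wN.
    case: leqP => // Ni; rewrite koszul_diff0; apply/ffunP => S.
    by rewrite ffunE fi // /wt wN; apply/negP => /eqP; lia.
  rewrite f0 // /D /= !addSn !addnS !(gtn_eqF _) ?koszul_diff0 ?kbar0 ?kmul0l ?addr0 //.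
    exact: ltnW.
(* Otherwise the primitive also has terms at exponent N + 1. They must be Koszul cycles, so that
   nothing appears at that exponent. *)
have glue l (h g : nat * nat -> K) : i.+2 = (N.+1.*2 + l)%N ->
    (forall w, (w.1 + w.2)%N = N -> koszul_deg l.+2 (h w)) ->
    (forall w, (w.1 + w.2)%N = N.+1 -> koszul_deg l (g w)) ->
    (forall w, (w.1 + w.2)%N = N.+1 -> d (g w) = 0) ->
    (forall p q, (p + q)%N = N -> f (p, q) =
       d (h (p, q)) + kmul (kbar (g (p.+1, q))) y + kmul (kbar (g (p, q.+1))) z) ->
    exists2 g, tdeg i.+2 g & forall w, (N <= w.1 + w.2)%N -> f w = D g w.
  move=> El hl gl dg fE.
  pose G w := if (w.1 + w.2 == N)%N then h w else if (w.1 + w.2 == N.+1)%N then g w else 0.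
  exists G.
    move=> w S nS; rewrite /G; case: eqP => [wN|_].
      by apply: hl => //; apply: contra nS => /eqP->; rewrite /wt wN El doubleS !addSnnS.
    case: eqP => [wN|_]; last by rewrite ffunE.
    by apply: gl => //; apply: contra nS => /eqP->; rewrite /wt wN El.
  move=> [p q]; rewrite leq_eqVlt => /orP[/eqP/= pq|pq].
    rewrite /D /G /= addSn addnS -pq eqxx !(gtn_eqF (ltnSn N)) eqxx.
    exact: fE.
  rewrite f0 // /D /G /= addSn addnS !(gtn_eqF pq) (gtn_eqF (ltnW pq : N < (p + q).+1)%N).
  rewrite eqSS (gtn_eqF pq) kbar0 !kmul0l !addr0.
  by case: eqP => [pqN|_]; [rewrite (dg (p, q))|rewrite koszul_diff0].
have [Ni|iN] := leqP N.*2 i.+1; last first.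
  apply: bnd => p q pq; exists 0; first exact: koszul_deg0.
  rewrite koszul_diff0; apply/ffunP => S; rewrite ffunE fi // /wt /= pq.
  by apply/negP => /eqP; lia.
have [l El] : exists l, i.+1 = (N.*2 + l)%N by exists (i.+1 - N.*2)%N; rewrite subnKC.
have hl : (i.+2 - N.*2 = l.+1)%N by rewrite El -addnS addKn.
case: l El hl => [|[|[|l]]] El hl; last 1 first.
- apply: bnd => p q pq; have [h hj hE] := span3 (fdeg _ _ _ pq El) (top _ _ pq).
  by exists h; rewrite ?hl.
- apply: bnd => p q pq; rewrite hl.
  have fE p' q' : (p' + q')%N = N -> f (p', q') = (f (p', q') set0 : R) *: one.
    by move=> pq'; apply: koszul_deg0E; apply: fdeg.
  have N0 : (0 < N)%N by case: (N) El.
  suff /(kone_boundary m_gen)[h h1 hE] : m (f (p, q) set0).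
    by exists h => //; rewrite hE -fE.
  (* The equation at (p', q') says that y and z, combined with these two scalars, bound. *)
  have lin p' q' : (p' + q').+1 = N -> m (f (p'.+1, q') set0) /\ m (f (p', q'.+1) set0).
    move=> pq'; apply: (ind1 (h := - f (p', q'))); rewrite koszul_diffN.
    have := below p' q' pq'.
    rewrite {1}(fE p'.+1 q') ?addSn // {1}(fE p' q'.+1) ?addnS //.
    rewrite !kbarZ !(kbar_deg (@kone_deg R e)) expr0 !scale1r !kmulZl !kmul1l -addrA addrC.
    by move/eqP; rewrite addr_eq0 => /eqP.
  case: p pq => [|p] pq; last by case: (lin p q).
  by case: q pq => [|q] pq; [rewrite -pq in N0|case: (lin 0%N q)].
- have /(choice_on ((0, 0, 0) : R * R * K))[c cP] w : (w.1 + w.2)%N = N ->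
      exists c : R * R * K, koszul_deg 2 c.2 /\ f w = c.1.1 *: y + c.1.2 *: z + d c.2.
    case: w => p q pq.
    by have [r [s [h H]]] := span1 (fdeg _ _ _ pq El) (top _ _ pq); exists (r, s, h).
  pose r w := (c w).1.1; pose s w := (c w).1.2; pose h w := (c w).2.
  (* Up to boundaries, the equation at (p, q) is a multiple of y z by this difference. *)
  have rs p q : (p + q).+1 = N -> m (s (p.+1, q) - r (p, q.+1)).
    move=> pq; have pq1 : (p.+1 + q)%N = N by rewrite addSn.
    have pq2 : (p + q.+1)%N = N by rewrite addnS.
    have [_ E1] := cP (p.+1, q) pq1; have [_ E2] := cP (p, q.+1) pq2.
    apply: (ind2 (h := kmul (h (p.+1, q)) y + kmul (h (p, q.+1)) z - f (p, q))).
    rewrite koszul_diffD koszul_diffN koszul_diffD !koszul_diffM dy dz !kmul0r !addr0.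
    have := below p q pq.
    rewrite (kbar_deg (fdeg _ _ _ pq1 El)) (kbar_deg (fdeg _ _ _ pq2 El)) expr1 !scaleN1r !kmulNl.
    move/eqP; rewrite -addrA addr_eq0 -opprD opprK => /eqP->.
    rewrite E1 E2 !kmulDl !kmulZl y_sq z_sq zy !scaler0 add0r addr0 -/(h _) -/(r _) -/(s _).
    rewrite -/(h _) scalerBl scalerN.
    set u := kmul (d _) y; set v := kmul (d _) z; set t := kmul y z.
    by rewrite [in RHS]addrACA opprD addrCA subrr addr0 opprD opprK.
  (* Scalars at exponent N + 1 that match the coefficients of y exactly. Those of z are matched
     exactly for p = 0 and modulo m otherwise by [rs], and elements of m times z bound. *)
  pose rho (w : nat * nat) : R := if w.1 is p.+1 then r (p, w.2) else s (0%N, w.2.-1).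
  have /(choice_on (0 : K))[h' h'P] w : (w.1 + w.2)%N = N ->
      exists h' : K, koszul_deg 2 h' /\ d h' = (s w - rho (w.1, w.2.+1)) *: z.
    move=> wN; have : m (s w - rho (w.1, w.2.+1)).
      by case: w wN => [[|p] q] /= wN; [rewrite subrr|apply: rs].
    by move=> /(m_boundary m_gen)/(_ z_deg dz)[g g2 gE]; exists g.
  apply: (glue 0%N (fun w => h w + h' w) (fun w => rho w *: one)) => //.
  - by move: El; lia.
  - by move=> w wN; apply: koszul_degD; [case: (cP w wN)|case: (h'P w wN)].
  - by move=> w _; apply: koszul_degZ; apply: kone_deg.
  - by move=> w _; rewrite koszul_diffZ koszul_diff1 scaler0.
  move=> p q pq; have [_ ->] := cP (p, q) pq; have [_] := h'P (p, q) pq.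
  rewrite koszul_diffD => ->; rewrite !kbarZ !(kbar_deg (@kone_deg R e)) expr0 !scale1r.
  rewrite !kmulZl !kmul1l /= -/(r _) -/(s _) -/(h _) scalerBl.
  set u := d _; set v := r _ *: y; set t := s _ *: z; set t' := rho _ *: z.
  by rewrite [RHS]addrAC -[X in _ = X + v]addrA subrK [LHS]addrC [v + t]addrC addrA.
- have /(choice_on ((0, 0) : R * K))[c cP] w : (w.1 + w.2)%N = N ->
      exists c : R * K, koszul_deg 3 c.2 /\ f w = c.1 *: kmul y z + d c.2.
    case: w => p q pq.
    by have [t [h H]] := span2 (fdeg _ _ _ pq El) (top _ _ pq); exists (t, h).
  (* A multiple of z placed at (p + 1, q) contributes the required multiple of y z at (p, q); its
     contribution at the other neighbour vanishes because z^2 = 0. *)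
  pose g w : K := if w.1 is p.+1 then (c (p, w.2)).1 *: z else 0.
  apply: (glue 1%N (fun w => (c w).2) g) => //.
  - by move: El; lia.
  - by move=> w wN; case: (cP w wN).
  - by move=> [[|p] q] _; [apply: koszul_deg0|apply: koszul_degZ].
  - by move=> [[|p] q] _; rewrite /g /= ?koszul_diff0 // koszul_diffZ dz scaler0.
  move=> p q pq; have [_ ->] := cP (p, q) pq.
  have -> : kmul (kbar (g (p, q.+1))) z = 0.
    case: p pq => [|p] pq; rewrite /g /=; first by rewrite kbar0 kmul0l.
    by rewrite kbarZ (kbar_deg z_deg) !kmulZl z_sq !scaler0.
  rewrite addr0 /g /= kbarZ (kbar_deg z_deg) expr1 scaleN1r kmulZl kmulNl zy opprK.
  by rewrite addrC.
Qed.

Lemma tate_tor_dim i : tor_dim iota m i (twisted_rank e wt tate_words i).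
Proof.
apply: (twisted_tor_dim m0 mD mM m_res m_iota (w0 := (0%N, 0%N)) tate_words_uniq
  mem_tate_words tate_weight0 (D := fun=> tate_diff)).
- by move=> j r f g w; rewrite tate_diffD tate_diffZ.
- by move=> j f; apply: tate_diff_deg.
- move=> f f0; split=> [/(kone_boundary m_gen)[g g1 Eg]|[g g1 ->]].
    exists (fun w => if w == (0%N, 0%N) then g else 0).
      move=> w S; case: (w =P (0%N, 0%N)) => [->|_ _]; last by rewrite ffunE.
      exact: g1.
    apply: functional_extensionality => -[p q]; rewrite /D /= !xpair_eqE /= ?andbF /=.
    rewrite !kbar0 !kmul0l !addr0; case: eqP => [->|p0] /=.
      case: eqP => [->|q0]; first by rewrite Eg; apply: koszul_deg0E => S nS; apply: f0.
      rewrite koszul_diff0; apply/ffunP => S; rewrite ffunE f0 // /wt /=.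
      by apply/negP => /eqP; move: q0; lia.
    rewrite koszul_diff0; apply/ffunP => S; rewrite ffunE f0 // /wt /=.
    by apply/negP => /eqP; move: p0; lia.
  exact: tate_diff_min.
- move=> j f fj; split=> [Df|[g gj ->] w]; first exact: tate_exact.
  exact: tate_diffK.
- by move=> j f w S _; apply: tate_diff_min.
Qed.

(** Degree 3 is left out because in the coefficient of z^4 it meets the linear coefficient of the
    Golod denominator, which is 0. *)
Lemma tate_ranks :
  [/\ twisted_rank e wt tate_words 0 = 1%N, twisted_rank e wt tate_words 1 = e,
      twisted_rank e wt tate_words 2 = ('C(e, 2) + 2)%N &
      twisted_rank e wt tate_words 4 = ('C(e, 4) + 2 * 'C(e, 2) + 3)%N].
Proof.
split; rewrite twisted_rankE.
- by rewrite (_ : tate_words 0 = [:: (0, 0)]%N) // big_seq1 bin0.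
- by rewrite (_ : tate_words 1 = [:: (0, 0)]%N) // big_seq1 bin1.
- rewrite (_ : tate_words 2 = [:: (0, 0); (0, 1); (1, 0)]%N) //.
  transitivity ('C(e, 2) + ('C(e, 0) + ('C(e, 0) + 0)))%N; last by rewrite bin0.
  by rewrite !big_cons big_nil.
rewrite (_ : tate_words 4 = [:: (0, 0); (0, 1); (0, 2); (1, 0); (1, 1); (2, 0)]%N) //.
transitivity ('C(e, 4) + ('C(e, 2) + ('C(e, 0) + ('C(e, 2) + ('C(e, 0) + ('C(e, 0) + 0))))))%N.
  by rewrite !big_cons big_nil.
rewrite bin0; lia.
Qed.

(* The coefficients of z and z^2 force e' = e and h 1 = 2; in degree 4 the Golod
   series then needs t 4 = 'C(e, 4) + 2 * 'C(e, 2) + 4 + e * h 2 + h 3, but there are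
   only 3 divided power monomials of degree 2 in two variables. *)
Lemma tate_not_golod : ~ golod iota m.
Proof.
move=> [e' [x' [t [h [_ _ tor _ series]]]]].
have tE i : t i = twisted_rank e wt tate_words i.
  exact: (tor_dim_unique m0 mD mM (tor i) (tate_tor_dim i)).
have [t0 t1 t2 t4] := tate_ranks; rewrite -!tE in t0 t1 t2 t4.
have := series 1%N; have := series 2%N; have := series 4%N.
rewrite /series_mul !big_ord_recr !big_ord0 /= t0 t1 t2 t4 bin1.
move=> E4 E2 E1; have Ee : e' = e by lia.
rewrite Ee in E4 E2.
have h1 : h 1%N = 2%N by lia.
rewrite h1 in E4.
have : (0 <= (e * h 2)%N)%N by [].
move: E4; lia.
Qed.

End TateResolution.

Section WedgeRelations.

Variables (R : comNzRingType) (e : nat).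
Local Notation K := (koszul R e).

Lemma kbasis1_sq (s : 'I_e) : kmul (kbasis R [set s]) (kbasis R [set s]) = 0.
Proof.
apply/ffunP => T; rewrite -/(wedge s _) wedgeE ffunE [RHS]ffunE; case: ifP => // sT.
case: eqP => [E|]; last by rewrite mulr0.
by have := set11 s; rewrite -E setD11.
Qed.

Lemma kbasis1_anti (s t : 'I_e) : s != t ->
  kmul (kbasis R [set s]) (kbasis R [set t]) = - kmul (kbasis R [set t]) (kbasis R [set s]).
Proof.
move=> st; apply/ffunP => T; rewrite -!/(wedge _ _) [RHS]ffunE !wedgeE !ffunE.
have aux (u v : 'I_e) : u != v -> u \in T -> (T :\ u == [set v]) = (T == [set u; v]).
  move=> uv uT; apply/eqP/eqP => [E|->]; first by rewrite -(setD1K uT) E.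
  by apply/setP => w; rewrite !inE; case: eqP => //= ->; rewrite (negbTE uv).
case: (T =P [set s; t]) => [ET|nT].
  have sT : s \in T by rewrite ET !inE eqxx.
  have tT : t \in T by rewrite ET !inE eqxx orbT.
  rewrite sT tT.
  have -> : T :\ s = [set t] by apply/eqP; rewrite aux // ET.
  have -> : T :\ t = [set s] by apply/eqP; rewrite aux // 1?eq_sym // ET setUC.
  rewrite !eqxx !nbelow1 !mulr1.
  by case: (ltngtP s t) => E; rewrite ?expr0 ?expr1 ?opprK //; case/eqP: st; apply: val_inj.
have F1 : s \in T -> (T :\ s == [set t]) = false by move=> sT; rewrite aux //; apply/negbTE/eqP.
have F2 : t \in T -> (T :\ t == [set s]) = false.
  by move=> tT; rewrite aux 1?[t == s]eq_sym // setUC; apply/negbTE/eqP.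
by case: ifP => [/F1->|_]; case: ifP => [/F2->|_]; rewrite ?mulr0 ?oppr0.
Qed.

Lemma kbasis1_mul (s t : 'I_e) : s != t ->
  kmul (kbasis R [set s]) (kbasis R [set t]) = (-1) ^+ (t < s)%N *: kbasis R [set s; t].
Proof.
move=> st; rewrite (@kbasis_wedge _ _ s [set s; t]) ?inE ?eqxx //.
have -> : [set s; t] :\ s = [set t].
  by apply/setP => w; rewrite !inE; case: eqP => //= ->; rewrite (negbTE st).
by rewrite nbelow1 scalerA -expr2 sqrr_sign scale1r.
Qed.

Lemma koszul_diff_addx (x x' : 'I_e -> R) (f : K) :
  koszul_diff (fun i => x i + x' i) f = koszul_diff x f + koszul_diff x' f.
Proof.
apply/ffunP => T; rewrite [RHS]ffunE !koszul_diffE -big_split.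
by apply: eq_bigr => s _; rewrite mulrDr mulrDl.
Qed.

(** Polarisation of d^2 = 0, the differential being additive in the variables. *)
Lemma koszul_diff_anti (x x' : 'I_e -> R) (f : K) :
  koszul_diff x (koszul_diff x' f) = - koszul_diff x' (koszul_diff x f).
Proof.
have := koszul_diffK (fun i => x i + x' i) f.
rewrite !koszul_diff_addx !koszul_diffD !koszul_diffK add0r addr0.
by move/eqP; rewrite addr_eq0 => /eqP.
Qed.

End WedgeRelations.

(** * Koszul homology for two squarefree monomials with disjoint supports *)

Section CompleteIntersection.

Variables (k : fieldType) (R : comNzRingType) (iota : {rmorphism k -> R}).
Variables (e : nat) (x : 'I_e -> R) (C : pred {set 'I_e}).
Variable co : 'X_{1..e} -> R -> k.
Hypothesis SR : stanley_reisner iota x C co.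

Local Notation K := (koszul R e).
Local Notation Kk := (koszul k e).
Local Notation d := (koszul_diff x).
Local Notation dk := (koszul_diff (fun=> 1 : k)).
Local Notation kmono := (kmono iota x).
Local Notation kcomp := (kcomp co).
Local Notation kbound := (kbound x).
Implicit Types (S T : {set 'I_e}) (u al : 'X_{1..e}) (r : R) (c : Kk).

Section OneFactor.

Variables (A B : {set 'I_e}) (a : 'I_e).
Hypothesis CE : forall S, C S = (A \subset S) || (B \subset S).
Hypothesis dAB : [disjoint A & B].
Hypothesis aA : a \in A.
Hypothesis B0 : B != set0.

Definition ci_cycle : K := xmon x (mset A - mset [set a])%MM *: kbasis R [set a].

Lemma ci_cycle_deg : koszul_deg 1 ci_cycle.
Proof.
by apply: koszul_degZ; rewrite -[X in koszul_deg X](cards1 a); apply: kbasis_deg.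
Qed.

Lemma ci_cycle_mono : ci_cycle = kmono (mset A) (kbasis k [set a]).
Proof.
apply/ffunP => S; rewrite !ffunE; case: eqP => [->|_]; last first.
  by rewrite scaler0; case: ifP => // _; rewrite (rmorph0 iota) mul0r.
by rewrite mset_le support_mset sub1set aA (rmorph1 iota) mul1r [LHS]mulr1.
Qed.

Lemma notBsubA S : S \subset A -> (B \subset S) = false.
Proof.
move=> SA; apply/negP => BS; have [E|[v vB]] := set_0Vmem B.
  by have := B0; rewrite E eqxx.
by have := disjointFl dAB vB; rewrite (subsetP SA) // (subsetP BS).
Qed.

(** B is nonempty and disjoint from A, so among the divisors of x^A only x^A itself vanishes in
    R. *)
Lemma inface_A S : inface C (mset A) S = (S \subset A) && (S != set0).
Proof.
rewrite inface_mset CE notBsubA ?subsetDl // orbF.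
case: (boolP (S \subset A)) => //= SA; congr (~~ _).
apply/idP/eqP => [AS|->]; last by rewrite setD0.
apply/setP => t; rewrite inE; apply/negP => tS.
by have := subsetP AS t (subsetP SA t tS); rewrite inE tS.
Qed.

Lemma ci_cycle_cycle : d ci_cycle = 0.
Proof.
rewrite koszul_diffZ; apply/ffunP => T; rewrite [LHS]ffunE koszul_diffE [RHS]ffunE.
have [->|T0] := eqVneq T set0; last first.
  rewrite big1 ?scaler0 // => s sT; rewrite ffunE; case: eqP => [E|]; last by rewrite mulr0.
  have [E'|[t tT]] := set_0Vmem T; first by rewrite E' eqxx in T0.
  have : t \in [set a] by rewrite -E inE tT orbT.
  rewrite inE => /eqP ta.
  have : s \in [set a] by rewrite -E setU11.
  by rewrite inE => /eqP sa; rewrite sa -ta tT in sT.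
rewrite (bigD1 a) ?inE //= big1 ?addr0 => [|s /andP[_ sa]]; last first.
  by rewrite ffunE setU0 (inj_eq set1_inj) (negbTE sa) mulr0.
rewrite ffunE setU0 eqxx mulr1.
rewrite nbelow0 expr0 mul1r -[RHS](xmon_nonface SR (u := mset A)).
  rewrite [RHS](@xmonB _ _ x (mset A) a) ?msetE ?aA // [LHS]mulrC.
  congr (_ * xmon x _); apply/mnmP => t; rewrite !mnmBE !msetE inE mnm1E eq_sym //.
by rewrite /nonface support_mset CE subxx.
Qed.

Lemma inface_B S T : B \subset T -> S \subset T -> S :&: A != set0 -> S :&: B != set0 ->
  inface C (mset T) S.
Proof.
move=> BT ST /set0Pn[v /setIP[vS vA]] /set0Pn[w /setIP[wS wB]].
rewrite inface_mset ST CE negb_or /=; apply/andP; split.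
  by apply/negP => AT; have := subsetP AT v vA; rewrite inE vS.
by apply/negP => BTS; have := subsetP BTS w wB; rewrite inE wS.
Qed.

(* Pairing a boundary in degree A with the contraction along A gives zero. *)
Lemma ci_cycle_independent r s (w h : K) : (forall v, v \in A -> w [set v] = 0) ->
  r *: ci_cycle + s *: w = d h -> co 0%MM r = 0.
Proof.
move=> w0 E; pose h' := kcomp (mset A) h.
pose dA := koszul_diff (fun i => (i \in A)%:R : k).
have dkE v : v \in A -> kcomp (mset A) (d h) [set v] = dA h' [set v].
  move=> vA; rewrite (kcomp_diff SR); last first.
    by rewrite inface_A sub1set vA; apply/set0Pn; exists v; rewrite inE.
  rewrite !koszul_diffE; apply: eq_bigr => t tv.
  case: (boolP (t \in A)) => // tA.
  rewrite [h' _](_ : _ = 0) ?mulr0 //; apply: kcomp_subdeg.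
  by rewrite mset_le support_mset subUset sub1set (negbTE tA).
have : \sum_(v in A) kcomp (mset A) (d h) [set v] = 0.
  have := congr1 (fun f : Kk => f set0) (koszul_diffK (fun i => (i \in A)%:R : k) h').
  rewrite koszul_diffE [RHS]ffunE => E0; rewrite -[RHS]E0 [RHS]big_mkcond [LHS]big_mkcond.
  apply: eq_bigr => v _; rewrite inE /= nbelow0 expr0 mul1r setU0.
  by case: (boolP (v \in A)) => vA; rewrite ?mul0r // mul1r dkE.
rewrite -E (bigD1 a) //= big1 ?addr0 => [|v /andP[vA va]].
  rewrite ffunE mset_le support_mset sub1set aA !ffunE w0 // eqxx scaler0 addr0.
  rewrite /GRing.scale /= mulr1 mulrC (coM_xmon SR) lepm_refl andbT.
  have := inface_A [set a]; rewrite /inface => /esym; rewrite sub1set aA.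
  have -> : [set a] != set0 by apply/set0Pn; exists a; rewrite inE.
  move=> /esym/andP[_ ->].
  by rewrite (_ : (_ - _)%MM = 0%MM) //; apply/mnmP => t; rewrite mnmBE subnn mnm0E.
rewrite ffunE mset_le support_mset sub1set vA !ffunE w0 // (inj_eq set1_inj) (negbTE va).
by rewrite !scaler0 addr0 (co0 SR).
Qed.

End OneFactor.

(** The homotopy along a leaves only the value of dk c at the empty set, the one subset of A that
    does not index a basis element. For j > 0 it is 0, as c has no terms at singletons. *)
Lemma ci_spanned_A (A B : {set 'I_e}) a j c : (forall S, C S = (A \subset S) || (B \subset S)) ->
  [disjoint A & B] -> a \in A -> B != set0 ->
  subdeg (mset A) c -> koszul_deg j.+1 c ->
  (forall S, inface C (mset A) S -> dk c S = 0) ->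
  exists2 r, (j != 0%N -> r = 0) & kbound j.+1 (kmono (mset A) c - r *: ci_cycle A a).
Proof.
move=> CE dAB aA B0 cA cj dc.
exists (iota (dk c set0)).
  move=> j0; rewrite koszul_diffE big1 ?rmorph0 // => s _.
  by rewrite cj ?mulr0 // setU0 cards1 eqSS eq_sym.
rewrite ci_cycle_mono // -kmonoZ (kmono_homotopy iota x (v := a) (c := c)) ?msetE ?aA //.
rewrite [X in _ + X - _](_ : _ = kmono (mset A) (dk c set0 *: kbasis k [set a])).
  rewrite addrK; exists (kmono (mset A) (wedge a c)) => //.
  exact/kmono_deg/wedge_deg.
apply: (kmono_eq SR) => S; rewrite (inface_A CE) // => /andP[SA S0].
rewrite wedgeE [RHS]ffunE [kbasis _ _ _]ffunE.
have [aS|aS] := boolP (a \in S); last first.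
  case: eqP => [ES|]; last by rewrite scaler0.
  by rewrite ES inE eqxx in aS.
have [Sa|Sa] := eqVneq (S :\ a) set0.
  have -> : S = [set a] by rewrite -(setD1K aS) Sa setU0.
  by rewrite eqxx setDv nbelow0 expr0 mul1r [RHS]mulr1.
rewrite dc ?mulr0; last by rewrite (inface_A CE) // Sa (subset_trans (subD1set _ _) SA).
by case: eqP => [ES|]; rewrite ?scaler0 //; rewrite ES setDv eqxx in Sa.
Qed.

Section TwoFactors.

Variables (A B : {set 'I_e}) (a b : 'I_e).
Hypothesis CE : forall S, C S = (A \subset S) || (B \subset S).
Hypothesis dAB : [disjoint A & B].
Hypothesis aA : a \in A.
Hypothesis bB : b \in B.

Let ab : a != b. Proof. by apply: contraTneq aA => ->; rewrite (disjointFl dAB bB). Qed.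

Local Notation y := (ci_cycle A a).
Local Notation z := (ci_cycle B b).
Local Notation U := (A :|: B).

Lemma ci_sq A' a' : kmul (ci_cycle A' a') (ci_cycle A' a') = 0.
Proof. by rewrite kmulZl kmulZr kbasis1_sq !scaler0. Qed.

Lemma ci_anti : kmul z y = - kmul y z.
Proof.
rewrite !(kmulZl, kmulZr) kbasis1_anti 1?eq_sym // !scalerN.
by rewrite !scalerA mulrC.
Qed.

Lemma ci_mul : kmul y z = (-1) ^+ (b < a)%N *: kmono (mset U) (kbasis k [set a; b]).
Proof.
rewrite kmulZl kmulZr kbasis1_mul // !scalerA mulrC -scalerA.
congr (_ *: _); apply/ffunP => S; rewrite !ffunE; case: eqP => [->|_]; last first.
  by rewrite scaler0; case: ifP => // _; rewrite (rmorph0 iota) mul0r.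
rewrite mset_le support_mset subUset !sub1set !inE aA bB orbT /= (rmorph1 iota) mul1r.
rewrite [LHS]mulr1 mulrC -xmonD; congr (xmon x _); apply/mnmP => i.
rewrite mnmDE !mnmBE !msetE !inE.
have := disjointFr dAB (x := i); case: (boolP (i \in A)) => iA /=; case: (boolP (i \in B)) => iB //=.
- by move/(_ isT).
- have /negbTE-> : i != b by apply: contraNneq iB => ->.
  by move=> _; case: (i == a).
have /negbTE-> : i != a by apply: contraNneq iA => ->.
by move=> _; case: (i == b).
Qed.

(* In degree A + B the differential is the sum of the anticommuting contractions
   along A and along B, so boundaries are killed by their composite. *)
Lemma ci_mul_independent r (h : K) : r *: kmul y z = d h -> co 0%MM r = 0.
Proof.
move=> E; pose h' := kcomp (mset U) h.
pose dA := koszul_diff (fun i => (i \in A)%:R : k).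
pose dB := koszul_diff (fun i => (i \in B)%:R : k).
pose pairing (g : Kk) : k := dA (dB g) set0.
have pairingE g : pairing g =
   \sum_(u in A) \sum_(v in B) (-1) ^+ (v > u)%N * (g [set v; u] : k).
  rewrite /pairing koszul_diffE [RHS]big_mkcond [LHS]big_mkcond.
  apply: eq_bigr => u _; rewrite inE /= nbelow0 expr0 mul1r setU0.
  case: (boolP (u \in A)) => uA; rewrite ?mul0r // mul1r koszul_diffE.
  rewrite [RHS]big_mkcond [LHS]big_mkcond; apply: eq_bigr => v _.
  rewrite inE; case: (v =P u) => [->|vu] /=; first by rewrite (disjointFr dAB uA).
  case: (boolP (v \in B)) => vB; rewrite ?mulr0 ?mul0r // mulr1 nbelow1.
  by [].
have sub0 (u : 'I_e) v (g : Kk) : u \notin U -> subdeg (mset U) g -> g (u |: v) = 0.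
  by move=> uU gU; apply: gU; rewrite mset_le support_mset subUset sub1set (negbTE uU).
have dkE S : inface C (mset U) S -> kcomp (mset U) (d h) S = dA h' S + dB h' S.
  move=> iS; rewrite (kcomp_diff SR) //.
  transitivity (koszul_diff (fun i => (i \in A)%:R + (i \in B)%:R : k) h' S); last first.
    by rewrite koszul_diff_addx ffunE.
  rewrite !koszul_diffE.
  apply: eq_bigr => t tS; have [tU|tU] := boolP (t \in U); last first.
    by rewrite sub0 ?mulr0 //; apply: kcomp_subdeg.
  congr (_ * _ * _); move: tU; rewrite inE.
  have := disjointFr dAB (x := t); case: (t \in A) => /= [->//|_ ->]; rewrite ?addr0 ?add0r //.
have : pairing (kcomp (mset U) (d h)) = 0.
  have -> : pairing (kcomp (mset U) (d h)) = pairing (dA h' + dB h').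
    rewrite !pairingE; apply: eq_bigr => u uA; apply: eq_bigr => v vB.
    rewrite dkE ?ffunE //; apply: (inface_B CE); first exact: subsetUr.
    - by rewrite subUset !sub1set !inE uA vB orbT.
    - by apply/set0Pn; exists u; rewrite !inE eqxx orbT.
    - by apply/set0Pn; exists v; rewrite !inE eqxx.
  rewrite /pairing (_ : dB (dA h' + dB h') = - dA (dB h')).
    by rewrite /dA koszul_diffN koszul_diffK oppr0 ffunE.
  by rewrite /dB koszul_diffD koszul_diffK addr0 koszul_diff_anti.
have iab : inface C (mset U) [set a; b].
  apply: (inface_B CE); first exact: subsetUr.
  - by rewrite subUset !sub1set !inE aA bB orbT.
  - by apply/set0Pn; exists a; rewrite !inE eqxx.
  - by apply/set0Pn; exists b; rewrite !inE eqxx orbT.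
have kcE S : kcomp (mset U) (r *: kmul y z) S =
    if S == [set a; b] then (-1) ^+ (b < a)%N * co 0%MM r else 0.
  rewrite ci_mul !ffunE.
  case: (S =P [set a; b]) => [->|_]; last first.
    case: ifP => // _; rewrite (rmorph0 iota) mul0r.
    by rewrite if_same !scaler0 (co0 SR).
  have /andP[-> nf] := iab.
  rewrite (rmorph1 iota) mul1r [X in co _ X]mulrCA (coZs SR); congr (_ * _).
  rewrite mulrC (coM_xmon SR) nf lepm_refl /=; congr (co _ r).
  by apply/mnmP => t; rewrite mnmBE subnn mnm0E.
have abE (u v : 'I_e) : u \in A -> v \in B -> ([set v; u] == [set a; b]) = (u == a) && (v == b).
  move=> uA vB; apply/eqP/andP => [Eab|[/eqP-> /eqP->]]; last by rewrite setUC.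
  have : u \in [set a; b] by rewrite -Eab !inE eqxx orbT.
  have : v \in [set a; b] by rewrite -Eab !inE eqxx.
  rewrite !inE => /orP[/eqP va|->] /orP[->//|/eqP ub] //.
  - by have := disjointFl dAB vB; rewrite va aA.
  - by have := disjointFl dAB vB; rewrite va aA.
  by have := disjointFr dAB uA; rewrite ub bB.
rewrite -E pairingE (bigD1 a) //= [X in _ + X]big1 ?addr0; last first.
  move=> u /andP[uA ua]; rewrite big1 // => v vB.
  by rewrite kcE abE // (negbTE ua) mulr0.
rewrite (bigD1 b) //= [X in _ + X]big1 ?addr0; last first.
  by move=> v /andP[vB vb]; rewrite kcE abE // (negbTE vb) andbF mulr0.
rewrite kcE abE // !eqxx /= => /eqP.
by rewrite !mulf_eq0 !signr_eq0 => /eqP.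
Qed.

(** Koszul homology is the exterior algebra on y and z. All degrees share one statement so that the
    sum over the multidegrees is taken only once. *)
Definition ci_spanned j (f : K) : Prop := exists (r s t : R) (h : K),
  koszul_deg j.+2 h /\ f = (if j == 0%N then r *: y + s *: z else 0)
    + (if j == 1%N then t *: kmul y z else 0) + d h.

Lemma ci_spannedD j f g : ci_spanned j f -> ci_spanned j g -> ci_spanned j (f + g).
Proof.
move=> [r [s [t [h [hj ->]]]]] [r' [s' [t' [h' [hj' ->]]]]].
exists (r + r'), (s + s'), (t + t'), (h + h'); split; first exact: koszul_degD.
rewrite koszul_diffD !scalerDl [LHS]addrACA [X in X + _]addrACA; congr (_ + _ + _).
  by case: ifP; rewrite ?addr0 // addrACA.
by case: ifP; rewrite ?addr0.
Qed.

Lemma ci_spanned_bound j f : kbound j.+1 f -> ci_spanned j f.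
Proof.
move=> [h hj ->]; exists 0, 0, 0, h; split=> //.
by rewrite !scale0r addr0 !if_same !add0r.
Qed.

Lemma ci_spanned_y j f r : (j != 0%N -> r = 0) -> kbound j.+1 (f - r *: y) -> ci_spanned j f.
Proof.
move=> r0 [h hj E]; exists r, 0, 0, h; split=> //.
rewrite -E !scale0r if_same !addr0; case: eqP r0 => [_ _|_ ->//]; first by rewrite addrC subrK.
by rewrite scale0r add0r subr0.
Qed.

Lemma ci_spanned_z j f r : (j != 0%N -> r = 0) -> kbound j.+1 (f - r *: z) -> ci_spanned j f.
Proof.
move=> r0 [h hj E]; exists 0, r, 0, h; split=> //.
rewrite -E !scale0r if_same addr0 add0r; case: eqP r0 => [_ _|_ ->//]; first by rewrite addrC subrK.
by rewrite scale0r add0r subr0.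
Qed.

Lemma ci_spanned_yz j f r : (j != 1%N -> r = 0) -> kbound j.+1 (f - r *: kmul y z) -> ci_spanned j f.
Proof.
move=> r0 [h hj E]; exists 0, 0, r, h; split=> //.
rewrite -E !scale0r addr0 if_same add0r; case: eqP r0 => [_ _|_ ->//]; first by rewrite addrC subrK.
by rewrite scale0r add0r subr0.
Qed.

Lemma inface_U S : inface C (mset U) S = [&& S \subset U, S :&: A != set0 & S :&: B != set0].
Proof.
rewrite inface_mset CE negb_or; congr (_ && (_ && _)).
  rewrite subsetD subsetUl /= -setI_eq0 setIC; by [].
by rewrite subsetD subsetUr /= -setI_eq0 setIC.
Qed.

(** The basis in degree A + B is indexed by the S meeting both A and B, as in the tensor product of
    the unaugmented chain complexes of two simplices. Contracting along a and then along b leaves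
    only {a, b}. *)
Lemma ci_spanned_U j c : subdeg (mset U) c -> koszul_deg j.+1 c ->
  (forall S, inface C (mset U) S -> dk c S = 0) ->
  exists2 r, (j != 1%N -> r = 0) & kbound j.+1 (kmono (mset U) c - r *: kmul y z).
Proof.
move=> cU cj dc.
pose c0 := wedge a (dk c).
(* The remainder of the homotopy along a. When S meets A in more than a, the set S :\ a still
   indexes a basis element and dk c vanishes there. *)
pose c1 : Kk := [ffun S : {set 'I_e} =>
   (if inface C (mset U) S && (S :&: A == [set a]) then c0 S else 0 : k)].
have aU : (0 < mset U a)%N by rewrite msetE inE aA.
have bU : (0 < mset U b)%N by rewrite msetE inE bB orbT.
have cE : kmono (mset U) c = d (kmono (mset U) (wedge a c)) + kmono (mset U) c1.
  rewrite {1}(kmono_homotopy iota x aU cU); congr (_ + _).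
  apply: (kmono_eq SR) => S iS; rewrite [RHS]ffunE iS /=; case: eqP => // SAa.
  rewrite /c0 wedgeE; case: ifP => // aS; rewrite dc ?mulr0 //.
  move: iS; rewrite !inface_U => /and3P[SU /set0Pn[v vSA] SB].
  apply/and3P; split; first exact: subset_trans (subD1set _ _) SU.
    have [w wSA wa] : exists2 w, w \in S :&: A & w != a.
      case: (boolP [exists w in S :&: A, w != a]) => [/exists_inP//|].
      rewrite negb_exists_in => /forall_inP H; case: SAa; apply/setP => w.
      rewrite in_set1; apply/idP/eqP => [/H|->]; first by rewrite negbK => /eqP.
      by rewrite inE aS aA.
    by apply/set0Pn; exists w; move: wSA; rewrite !inE wa.
  have /set0Pn[w] := SB; rewrite inE => /andP[wS wB].
  apply/set0Pn; exists w; rewrite !inE wS wB !andbT.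
  by apply: contraTneq aA => <-; rewrite (disjointFl dAB wB).
have c1U : subdeg (mset U) c1.
  by move=> S; rewrite mset_le support_mset => nS; rewrite ffunE inface_U (negbTE nS).
have c1j : koszul_deg j.+1 c1.
  move=> S nS; rewrite ffunE; case: ifP => // /andP[iS _].
  rewrite /c0 wedgeE; case: ifP => // aS; rewrite (koszul_diff_deg _ cj) ?mulr0 //.
  by apply: contra nS => /eqP E; rewrite (cardsD1 a) aS E.
have dc1 S : inface C (mset U) S -> dk c1 S = 0.
  move=> iS; rewrite -(kmonoK SR (dk c1) iS) -kdiff_mono //.
  have -> : kmono (mset U) c1 = kmono (mset U) c - d (kmono (mset U) (wedge a c)).
    by rewrite cE addrC addKr.
  rewrite koszul_diffD koszul_diffN koszul_diffK subr0 kdiff_mono //.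
  by rewrite (kmonoK SR) // dc.
(* The set {a} does not meet B, so dk c1 need not vanish there; this value survives the homotopy
   along b. *)
pose lam := dk c1 [set a].
have c1E : kmono (mset U) c1 = d (kmono (mset U) (wedge b c1)) +
    kmono (mset U) (((-1) ^+ (a < b)%N * lam) *: kbasis k [set a; b]).
  rewrite {1}(kmono_homotopy iota x bU c1U); congr (_ + _).
  apply: (kmono_eq SR) => S iS; rewrite wedgeE [RHS]ffunE [kbasis _ _ _]ffunE.
  have [bS|bS] := boolP (b \in S); last first.
    case: eqP => [ES|]; last by rewrite scaler0.
    by rewrite ES !inE eqxx orbT in bS.
  have ba : b != a by apply: contraTneq aA => <-; rewrite (disjointFl dAB bB).
  have [ES|nS] := eqVneq S [set a; b].
    have -> : S :\ b = [set a].
      rewrite ES; apply/setP => t; rewrite !inE; case: (t =P b) => [->|] /=; last by rewrite orbF.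
      by rewrite (negbTE ba).
    by rewrite nbelow1 [RHS]mulr1.
  rewrite scaler0; have [iSb|niSb] := boolP (inface C (mset U) (S :\ b)).
    by rewrite dc1 ?mulr0.
  move: iS niSb; rewrite !inface_U => /and3P[SU SA SB].
  rewrite (subset_trans (subD1set _ _) SU) /=.
  have -> : (S :\ b) :&: A = S :&: A.
    apply/setP => t; rewrite !inE; case: (t =P b) => [->|] //=.
    by rewrite (disjointFl dAB bB) !andbF.
  rewrite SA /= negbK => /eqP SbB.
  (* A nonzero term would need t in B and t |: S :\ b meeting A in a alone, which forces S = {a,
     b}. *)
  rewrite koszul_diffE big1 ?mulr0 // => t tS.
  rewrite [c1 _]ffunE; case: ifP => [/andP[+ /eqP tA]|_]; last by rewrite mulr0.
  rewrite inface_U => /and3P[_ _ /set0Pn[w]]; rewrite !inE => /andP[/orP[/eqP wt|wS] wB]; last first.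
    by have : w \in (S :\ b) :&: B by [rewrite !inE wS wB]; rewrite SbB inE.
  case/negP: nS; apply/eqP/setP => q; rewrite !inE.
  apply/idP/orP => [qS|[/eqP->|/eqP->]] //.
    have [qb|qb] := eqVneq q b; [by right|left].
    have qA : q \in A.
      have := subsetP SU q qS; rewrite inE => /orP[//|qB].
      by have : q \in (S :\ b) :&: B by [rewrite !inE qb qS qB]; rewrite SbB inE.
    have : q \in (t |: S :\ b) :&: A by rewrite !inE qb qS qA orbT.
    by rewrite tA inE.
  have : a \in (t |: S :\ b) :&: A by rewrite tA set11.
  rewrite !inE => /andP[/orP[/eqP at_|/andP[]//] _].
  by have := disjointFl dAB wB; rewrite wt -at_ aA.
(* The last sign cancels the one in [ci_mul]. *)
exists (iota ((-1) ^+ (a < b)%N * lam * (-1) ^+ (b < a)%N)).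
  move=> j1; rewrite /lam koszul_diffE big1 ?mulr0 ?mul0r ?rmorph0 // => s.
  rewrite inE => sa; rewrite c1j ?mulr0 // cards2 sa.
  by apply: contra j1 => /eqP[<-].
rewrite ci_mul scalerA rmorphM rmorphXn rmorphN1 -mulrA -expr2 sqrr_sign mulr1.
rewrite -kmonoZ cE c1E addrA addrK -koszul_diffD; eexists; last by [].
by apply: koszul_degD; apply/kmono_deg/wedge_deg.
Qed.

(** Only the degrees A, B and A + B carry homology. Any other nonempty squarefree degree T has a
    vertex outside each of A and B that is contained in T, and this vertex is the apex of a cone. *)
Lemma ci_span j f : koszul_deg j.+1 f -> d f = 0 -> ci_spanned j f.
Proof.
move=> fj df; have [l _ ->] := koszul_decomposition SR f.
elim/big_ind: _ => [||al _]; first by apply: ci_spanned_bound; apply: kbound0.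
  exact: ci_spannedD.
have cyc S : inface C al S -> dk (kcomp al f) S = 0 by apply: (kcomp_cycle SR).
have [sal|nal] := boolP (squarefree al); last first.
  exact/ci_spanned_bound/(nonsquarefree_bound SR).
have cj := kcomp_deg SR al fj.
have cal : subdeg al (kcomp al f) by apply: kcomp_subdeg.
move: (kcomp al f) cyc cj cal; rewrite (squarefree_mset sal).
move: (mnm_support al) => T c dc cj cT {al sal f fj df l}.
have cone v : v \in T -> (forall S, v \in S -> inface C (mset T) S -> inface C (mset T) (S :\ v)) ->
    ci_spanned j (kmono (mset T) c).
  by move=> vT H; apply/ci_spanned_bound/(cone_bound SR vT).
have coneH v (X : {set 'I_e}) S : (v \in X -> ~~ (X \subset T)) ->
    ~~ (X \subset T :\: S) -> ~~ (X \subset T :\: (S :\ v)).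
  move=> H; apply: contra => XT; have [vX|vX] := boolP (v \in X).
    by case/negP: (H vX); apply: subset_trans XT (subsetDl _ _).
  apply/subsetP => q qX; have := subsetP XT q qX; rewrite !inE.
  by case: eqP => // qv; rewrite -qv qX in vX.
have coneT v : v \in T -> (v \in A -> ~~ (A \subset T)) -> (v \in B -> ~~ (B \subset T)) ->
    ci_spanned j (kmono (mset T) c).
  move=> vT HA HB; apply: (cone v vT) => S vS; rewrite !inface_mset !CE !negb_or.
  move=> /and3P[ST nA nB]; rewrite (subset_trans (subD1set _ _) ST) /=.
  by rewrite !coneH.
have [TU|/subsetPn[v vT]] := boolP (T \subset U); last first.
  rewrite inE negb_or => /andP[vA vB].
  by apply: (coneT v vT) => [vA'|vB']; [rewrite vA' in vA|rewrite vB' in vB].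
have [T0|[v vT]] := set_0Vmem T.
  by apply: ci_spanned_bound; rewrite T0; apply: empty_degree_bound.
have [AT|nAT] := boolP (A \subset T); have [BT|nBT] := boolP (B \subset T).
- have ET : T = U by apply/eqP; rewrite eqEsubset TU subUset AT.
  subst T; have [r r0 rb] := ci_spanned_U cT cj dc.
  exact: ci_spanned_yz r0 rb.
- have [TA|/subsetPn[w wT wA]] := boolP (T \subset A); last first.
    by apply: (coneT w wT) => // wA'; rewrite wA' in wA.
  have ET : T = A by apply/eqP; rewrite eqEsubset TA AT.
  subst T; have [|r r0 rb] := ci_spanned_A CE dAB aA _ cT cj dc.
    by apply/set0Pn; exists b.
  exact: ci_spanned_y r0 rb.
- have [TB|/subsetPn[w wT wB]] := boolP (T \subset B); last first.
    by apply: (coneT w wT) => // wB'; rewrite wB' in wB.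
  have ET : T = B by apply/eqP; rewrite eqEsubset TB BT.
  subst T; have [|||r r0 rb] := ci_spanned_A (A := B) (B := A) _ _ bB _ cT cj dc.
  - by move=> S; rewrite CE orbC.
  - by rewrite disjoint_sym.
  - by apply/set0Pn; exists a.
  exact: ci_spanned_z r0 rb.
by apply: (coneT v vT).
Qed.

End TwoFactors.


Variable m : R -> Prop.
Hypothesis mE : forall r, m r <-> co 0%MM r = 0.

(** No singleton is in C, so A is not contained in {a} and x^(A - a) is not constant. *)
Lemma ci_cycle_min (A B S : {set 'I_e}) a : (forall S, C S = (A \subset S) || (B \subset S)) ->
  m (ci_cycle A a S).
Proof.
move=> CE; apply/mE; rewrite ffunE [X in _ *: X]ffunE (coM_xmon SR).
case: ifP => // /andP[_ /mnm_lepP le0].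
have A1 : A \subset [set a].
  apply/subsetP => v vA; rewrite inE; apply: contraT => va.
  by have := le0 v; rewrite mnm0E mnmBE !msetE vA inE (negbTE va).
by have := sr_set1 SR a; rewrite CE A1.
Qed.

Lemma complete_intersection_not_golod (A B : {set 'I_e}) :
  (forall S, C S = (A \subset S) || (B \subset S)) -> [disjoint A & B] -> ~ golod iota m.
Proof.
move=> CE dAB.
have A0 : A != set0 by apply: contraNneq (sr_set0 SR) => E; rewrite CE E subxx.
have B0 : B != set0 by apply: contraNneq (sr_set0 SR) => E; rewrite CE E subxx orbT.
have [a aA] := set0Pn _ A0; have [b bB] := set0Pn _ B0.
have CE' S : C S = (B \subset S) || (A \subset S) by rewrite CE orbC.
have dBA : [disjoint B & A] by rewrite disjoint_sym.
have span := ci_span CE dAB aA bB.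
have notA v : v \in A -> ci_cycle B b [set v] = 0.
  move=> vA; rewrite !ffunE (inj_eq set1_inj); case: eqP => [vb|]; last by rewrite scaler0.
  by have := disjointFr dAB vA; rewrite vb bB.
have notB v : v \in B -> ci_cycle A a [set v] = 0.
  move=> vB; rewrite !ffunE (inj_eq set1_inj); case: eqP => [va|]; last by rewrite scaler0.
  by have := disjointFl dAB vB; rewrite va aA.
apply: (@tate_not_golod _ _ _ m (sr_m0 SR mE) (sr_mD SR mE) (sr_mM SR mE)
  (sr_m_res SR mE) (sr_m_iota SR mE) e x (sr_m_x SR mE) (sr_m_gen SR mE)
  (ci_cycle A a) (ci_cycle B b)).
- exact: ci_cycle_deg.
- exact: ci_cycle_deg.
- exact: (ci_cycle_cycle CE aA).
- exact: (ci_cycle_cycle CE' bB).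
- exact: ci_sq.
- exact: ci_sq.
- exact: (ci_anti dAB aA bB).
- by move=> S; apply: ci_cycle_min CE.
- by move=> S; apply: ci_cycle_min CE'.
- move=> f f1 df; have [r [s [t [h [h2 ->]]]]] := span 0%N f f1 df.
  by exists r, s, h; rewrite /= addr0.
- move=> f f1 df; have [r [s [t [h [h2 ->]]]]] := span 1%N f f1 df.
  by exists t, h; rewrite /= add0r.
- move=> j f f1 df; have [r [s [t [h [h2 ->]]]]] := span j.+2 f f1 df.
  by exists h; rewrite /= ?addr0 ?add0r.
- move=> r s h E; split; apply/mE.
    exact: (ci_cycle_independent CE dAB aA B0 notA E).
  by apply: (ci_cycle_independent CE' dBA bB A0 notB (h := h)); rewrite -E addrC.
- by move=> t h E; apply/mE; apply: (ci_mul_independent CE dAB aA bB E).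
Qed.

End CompleteIntersection.

(** * Cover ideals *)

Section MonomialIdeals.

Variables (k : fieldType) (n : nat).
Local Notation Q := {mpoly k[n]}.
Implicit Types (p q : Q) (u v w : 'X_{1..n}).

Lemma mcoeffMX_if p u w : (p * 'X_[u])@_w = if (u <= w)%MM then p@_(w - u) else 0.
Proof.
case: ifP => uw; first by rewrite -[in LHS](submK uw) addmC mcoeffMX.
apply: memN_msupp_eq0; rewrite (perm_mem (msuppMX p u)); apply/negP => /mapP[w' _ E].
by rewrite E lem_addr in uw.
Qed.

Lemma monomial_idealP (P : 'X_{1..n} -> Prop) p :
  ideal_gen (fun z => exists2 u, P u & z = 'X_[u]) p <->
  forall w, p@_w != 0 -> exists2 u, P u & (u <= w)%MM.
Proof.
split=> [[r [a [g [gP ->]]]] w|H].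
  rewrite raddf_sum /= => nz.
  have [i ai] : exists i, (a i * g i)@_w != 0.
    apply/existsP; apply: contraNT nz; rewrite negb_exists => /forallP z.
    by rewrite big1 // => i _; apply/eqP; have := z i; rewrite negbK.
  have [u Pu gE] := gP i; exists u => //; move: ai; rewrite gE mcoeffMX_if.
  by case: ifP => //; rewrite eqxx.
have Hi (i : 'I_(size (msupp p))) : exists u, P u /\ (u <= tnth (in_tuple (msupp p)) i)%MM.
  have := mem_tnth i (in_tuple (msupp p)); rewrite mcoeff_msupp => /H[u Pu uw].
  by exists u.
have [f fP] := fin_all_exists Hi.
exists (size (msupp p)), (fun i => p@_(tnth (in_tuple (msupp p)) i) *:
   'X_[(tnth (in_tuple (msupp p)) i - f i)]), (fun i => 'X_[f i]); split.
  by move=> i; exists (f i) => //; case: (fP i).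
rewrite {1}[p]mpolyE big_tnth; apply: eq_bigr => i _.
by rewrite -scalerAl -mpolyXD submK //; case: (fP i).
Qed.

Lemma ideal_gen_ext (R : comNzRingType) (S T : R -> Prop) (x : R) :
  (forall z, S z <-> T z) -> ideal_gen S x <-> ideal_gen T x.
Proof.
by move=> ST; split=> -[r [a [g [H E]]]]; exists r, a, g; split => // i; apply/ST.
Qed.

Lemma ideal_gen_nil p : ideal_gen (fun z => z \in [::]) p <-> p = 0.
Proof.
split=> [[[|r] [a [g [H ->]]]]|->]; first by rewrite big_ord0.
  by have := H ord0.
by exists 0%N, (fun=> 0), (fun=> 0); split; [case|rewrite big_ord0].
Qed.

Lemma ideal_gen_seqX (s : seq 'X_{1..n}) p :
  ideal_gen (fun z => z \in [seq 'X_[k, u] | u <- s]) p <->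
  forall w, p@_w != 0 -> exists2 u, u \in s & (u <= w)%MM.
Proof.
rewrite -(monomial_idealP (fun u => u \in s)); apply: ideal_gen_ext => z.
by split=> [/mapP//|[u us ->]]; apply: map_f.
Qed.

Lemma mcoeffX_neq0 u w : ('X_[k, u])@_w != 0 <-> u = w.
Proof. by rewrite mcoeffX; case: (u =P w) => [->|uw]; split; rewrite ?oner_eq0 ?eqxx. Qed.

Lemma regular_pairP u v : (0 < mdeg u)%N -> (0 < mdeg v)%N ->
  regular_seq [:: 'X_[k, u]; 'X_[v]] <->
  (forall i, (u i == 0%N) || (v i == 0%N)).
Proof.
have m0 w : ((w <= 0)%MM -> mdeg w = 0%N).
  move=> /mnm_lepP w0; apply/eqP; rewrite mdeg_eq0; apply/eqP/mnmP => i.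
  by apply/eqP; rewrite mnm0E -leqn0; have := w0 i; rewrite mnm0E.
move=> u0 v0; split=> [[reg _] i|dis].
  apply/norP => -[ui vi]; rewrite -!lt0n in ui vi.
  (* If the variable i divides both monomials, x^(u - U_(i)) times x^v lies in (x^u) although x^(u -
     U_(i)) does not. *)
  have := reg 1%N (erefl _) 'X_[(u - U_(i))]; rewrite /= -/(map (fun u => 'X_[k, u]) [:: u]).
  rewrite !ideal_gen_seqX => H.
  have [w||w /[1!inE] /eqP -> /mnm_lepP/(_ i)] := H _ (u - U_(i))%MM.
  - rewrite -mpolyXD => /mcoeffX_neq0 <-; exists u; first by rewrite inE.
    apply/mnm_lepP => j; rewrite mnmDE mnmBE mnm1E; case: eqP => [<-|_]; last by rewrite subn0 leq_addl.
    by move: vi; lia.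
  - by apply/mcoeffX_neq0.
  by rewrite mnmBE mnm1E eqxx; move: ui; lia.
split.
  move=> [|[|//]] _ p /=.
    rewrite !ideal_gen_nil => E; apply/mpolyP => w; rewrite mcoeff0.
    by have := congr1 (mcoeff (u + w)) E; rewrite mulrC mcoeffMX mcoeff0.
  rewrite -/(map (fun u => 'X_[k, u]) [:: u]) !ideal_gen_seqX => H w pw.
  have [|u' /[1!inE] /eqP -> /mnm_lepP uw] := H (v + w)%MM.
    by rewrite mulrC mcoeffMX.
  exists u; rewrite ?inE //; apply/mnm_lepP => i; have := uw i; rewrite mnmDE.
  by case/orP: (dis i) => /eqP->.
rewrite -/(map (fun u => 'X_[k, u]) [:: u; v]) ideal_gen_seqX => H.
have [|w + w0] := H 0%MM; first by rewrite mcoeff1 eqxx oner_eq0.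
by rewrite !inE => /orP[]/eqP E; rewrite E in w0; have := m0 _ w0; lia.
Qed.

End MonomialIdeals.

Section CoverIdeals.

Variables (V : finType) (G : rel V) (k : fieldType).
Local Notation n := #|V|.
Local Notation Q := {mpoly k[n]}.
Implicit Types (w : 'X_{1..n}) (A B : {set V}).

Definition vsupport w : {set V} := [set v | (0 < w (enum_rank v))%N].

Definition vmono A : 'X_{1..n} := [multinom (enum_val i \in A : nat) | i < n].

Lemma vmonoE A v : vmono A (enum_rank v) = (v \in A).
Proof. by rewrite mnmE enum_rankK. Qed.

Lemma vmono_le A w : (vmono A <= w)%MM = (A \subset vsupport w).
Proof.
apply/mnm_lepP/subsetP => [H v vA|H i]; first by have := H (enum_rank v); rewrite vmonoE vA inE.
rewrite mnmE; case: (boolP (enum_val i \in A)) => // /H.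
by rewrite inE enum_valK.
Qed.

Lemma vmono_support A : vsupport (vmono A) = A.
Proof. by apply/setP => v; rewrite inE vmonoE lt0b. Qed.

Lemma vmono_deg A : mdeg (vmono A) = #|A|.
Proof.
rewrite mdegE -sum1_card [RHS]big_mkcond (reindex (@enum_rank V)) /=.
  by apply: eq_bigr => v _; rewrite vmonoE; case: (_ \in _).
by exists enum_val => i _; rewrite ?enum_valK ?enum_rankK.
Qed.

Lemma vmono_prod A : \prod_(x in A) 'X_(enum_rank x) = 'X_[k, vmono A].
Proof.
rewrite mpolyXE_id [LHS]big_mkcond (reindex (@enum_rank V)) /=.
  by apply: eq_bigr => v _; rewrite vmonoE; case: (_ \in _).
by exists enum_val => i _; rewrite ?enum_valK ?enum_rankK.
Qed.

Lemma vertex_coverP A : reflect (forall x y, G x y -> (x \in A) || (y \in A)) (vertex_cover G A).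
Proof.
apply: (iffP forallP) => [H x y Gxy|H x]; first by have /forallP/(_ y)/implyP := H x; apply.
by apply/forallP => y; apply/implyP; apply: H.
Qed.

Lemma vertex_cover_sub A B : A \subset B -> vertex_cover G A -> vertex_cover G B.
Proof.
move=> /subsetP AB /vertex_coverP cA; apply/vertex_coverP => x y /cA.
by case/orP => /AB ->; rewrite ?orbT.
Qed.

(** Every cover contains a minimal one, so the monomials of J(G) are those whose support is a
    cover. *)
Lemma cover_idealP (p : Q) :
  cover_ideal G k p <-> forall w, p@_w != 0 -> vertex_cover G (vsupport w).
Proof.
transitivity (ideal_gen (fun z : Q => exists2 u,
    (exists2 A, minset (vertex_cover G) A & u = vmono A) & z = 'X_[u]) p).
  apply: ideal_gen_ext => z; split=> [[A mA ->]|[u [A mA ->] ->]].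
    by exists (vmono A); [exists A|rewrite vmono_prod].
  by exists A; rewrite ?vmono_prod.
rewrite monomial_idealP; split=> H w /H.
  move=> [u [A /minsetP[cA _] ->]]; rewrite vmono_le => /vertex_cover_sub; exact.
move=> /minset_exists[A mA AS]; exists (vmono A); first by exists A.
by rewrite vmono_le.
Qed.

(** The argument [nc] is what makes the ideal proper, as the [idealr] instance requires. *)
Definition cover_pred (nc : ~~ vertex_cover G set0) : Q -> bool :=
  fun p => all (fun w => vertex_cover G (vsupport w)) (msupp p).

Lemma cover_predP nc (p : Q) : reflect (cover_ideal G k p) (p \in cover_pred nc).
Proof.
apply: (iffP allP) => [H|/cover_idealP H w].
  by apply/cover_idealP => w; rewrite -mcoeff_msupp; apply: H.
by rewrite mcoeff_msupp; apply: H.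
Qed.

Lemma vsupport0 : vsupport 0%MM = set0.
Proof. by apply/setP => v; rewrite !inE mnm0E. Qed.

Lemma cover_pred_closed nc : idealr_closed (cover_pred nc).
Proof.
split.
- by rewrite unfold_in /cover_pred msupp0.
- apply/cover_predP => /cover_idealP/(_ 0%MM); rewrite mcoeff1 eqxx oner_eq0 vsupport0.
  by rewrite (negbTE nc) => /(_ isT).
move=> a p q /cover_predP cp /cover_predP cq; apply/cover_predP; exact: ideal_gen_lin.
Qed.

HB.instance Definition _ nc := isIdealr.Build Q (cover_pred nc) (cover_pred_closed nc).

Definition cover_idealr nc : idealr Q := cover_pred nc.

End CoverIdeals.

(** * The quotient by a cover ideal as a Stanley-Reisner ring *)

Section CoverQuotient.

Variables (V : finType) (G : rel V) (k : fieldType).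
Local Notation n := #|V|.
Local Notation Q := {mpoly k[n]}.
Variable I : idealr Q.
Hypothesis IE : forall p, p \in I <-> cover_ideal G k p.
Local Notation R := {ideal_quot I}.
Local Notation pi := (\pi_R : Q -> R).

(* The other vertices are covers by themselves, so their variables vanish in [R]. *)
Definition big_vertices : {set V} := [set v | ~~ vertex_cover G [set v]].
Local Notation e := #|big_vertices|.

Definition vertex_of (i : 'I_e) : V := enum_val i.

Definition cq_cover (S : {set 'I_e}) : bool := vertex_cover G [set vertex_of i | i in S].

Definition cq_var (i : 'I_e) : R := pi 'X_(enum_rank (vertex_of i)).

Definition cq_lift (u : 'X_{1..e}) : 'X_{1..n} :=
  [multinom (\sum_(i < e | enum_rank (vertex_of i) == j) u i)%N | j < n].

(** Any representative will do: a monomial whose support is not a cover has the same coefficient in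
    all of them. The monomials that vanish in the quotient get 0. *)
Definition cq_coef (u : 'X_{1..e}) (r : R) : k :=
  if cq_cover (mnm_support u) then 0 else (repr r)@_(cq_lift u).

Lemma vertex_of_inj : injective vertex_of.
Proof. exact: enum_val_inj. Qed.

Lemma cq_liftE u i : cq_lift u (enum_rank (vertex_of i)) = u i.
Proof.
rewrite mnmE (big_pred1 i) // => j.
by rewrite (inj_eq enum_rank_inj) (inj_eq vertex_of_inj).
Qed.

Lemma cq_lift_out u v : v \notin big_vertices -> cq_lift u (enum_rank v) = 0%N.
Proof.
move=> nv; rewrite mnmE big1 // => i; rewrite (inj_eq enum_rank_inj) => /eqP iv.
by have := enum_valP i; rewrite -/(vertex_of i) iv (negbTE nv).
Qed.

Lemma vertex_ofP v : v \in big_vertices -> exists i, v = vertex_of i.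
Proof. by move=> vE; exists (enum_rank_in vE v); rewrite /vertex_of enum_rankK_in. Qed.

Lemma cq_lift_support u : vsupport (cq_lift u) = [set vertex_of i | i in mnm_support u].
Proof.
apply/setP => v; rewrite inE; apply/idP/imsetP => [uv|[i + ->]]; last by rewrite inE cq_liftE.
have [vE|vE] := boolP (v \in big_vertices); last by rewrite cq_lift_out in uv.
by have [i iE] := vertex_ofP vE; exists i => //; rewrite inE -(cq_liftE u) -iE.
Qed.

Lemma cq_liftD u w : cq_lift (u + w)%MM = (cq_lift u + cq_lift w)%MM.
Proof. by apply/mnmP => j; rewrite mnmDE !mnmE -big_split; apply: eq_bigr => i _; rewrite mnmDE. Qed.

Lemma cq_lift1 i : cq_lift U_(i)%MM = U_(enum_rank (vertex_of i))%MM.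
Proof.
apply/mnmP => j; rewrite mnmE mnm1E; case: eqP => [<-|nj].
  rewrite (big_pred1 i) ?mnm1E ?eqxx // => l.
  by rewrite (inj_eq enum_rank_inj) (inj_eq vertex_of_inj).
rewrite big1 // => l /eqP lj; rewrite mnm1E; case: eqP => // il.
by case: nj; rewrite il lj.
Qed.

Lemma cq_ker p : pi p = 0 <-> cover_ideal G k p.
Proof.
by rewrite -IE -[p in p \in I]subr0 Quotient.idealrBE -(rmorph0 pi); split=> [->//|/eqP].
Qed.

Lemma cq_coefE u p : cq_coef u (pi p) =
  if cq_cover (mnm_support u) then 0 else p@_(cq_lift u).
Proof.
rewrite /cq_coef; case: ifP => // nu; apply/eqP; rewrite -subr_eq0 -mcoeffB.
have : cover_ideal G k (repr (pi p) - p) by apply/cq_ker; rewrite rmorphB /= reprK subrr.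
move/cover_idealP/(_ (cq_lift u)); rewrite cq_lift_support -/(cq_cover _) nu.
by case: eqP => // _ /(_ isT).
Qed.

Hypothesis no_cover0 : ~~ vertex_cover G set0.

Lemma vertex_cover_small w v : v \notin big_vertices -> v \in vsupport w ->
  vertex_cover G (vsupport w).
Proof.
rewrite inE negbK => cv vw; apply: vertex_cover_sub cv; by rewrite sub1set.
Qed.

Lemma cq_stanley_reisner : stanley_reisner (quot_const I) cq_var cq_cover cq_coef.
Proof.
have iotaE c : quot_const I c = pi c%:MP by [].
have up (A B : {set 'I_e}) : A \subset B -> cq_cover A -> cq_cover B.
  by move=> AB; apply: vertex_cover_sub; apply: imsetS.
pose low (w : 'X_{1..n}) : 'X_{1..e} := [multinom w (enum_rank (vertex_of i)) | i < e].
(* A monomial either involves only big vertices or is divisible by a variable that is zero in the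
   quotient. *)
have restr w : w = cq_lift (low w) \/
    exists2 v, v \notin big_vertices & v \in vsupport w.
  case: (boolP (vsupport w \subset big_vertices)) => [/subsetP sw|/subsetPn[v vw vE]]; last first.
    by right; exists v.
  left; apply/mnmP => j; rewrite -(enum_valK j).
  have [/vertex_ofP[i ->]|vE] := boolP (enum_val j \in big_vertices).
    by rewrite cq_liftE mnmE.
  rewrite cq_lift_out //; apply/eqP; rewrite -leqn0 leqNgt; apply: contra vE => wj.
  by apply: sw; rewrite inE.
have monE u : xmon cq_var u = pi 'X_[cq_lift u].
  have -> : cq_lift u = (\sum_i U_(enum_rank (vertex_of i)) *+ u i)%MM.
    apply/mnmP => j; rewrite mnmE mnm_sumE [LHS]big_mkcond; apply: eq_bigr => i _.
    by rewrite mulmnE mnm1E; case: eqP; rewrite ?mul1n ?mul0n.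
  rewrite (big_morph (fun w => 'X_[k, w]) (@mpolyXD _ _) (@mpolyX0 _ _)) rmorph_prod.
  by apply: eq_bigr => i _; rewrite -mpolyXn rmorphXn.
split.
- exact: up.
- by rewrite /cq_cover imset0.
- by move=> i; rewrite /cq_cover imset_set1; have := enum_valP i; rewrite inE.
- by move=> u r s; rewrite -[r]reprK -[s]reprK -rmorphD !cq_coefE; case: ifP; rewrite ?addr0 ?mcoeffD.
- move=> u c r; rewrite -[r]reprK iotaE -rmorphM !cq_coefE; case: ifP; rewrite ?mulr0 //.
  by rewrite mcoeffCM.
- by move=> u r Nu; rewrite /cq_coef -/(nonface cq_cover u) Nu.
- move=> u i r Nu; rewrite -[r]reprK -rmorphM !cq_coefE -!/(nonface cq_cover _) (negbTE Nu).
  case: ltnP => ui; last first.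
    rewrite mulrC mcoeffMX_if; case: mnm_lepP => // /(_ (enum_rank (vertex_of i))).
    by rewrite mnm1E eqxx cq_liftE ltnNge ui.
  have Eu : u = (U_(i) + (u - U_(i)))%MM by rewrite addmC submK // lep1mP -lt0n.
  rewrite ifF; last first.
    apply: contraNF Nu; apply: up; apply/subsetP => j; rewrite !inE mnmBE => uj.
    exact: leq_trans uj (leq_subr _ _).
  by rewrite {1}Eu cq_liftD cq_lift1 mulrC mcoeffMX.
- move=> u; rewrite -(rmorph1 pi) cq_coefE mcoeff1; case: ifP => Nu.
    case: eqP => // u0; move: Nu; rewrite u0 (_ : mnm_support _ = set0).
      by rewrite /cq_cover imset0 (negbTE no_cover0).
    by apply/setP => i; rewrite !inE mnm0E.
  congr (_%:R); congr nat_of_bool; apply/eqP/eqP => [E|->].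
    by apply/mnmP => i; rewrite -cq_liftE E !mnm0E.
  by apply/mnmP => j; rewrite mnmE mnm0E big1 // => i _; rewrite mnm0E.
- move=> r r0; rewrite -[r]reprK; apply/cq_ker/cover_idealP => w pw.
  have [E|[v vE vw]] := restr w; last exact: vertex_cover_small vE vw.
  set u := low w in E; have := r0 u; rewrite -[r]reprK cq_coefE -E.
  rewrite E cq_lift_support -/(cq_cover _); case: (cq_cover _) => //.
  by rewrite -E => r0'; rewrite r0' eqxx in pw.
move=> r; pose p := repr r.
exists [seq low w | w <- [seq w <- msupp p | vsupport w \subset big_vertices]].
exists (fun u => p@_(cq_lift u)).
rewrite big_map big_filter -[LHS]reprK -/p {1}[p]mpolyE rmorph_sum /=.
rewrite (bigID (fun w => vsupport w \subset big_vertices)) /= [X in _ + X]big1 ?addr0.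
  apply: eq_bigr => w sw; rewrite monE; have [<-|[v vE vw]] := restr w; last first.
    by have := subsetP sw v vw; rewrite (negbTE vE).
  by rewrite -mul_mpolyC rmorphM.
move=> w /subsetPn[v vw vE]; apply/cq_ker/cover_idealP => w'.
rewrite mcoeffZ mcoeffX; case: (w =P w') => [<- _|_]; last by rewrite mulr0 eqxx.
exact: vertex_cover_small vE vw.
Qed.

Lemma cq_max_ideal r : quot_max_ideal (I := I) r <-> cq_coef 0%MM r = 0.
Proof.
have SR := cq_stanley_reisner.
split=> [[l [a [g [gP ->]]]]|r0].
  rewrite (co_sum SR) big1 // => i _; have [j ->] := gP i.
  rewrite -[a i]reprK -rmorphM cq_coefE; case: ifP => // _.
  rewrite mcoeffMX_if; case: mnm_lepP => // /(_ j).
  rewrite mnm1E eqxx (_ : cq_lift 0%MM = 0%MM) ?mnm0E //.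
  by apply/mnmP => q; rewrite mnmE mnm0E big1 // => i' _; rewrite mnm0E.
have [s ->] := max_ideal_gen SR r0.
exists e, s, cq_var; split; first by move=> i; exists (enum_rank (vertex_of i)).
by apply: eq_bigr => i _; rewrite mulrC.
Qed.

End CoverQuotient.

(** * Graphs with and without a bipartite core *)

Section CoverGraph.

Variables (V : finType) (G : rel V) (k : fieldType).
Hypothesis Gsym : symmetric G.
Hypothesis Girr : irreflexive G.

(* [G] is [K_(m, n)] with [m, n >= 2], up to isolated vertices. *)
Definition bipartite_core (A B : {set V}) : Prop :=
  [/\ [disjoint A & B], vertex_cover G A && vertex_cover G B,
      (2 <= #|A|)%N && (2 <= #|B|)%N &
      forall a b, a \in A -> b \in B -> G a b].

(** A cover that misses a vertex of A contains all neighbours of this vertex, hence B. *)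
Lemma core_cover A B S : bipartite_core A B ->
  vertex_cover G S = (A \subset S) || (B \subset S).
Proof.
move=> [dAB /andP[cA cB] _ AB]; apply/idP/orP => [cS|[AS|BS]];
  [|exact: (vertex_cover_sub AS cA)|exact: (vertex_cover_sub BS cB)].
have [AS|/subsetPn[a aA aS]] := boolP (A \subset S); first by left.
right; apply/subsetP => b bB; have := vertex_coverP _ _ cS _ _ (AB a b aA bB).
by rewrite (negbTE aS).
Qed.

Lemma core_no_cover0 A B : bipartite_core A B -> ~~ vertex_cover G set0.
Proof.
move=> bc; rewrite (core_cover _ bc) !subset0; case: bc => _ _ /andP[A2 B2] _.
by rewrite -!cards_eq0 negb_or -!lt0n (ltnW A2) (ltnW B2).
Qed.

Lemma minimal_cover_edge A v : vertex_cover G A -> ~~ vertex_cover G (A :\ v) ->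
  exists w, G v w.
Proof.
move=> /vertex_coverP cA ncA; apply/existsP; apply: contraR ncA.
rewrite negb_exists => /forallP H; apply/vertex_coverP => p q Gpq.
have pv : p != v by apply: contraTneq Gpq => ->.
have qv : q != v by apply: contraTneq Gpq => ->; rewrite Gsym.
by rewrite !in_setD1 pv qv; apply: cA.
Qed.

(** Each edge has one end in A and the other in B; to avoid all the remaining vertices it would have
    to be {a, b}. *)
Lemma cover_minus_nonedge (A B : {set V}) a b :
  [disjoint A & B] -> vertex_cover G A -> vertex_cover G B ->
  a \in A -> b \in B -> ~~ G a b -> vertex_cover G ((A :|: B) :\: [set a; b]).
Proof.
move=> dAB cA cB aA bB nab.
have two t t' : G t t' -> t \in A -> t' \in B ->
    (t \in (A :|: B) :\: [set a; b]) || (t' \in (A :|: B) :\: [set a; b]).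
  move=> Gt tA t'B; rewrite !in_setD !in_setU tA t'B orbT !andbT !in_set1.
  have tb : t != b by apply: contraTneq tA => ->; rewrite (disjointFl dAB bB).
  have t'a : t' != a by apply: contraTneq t'B => ->; rewrite (disjointFr dAB aA).
  rewrite (negbTE tb) (negbTE t'a) orbF /= -negb_and.
  by apply/negP => /andP[/eqP ta /eqP t'b]; rewrite -ta -t'b Gt in nab.
apply/vertex_coverP => p q Gpq.
case/orP: (vertex_coverP _ _ cA _ _ Gpq) => pA; case/orP: (vertex_coverP _ _ cB _ _ Gpq) => pB.
- by have := disjointFr dAB pA; rewrite pB.
- exact: two.
- by rewrite orbC; apply: two => //; rewrite Gsym.
by have := disjointFr dAB pA; rewrite pB.
Qed.

Lemma golod_of_no_core : (forall A B, ~ bipartite_core A B) ->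
  golod_ideal (cover_ideal G k).
Proof.
move=> nocore I IE.
(* If the empty set is a cover, J(G) is the unit ideal, which no [idealr] represents. *)
have [c0|nc0] := boolP (vertex_cover G set0).
  have : 1 \in I.
    apply/IE/cover_idealP => w _; apply: vertex_cover_sub c0; exact: sub0set.
  by rewrite idealr1.
have SR := cq_stanley_reisner IE nc0.
pose e := #|big_vertices G|; pose ev := @vertex_of V G.
(* The non-isolated big vertices. Two disjoint minimal covers partition [U], so a condition on the
   complement of T in [U] does not mention the second cover. *)
pose U : {set 'I_e} := [set i | [exists w, G (ev i) w]].
(* T = {a, b} will be a non-edge between two disjoint covers A and B; the condition is
   symmetric in A and B, so that [rho A] and [rho B] come from the same T. *)
pose P (A T : {set 'I_e}) := [&& T \subset U, #|T| == 2, #|T :&: A| == 1%N & cq_cover (U :\: T)].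
pose rho (A : {set 'I_e}) : {set 'I_e} := if [pick T | P A T] is Some T then T :&: A else set0.
have evinj : injective ev by apply: vertex_of_inj.
have dimg (A B : {set 'I_e}) : [disjoint A & B] -> [disjoint [set ev i | i in A] & [set ev i | i in B]].
  move=> dAB; rewrite -setI_eq0 -imsetI; last by move=> ? ? _ _; apply: evinj.
  by move: dAB; rewrite -setI_eq0 => /eqP->; rewrite imset0.
(* If the end i were in neither cover, the other end w would be in both. *)
have cc (A B : {set 'I_e}) i w : [disjoint A & B] -> cq_cover A -> cq_cover B -> G (ev i) w ->
    (i \in A) || (i \in B).
  move=> dAB /vertex_coverP/(_ (ev i) w) cA /vertex_coverP/(_ (ev i) w) cB Giw.
  have := cA Giw; have := cB Giw; rewrite !(mem_imset _ _ evinj).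
  case: (i \in A) => //=; case: (i \in B) => //= wB wA.
  by have := disjointFr (dimg _ _ dAB) wA; rewrite wB.
have mU (A : {set 'I_e}) : minimal_cover (@cq_cover V G) A -> A \subset U.
  move=> [cA mA]; apply/subsetP => i iA; rewrite inE.
  have := mA i iA; rewrite /cq_cover.
  have -> : [set ev j | j in A :\ i] = [set ev j | j in A] :\ ev i.
    apply/setP => v; rewrite !inE; apply/imsetP/andP => [[j + ->]|[vi /imsetP[j jA vj]]].
      by rewrite !inE (inj_eq evinj) => /andP[ji jA]; split => //; apply: imset_f.
    by exists j => //; rewrite !inE jA andbT; apply: contraNneq vi => <-; rewrite vj.
  by move=> /(minimal_cover_edge cA)[w Gw]; apply/existsP; exists w.
apply: (golod_stanley_reisner SR (@cq_max_ideal _ _ _ _ IE nc0) (rho := rho)).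
- move=> A B v dAB cA cB vA cAv S.
  have iso w : ~~ G (ev v) w.
    have dAvB : [disjoint A :\ v & B] := disjointWl (subD1set _ _) dAB.
    apply/negP => Gw; have := cc _ _ _ _ dAvB cAv cB Gw.
    by rewrite !inE eqxx (disjointFr dAB vA).
  apply/idP/idP; first by apply: (sr_up SR); apply: subD1set.
  move=> /vertex_coverP cS; apply/vertex_coverP => p q Gpq.
  have aux t t' : G t t' -> t \in [set ev j | j in S] -> t \in [set ev j | j in S :\ v].
    move=> Gt /imsetP[j jS tj]; rewrite tj mem_imset // !inE jS andbT.
    by apply: contraTneq Gt => jv; rewrite tj jv; apply: iso.
  case/orP: (cS p q Gpq) => /aux H; first by rewrite (H q).
  by rewrite (H p) ?orbT // Gsym.
move=> A B dAB mA mB; have [cA nA] := mA; have [cB nB] := mB.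
have UE : U = A :|: B.
  apply/eqP; rewrite eqEsubset subUset !mU // !andbT; apply/subsetP => i.
  by rewrite !inE => /existsP[w]; apply: cc.
(* T has two elements in U, one of them in X, so the other one is in Y. *)
have PU (X Y T : {set 'I_e}) : [disjoint X & Y] -> U = X :|: Y -> P X T -> P Y T.
  move=> dXY UXY /and4P[TU T2 T1 cT]; apply/and4P; split=> //.
  have := cardsID X T; rewrite (eqP T1) (eqP T2) (_ : T :\: X = T :&: Y).
    by move=> /eqP; rewrite add1n eqSS.
  apply/setP => i; rewrite !inE; case: (boolP (i \in T)) => iT; rewrite ?andbF //= andbT.
  have := subsetP TU i iT; rewrite UXY inE; have := disjointFr dXY (x := i).
  by case: (i \in X) => /= [->|_ ->].
have PE T : P A T = P B T.
  by apply/idP/idP; apply: PU; rewrite // ?UE ?[B :|: A]setUC // disjoint_sym.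
(* A and B have at least two vertices each, since no single big vertex is a cover. As they do not
   form a core, there is a non-edge {a, b} between them, which serves as T by
   [cover_minus_nonedge]. *)
have [T PT] : exists T, P A T.
  have size2 (X : {set 'I_e}) : cq_cover X -> (2 <= #|[set ev i | i in X]|)%N.
    move=> cX; rewrite card_imset // ltnNge; apply/negP => X1.
    have [X0|[i iX]] := set_0Vmem X.
      by have := sr_set0 SR; rewrite -X0 cX.
    have := sr_set1 SR i; rewrite (_ : [set i] = X) ?cX //.
    by apply/eqP; rewrite eqEcard sub1set iX cards1 X1.
  have [a [b [aA bB nab]]] : exists a b, [/\ a \in A, b \in B & ~~ G (ev a) (ev b)].
    apply: NNPP => H; apply: (nocore [set ev i | i in A] [set ev i | i in B]); split.
    - exact: dimg.
    - exact/andP.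
    - by rewrite !size2.
    move=> _ _ /imsetP[a aA ->] /imsetP[b bB ->]; apply: contraT => nab.
    by case: H; exists a, b.
  have ab : a != b by apply: contraTneq aA => ->; rewrite (disjointFl dAB bB).
  exists [set a; b]; apply/and4P; split.
  - by rewrite UE subUset !sub1set !inE aA bB orbT.
  - by rewrite cards2 ab.
  - rewrite (_ : _ :&: _ = [set a]) ?cards1 //; apply/setP => i; rewrite !inE.
    case: (i =P a) => [->|_] /=; first by rewrite aA.
    by case: (i =P b) => [->|//]; rewrite (disjointFl dAB bB).
  apply: (vertex_cover_sub _ (cover_minus_nonedge _ cA cB _ _ nab)); rewrite ?imset_f ?dimg //.
  apply/subsetP => v; rewrite !inE => /andP[vab vAB].
  have [i iU vi] : exists2 i, i \in U & v = ev i.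
    by case/orP: vAB => /imsetP[i iX vi]; exists i => //; rewrite UE inE iX ?orbT.
  by move: vab; rewrite vi !(inj_eq evinj) => iab; apply: imset_f; rewrite in_setD iU !inE iab.
have rhoE : exists2 T0, P A T0 & rho A = T0 :&: A /\ rho B = T0 :&: B.
  rewrite /rho (_ : [pick T | P B T] = [pick T | P A T]); last first.
    by apply: eq_pick => T0; rewrite PE.
  by case: pickP => [T0 PT0|/(_ T)]; [exists T0|rewrite PT].
have [T0 /and4P[TU _ /cards1P[a aE] cT] [-> ->]] := rhoE; split.
  by exists a => //; have := set11 a; rewrite -aE inE => /andP[].
move: cT; congr (is_true (cq_cover _)); rewrite UE; apply/setP => i; rewrite !inE.
by case: (i \in T0); case: (i \in A); case: (i \in B).
Qed.

Lemma not_golod_of_core A B : bipartite_core A B -> ~ golod_ideal (cover_ideal G k).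
Proof.
move=> bc; have nc0 := core_no_cover0 bc.
have IE p : p \in cover_idealr k nc0 <-> cover_ideal G k p.
  by apply: iff_sym; apply: (rwP (cover_predP nc0 p)).
move=> /(_ (cover_idealr k nc0) IE); have SR := cq_stanley_reisner IE nc0.
have [dAB _ /andP[A2 B2] _] := bc.
pose ev := @vertex_of V G.
have evinj : injective ev by apply: vertex_of_inj.
(* Both sides have at least two vertices and every cover contains one of them, so no single vertex
   is a cover. *)
have evA (X : {set V}) : X = A \/ X = B -> X \subset big_vertices G.
  move=> XE; apply/subsetP => v _; rewrite inE (core_cover _ bc) negb_or.
  apply/andP; split; apply/negP => /subset_leq_card; rewrite cards1 leqNgt.
    by rewrite A2.
  by rewrite B2.
have sub (X : {set V}) (S : {set 'I_#|big_vertices G|}) : X \subset big_vertices G ->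
    (X \subset [set ev i | i in S]) = (ev @^-1: X \subset S).
  move=> XE; apply/subsetP/subsetP => [H i|H v vX]; first by rewrite inE => /H; rewrite mem_imset.
  have [i vi] := vertex_ofP (subsetP XE v vX); rewrite vi mem_imset //; apply: H.
  by rewrite inE -/ev /ev -vi.
apply: (complete_intersection_not_golod SR (@cq_max_ideal _ _ _ _ IE nc0)
  (A := ev @^-1: A) (B := ev @^-1: B)) => [S|].
  by rewrite /cq_cover (core_cover _ bc) !sub //; apply: evA; [right|left].
rewrite -setI_eq0 -preimsetI; move: dAB; rewrite -setI_eq0 => /eqP->.
by rewrite preimset0.
Qed.

Lemma core_complete_intersection A B : bipartite_core A B ->
  complete_intersection_two_monomials (cover_ideal G k).
Proof.
move=> bc; have [dAB _ /andP[A2 B2] _] := bc.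
exists (vmono A), (vmono B); rewrite !vmono_deg; split => //.
  apply/regular_pairP; rewrite ?vmono_deg; try exact: ltnW.
  move=> i; rewrite -(enum_valK i) !vmonoE !eqb0.
  by case: (boolP (_ \in A)) => //= /(disjointFr dAB)->.
move=> p; rewrite cover_idealP -/(map (fun u => 'X_[k, u]) [:: vmono A; vmono B]).
rewrite ideal_gen_seqX; split=> H w /H.
  rewrite (core_cover _ bc) -!vmono_le => /orP[] le; eexists; try exact: le.
    by rewrite !inE eqxx.
  by rewrite !inE eqxx orbT.
rewrite (core_cover _ bc) -!vmono_le => -[u].
by rewrite !inE => /orP[]/eqP-> ->; rewrite ?orbT.
Qed.

(** The sides are the supports of the two monomials, disjoint by regularity. A missing edge {a, b}
    would make A :|: B without a and b a cover, and its monomial is divisible by neither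
    generator. *)
Lemma complete_intersection_core : complete_intersection_two_monomials (cover_ideal G k) ->
  exists A B, bipartite_core A B.
Proof.
move=> [u [v [u2 v2 reg JE]]].
have dis : forall i, (u i == 0%N) || (v i == 0%N).
  by apply/(regular_pairP k) => //; apply: ltnW.
have cE w : vertex_cover G (vsupport w) = (u <= w)%MM || (v <= w)%MM.
  have X1 : ('X_[k, w])@_w != 0 by apply/mcoeffX_neq0.
  apply/idP/orP => [cw|H].
    have /JE : cover_ideal G k 'X_[w] by apply/cover_idealP => w' /mcoeffX_neq0 <-.
    rewrite -/(map (fun u => 'X_[k, u]) [:: u; v]) ideal_gen_seqX => /(_ w X1)[u'].
    by rewrite !inE => /orP[]/eqP-> ->; [left|right].
  have /JE/cover_idealP/(_ w X1) // : ideal_gen (fun z => z \in [:: 'X_[k, u]; 'X_[v]]) 'X_[k, w].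
  rewrite -/(map (fun u => 'X_[k, u]) [:: u; v]) ideal_gen_seqX => w' /mcoeffX_neq0 <-.
  by case: H => H; [exists u|exists v]; rewrite ?inE ?eqxx ?orbT.
pose A := vsupport u; pose B := vsupport v.
have cAE S : vertex_cover G S = (u <= vmono S)%MM || (v <= vmono S)%MM.
  by rewrite -cE vmono_support.
have cA : vertex_cover G A by rewrite cE lepm_refl.
have cB : vertex_cover G B by rewrite cE lepm_refl orbT.
have dAB : [disjoint A & B].
  rewrite -setI_eq0; apply/eqP/setP => x; rewrite !inE !lt0n -negb_or.
  by rewrite dis.
have nle (w w' : 'X_{1..#|V|}) : (0 < mdeg w)%N -> (forall i, (w i == 0%N) || (w' i == 0%N)) ->
    (w <= vmono (vsupport w'))%MM = false.
  move=> w0 dw; apply/negP => /mnm_lepP le; move: w0; rewrite lt0n mdeg_eq0 => /eqP; apply.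
  apply/mnmP => i; rewrite mnm0E; case/orP: (dw i) => /eqP // wi; apply/eqP; rewrite -leqn0.
  by apply: leq_trans (le i) _; rewrite mnmE inE enum_valK wi.
exists A, B; split => //; first exact/andP.
  (* The squarefree monomial of A lies in J(G) and is not divisible by x^v, so x^u divides it and A
     has at least mdeg u elements; likewise for B. *)
  rewrite -!vmono_deg; have := cA; have := cB; rewrite !cAE /A /B.
  rewrite (nle u v) ?(ltnW u2) // (nle v u) ?(ltnW v2) ?orbF //=; last first.
    by move=> i; rewrite orbC.
  move=> vB uA; apply/andP; split.
    apply: leq_trans u2 _; rewrite !mdegE; apply: leq_sum => i _; exact/mnm_lepP.
  apply: leq_trans v2 _; rewrite !mdegE; apply: leq_sum => i _; exact/mnm_lepP.
move=> a b aA bB; apply: contraT => nab.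
have := cover_minus_nonedge dAB cA cB aA bB nab.
rewrite cAE => /orP[]/mnm_lepP.
  move=> /(_ (enum_rank a)); rewrite vmonoE !inE eqxx /=.
  by move: aA; rewrite inE; case: (u _).
move=> /(_ (enum_rank b)); rewrite vmonoE !inE eqxx orbT /=.
by move: bB; rewrite inE; case: (v _).
Qed.

(** Without isolated vertices two disjoint covers exhaust V; the complement of a cover is
    independent, so both sides are. *)
Lemma core_complete_bipartite : no_isolated_vertex G ->
  (exists A B, bipartite_core A B) <->
  exists m n : nat, complete_bipartite G m n /\ (2 <= minn m n)%N.
Proof.
move=> noiso; split=> [[A [B [dAB /andP[cA cB] /andP[A2 B2] AB]]]|].
  exists #|A|, #|B|; rewrite leq_min A2 B2; split=> //; exists A, B; split=> //.
    apply/setP => x; rewrite !inE; have [y Gxy] := noiso x.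
    have := vertex_coverP _ _ cA _ _ Gxy; have := vertex_coverP _ _ cB _ _ Gxy.
    case: (x \in A) => //=; case: (x \in B) => //= yB yA.
    by have := disjointFr dAB yA; rewrite yB.
  move=> x y; apply/idP/orP => [Gxy|[]/andP[]]; [|exact: AB|].
    have := vertex_coverP _ _ cA _ _ Gxy; have := vertex_coverP _ _ cB _ _ Gxy.
    have := disjointFr dAB (x := x); have := disjointFr dAB (x := y).
    case: (x \in A) => /=; case: (y \in A) => /=; case: (x \in B) => /=; case: (y \in B) => //=;
      by move=> H1 H2; try (by have := H1 isT); try (by have := H2 isT); auto.
  by move=> xB yA; rewrite Gsym; apply: AB.
move=> [m [n [[A [B [dAB UAB Am Bn GE]]] mn]]]; exists A, B.
move: mn; rewrite leq_min -Am -Bn => mn; split=> //; last by move=> a b aA bB; rewrite GE aA bB.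
apply/andP; split; apply/vertex_coverP => x y; rewrite GE => /orP[]/andP[H H'];
  by rewrite ?H ?H' ?orbT.
Qed.

End CoverGraph.

Theorem theorem2 (k : fieldType) (V : finType) (G : rel V)
    (Gsym : symmetric G) (Girr : irreflexive G) :
  (~ golod_ideal (cover_ideal G k) <->
     complete_intersection_two_monomials (cover_ideal G k))
  /\ (no_isolated_vertex G ->
       (complete_intersection_two_monomials (cover_ideal G k) <->
        exists m n : nat, complete_bipartite G m n /\ (2 <= minn m n)%N)).
Proof.
(* The existence of a core is the condition with which all the others are compared. *)
have ci_core : complete_intersection_two_monomials (cover_ideal G k) <->
    exists A B, bipartite_core G A B.
  split; first exact: complete_intersection_core.
  by move=> [A [B]]; apply: core_complete_intersection.
split; last by move=> noiso; rewrite ci_core; apply: core_complete_bipartite.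
rewrite ci_core; split=> [ng|[A [B bc]]]; last exact: not_golod_of_core bc.
apply: NNPP => nc; apply/ng/golod_of_no_core => // A B bc; apply: nc.
by exists A, B.
Qed.
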